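(* Let $0<q<1$, $0<a<q^{-1}$, $0<b<q^{-1}$, $c<0$. Put $\mu(m)=q^{-m}+ab\,q^{m+1}$ for $m=0,1,2,\dots$, and let $D_n(\mu(m))\equiv D_n(\mu(m);a,b,c|q)$, $n=0,1,2,\dots$, be the dual big $q$-Jacobi polynomials. Then for all nonnegative integers $n,n'$ $$\sum_{m=0}^\infty\frac{(1-abq^{2m+1})(aq,abq,abq/c;q)_m}{(1-abq)(bq,cq,q;q)_m}\,(-c/a)^m q^{m(m-1)/2}D_n(\mu(m))D_{n'}(\mu(m))=\frac{(abq^2,c/a;q)_\infty}{(bq,cq;q)_\infty}\,\frac{(aq/c,q;q)_n}{(aq,abq/c;q)_n\,q^n}\,\delta_{nn'} .$$ Moreover, the polynomials $D_n$ correspond to an indeterminate moment problem, and the orthogonality measure given by this relation (supported on the points $\mu(m)$, $m=0,1,2,\dots$) is not extremal.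
   Context: Notation: $(x;q)_k=\prod_{j=0}^{k-1}(1-xq^j)$, $(x;q)_\infty=\prod_{j\ge0}(1-xq^j)$, $(x_1,\dots,x_r;q)_k=\prod_i(x_i;q)_k$. ${}_3\phi_2(\alpha_1,\alpha_2,\alpha_3;\beta_1,\beta_2;q,z)=\sum_{k\ge0}\frac{(\alpha_1,\alpha_2,\alpha_3;q)_k}{(\beta_1,\beta_2,q;q)_k}z^k$. Dual big $q$-Jacobi polynomials: $D_n(\mu(m);a,b,c|q)={}_3\phi_2(q^{-m},abq^{m+1},q^{-n};\,aq,abq/c;\,q,aq^{n+1}/c)$, a polynomial of degree $n$ in $\mu(m)=q^{-m}+abq^{m+1}$, since $(q^{-m},abq^{m+1};q)_k=\prod_{j=0}^{k-1}(1+abq^{2j+1}-q^j\mu(m))$. The quotient $(1-abq^{2m+1})(abq;q)_m/(1-abq)$ is understood with the common factor $1-abq$ cancelled. A family of polynomials corresponds to an indeterminate (Hamburger) moment problem if it is orthogonal with respect to more than one normalized positive measure on $\mathbb{R}$. In the indeterminate case an orthogonality measure $\mu$ is called extremal if it comes from a constant (possibly infinite) parameter in the Nevanlinna parametrization; equivalently (M. Riesz), if the polynomials are complete in $L^2(\mu)$. *)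

(* Defs.v *)
From HB Require Import structures.
From mathcomp Require Import all_boot all_order all_algebra.
From mathcomp Require Import all_classical all_reals all_analysis.
From mathcomp Require Import complex.
From mathcomp Require Import ring.

Set Implicit Arguments.
Unset Strict Implicit.
Unset Printing Implicit Defensive.

Import Order.TTheory GRing.Theory Num.Theory.
Import numFieldNormedType.Exports.

Local Open Scope classical_set_scope.
Local Open Scope ring_scope.

Definition qpoch {R : realType} (q x : R) (k : nat) : R :=
  \prod_(j < k) (1 - x * q ^+ j).

Definition qpoch_inf {R : realType} (q x : R) : R := limn (qpoch q x).

Definition phi32 {R : realType} (x1 x2 x3 y1 y2 q z : R) : R :=
  limn (series (fun k =>
    qpoch q x1 k * qpoch q x2 k * qpoch q x3 k /
    (qpoch q y1 k * qpoch q y2 k * qpoch q q k) * z ^+ k)).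

Definition dual_lattice {R : realType} (q a b : R) (m : nat) : R :=
  q ^- m + a * b * q ^+ m.+1.

(* The 3phi2 series of the dual big q-Jacobi polynomial, in which
   (q^-m, a b q^(m+1); q)_k is replaced by the polynomial in mu(m) it is equal
   to.  The sum stops at k = n because (q^-n; q)_k = 0 for k > n; the relation
   with phi32 is lemma dbqJE below. *)
Definition dbqJ {R : realType} (q a b c : R) (n : nat) : {poly R} :=
  \sum_(k < n.+1)
    (qpoch q (q ^- n) k /
       (qpoch q (a * q) k * qpoch q (a * b * q / c) k * qpoch q q k) *
     (a * q ^+ n.+1 / c) ^+ k) *:
    \prod_(j < k) ((1 + a * b * q ^+ (2 * j).+1)%:P - q ^+ j *: 'X).

Lemma qpoch_lattice {R : realType} (q a b : R) (m k : nat) : q != 0 ->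
  \prod_(j < k) (1 + a * b * q ^+ (2 * j).+1 - q ^+ j * dual_lattice q a b m) =
  qpoch q (q ^- m) k * qpoch q (a * b * q ^+ m.+1) k.
Proof.
move=> q0; rewrite /qpoch -big_split /=; apply: eq_bigr => j _.
rewrite /dual_lattice !exprS mulnC exprM expr2.
have : q ^+ m != 0 by rewrite expf_neq0.
by move: (q ^+ m) (q ^+ j) => u v u0; field.
Qed.

Lemma dbqJE {R : realType} (q a b c : R) (n m : nat) : q != 0 ->
  (dbqJ q a b c n).[dual_lattice q a b m] =
  phi32 (q ^- m) (a * b * q ^+ m.+1) (q ^- n) (a * q) (a * b * q / c) q
        (a * q ^+ n.+1 / c).
Proof.
move=> q0; rewrite /phi32; set t := (fun k => _ * _).
have tE k : (k > n)%N -> t k = 0.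
  move=> nk; rewrite /t; suff -> : qpoch q (q ^- n) k = 0 by rewrite mulr0 !mul0r.
  rewrite /qpoch (bigD1 (Ordinal nk)) //= mulVf ?expf_neq0 // subrr.
  by rewrite mul0r.
have seriesE i : series t (i + n.+1)%N = series t n.+1.
  elim: i => // i IH; rewrite addSn -{}IH /series /= big_nat_recr //= tE ?addr0//.
  by rewrite addnS ltnS leq_addl.
transitivity (series t n.+1); last first.
  apply/esym/cvg_lim => //; rewrite -(cvg_shiftn n.+1).
  by rewrite (_ : (fun _ => _) = cst (series t n.+1));
    [exact: cvg_cst | apply/funext => i /=; exact: seriesE].
rewrite /dbqJ horner_sum /series /= big_mkord; apply: eq_bigr => k _.
rewrite hornerZ horner_prod -/(qpoch _ _ _) /t -qpoch_lattice //.
under eq_bigr do rewrite hornerD hornerN hornerZ hornerX hornerC.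
by rewrite mulrC !mulrA.
Qed.

(* The case distinction cancels the factor 1 - abq in
   (1 - a b q^(2m+1)) (abq; q)_m / (1 - abq), which makes sense even if
   abq = 1. *)
Definition dbqJ_weight {R : realType} (q a b c : R) (m : nat) : R :=
  (if m is k.+1 then
     (1 - a * b * q ^+ (2 * m).+1) * qpoch q (a * b * q ^+ 2) k
   else 1) *
  (qpoch q (a * q) m * qpoch q (a * b * q / c) m /
   (qpoch q (b * q) m * qpoch q (c * q) m * qpoch q q m)) *
  (- c / a) ^+ m * q ^+ (m * m.-1)./2.

Definition dbqJ_norm {R : realType} (q a b c : R) (n : nat) : R :=
  qpoch_inf q (a * b * q ^+ 2) * qpoch_inf q (c / a) /
  (qpoch_inf q (b * q) * qpoch_inf q (c * q)) *
  (qpoch q (a * q / c) n * qpoch q q n /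
   (qpoch q (a * q) n * qpoch q (a * b * q / c) n * q ^+ n)).

Definition orthogonality_measure {R : realType} (P : nat -> {poly R})
    (mu : probability (measurableTypeR R) R) : Prop :=
  (forall k : nat, mu.-integrable setT (fun x : R => (x ^+ k)%:E)) /\
  (forall n n' : nat, n != n' ->
     Rintegral mu setT (fun x : R => (P n).[x] * (P n').[x]) = 0) /\
  (forall n : nat, 0 < Rintegral mu setT (fun x : R => (P n).[x] ^+ 2)).

Definition indeterminate {R : realType} (P : nat -> {poly R}) : Prop :=
  exists mu nu : probability (measurableTypeR R) R,
    [/\ orthogonality_measure P mu, orthogonality_measure P nu &
        exists2 A : set (measurableTypeR R), measurable A & mu A <> nu A].

Definition orthonormalized {R : realType}
    (mu : probability (measurableTypeR R) R) (P : nat -> {poly R}) (n : nat) :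
    {poly R} :=
  (Num.sqrt (Rintegral mu setT (fun x : R => (P n).[x] ^+ 2)))^-1 *: P n.

(* Polynomial of the second kind: the integral of (p(z) - p(x)) / (z - x) over
   dmu(x).  The (exact) quotient is a polynomial in z that is integrated
   coefficientwise. *)
Definition second_kind {R : realType}
    (mu : probability (measurableTypeR R) R) (p : {poly R}) : {poly R} :=
  \poly_(j < size p)
    Rintegral mu setT (fun x : R => ((p - p.[x]%:P) %/ ('X - x%:P))`_j).

Definition cseries {R : realType} (u : nat -> R[i]) : R[i] :=
  Complex (limn (series (fun n => complex.Re (u n))))
          (limn (series (fun n => complex.Im (u n)))).

Definition cintegral {R : realType} (mu : probability (measurableTypeR R) R)
    (f : R -> R[i]) : R[i] :=
  Complex (Rintegral mu setT (fun x : R => complex.Re (f x)))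
          (Rintegral mu setT (fun x : R => complex.Im (f x))).

Definition ceval {R : realType} (p : {poly R}) (z : R[i]) : R[i] :=
  (map_poly (real_complex R) p).[z].

Definition stieltjes {R : realType} (mu : probability (measurableTypeR R) R)
    (z : R[i]) : R[i] :=
  cintegral mu (fun x => (real_complex R x - z)^-1).

(* The entire functions A, B, C, D of the Nevanlinna parametrization, in
   Akhiezer's normalization (A D - B C = 1). *)
Section Nevanlinna.
Context {R : realType} (mu : probability (measurableTypeR R) R).
Context (P : nat -> {poly R}).
Let p := orthonormalized mu P.
Let r n := second_kind mu (p n).

Definition nevanlinnaA (z : R[i]) : R[i] :=
  z * cseries (fun n => ceval (r n) 0 * ceval (r n) z).
Definition nevanlinnaB (z : R[i]) : R[i] :=
  -1 + z * cseries (fun n => ceval (r n) 0 * ceval (p n) z).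
Definition nevanlinnaC (z : R[i]) : R[i] :=
  1 + z * cseries (fun n => ceval (p n) 0 * ceval (r n) z).
Definition nevanlinnaD (z : R[i]) : R[i] :=
  z * cseries (fun n => ceval (p n) 0 * ceval (p n) z).

(* The Nevanlinna parametrization
     int dmu(x) / (x - z) = - (A(z) phi(z) - C(z)) / (B(z) phi(z) - D(z))
   for a constant parameter phi = t; None stands for t = oo. *)
Definition nevanlinna_const (t : option R) (z : R[i]) : R[i] :=
  if t is Some s then
    - (nevanlinnaA z * real_complex R s - nevanlinnaC z) /
      (nevanlinnaB z * real_complex R s - nevanlinnaD z)
  else - nevanlinnaA z / nevanlinnaB z.

Definition extremal : Prop :=
  exists t : option R, forall z : R[i], complex.Im z != 0 ->
    stieltjes mu z = nevanlinna_const t z.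
End Nevanlinna.

(* The normalized measure with masses proportional to the weights; it is pinned
   down by its values on Borel sets. *)
Definition is_dbqJ_measure {R : realType} (q a b c : R)
    (mu : probability (measurableTypeR R) R) : Prop :=
  forall A : set (measurableTypeR R), measurable A ->
    mu A = (\sum_(0 <= m <oo)
      (dbqJ_weight q a b c m / limn (series (dbqJ_weight q a b c)))%:E *
      \d_(dual_lattice q a b m : measurableTypeR R) A)%E.

(* Main.v *)
Require Import Defs.
From HB Require Import structures.
From mathcomp Require Import all_boot all_order all_algebra.
From mathcomp Require Import all_classical all_reals all_analysis.
From mathcomp Require Import measurable_realfun complex.
From mathcomp Require Import ring lra.

Set Implicit Arguments.
Unset Strict Implicit.
Unset Printing Implicit Defensive.

Import Order.TTheory GRing.Theory Num.Theory.
Import numFieldNormedType.Exports.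

Local Open Scope classical_set_scope.
Local Open Scope ring_scope.

(** Write [A = a b q], [beta = a b q / c], [x_m] for the lattice points, [w_m]
    for the weights and [(.)_k] for q-shifted factorials.

    Orthogonality.  The polynomials [phi_k = (q^-m, A q^m)_k] and
    [psi_j = (beta q^m, q^-m / c)_j] of the lattice variable are adapted to the
    weights: multiplication by [phi_k] turns the weights for [(a, b, c)] into
    weights for [(a q^k, b q^k, c q^k)] on a shifted lattice
    ([weight_shift]), and multiplication by [psi_j] replaces [c] by [c q^-j]
    ([weight_psi]).  Hence every sum [sum_m w_m phi_k psi_j] reduces to the
    total mass, a limiting very-well-poised 6phi5 sum.  The mass is found by
    comparing [(a, b, c)] with [(a, b q, c q)] through a telescoping series and
    iterating ([mass_telescope], [massE]).  Summing over [k] against the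
    coefficients of [D_n] gives the q-Vandermonde sum [(q^-j)_n / (beta)_n],
    which vanishes for [j < n] ([wmom_dbqJ_psi]).

    An annihilator.  The sequence
    [h_m = (1 - A q^(2m)) (A)_m / ((1 - A) (q)_m) (-1)^m q^(m(m-1)/2)]
    satisfies [sum_m h_m p(x_m) = 0] for every polynomial [p]
    ([annihilator_poly]: the sums telescope), while [h_m / w_m] grows only
    geometrically.  So [h / w] is a nonzero element of L^2 of the measure that
    is orthogonal to all polynomials, and the last two claims follow.

    Indeterminacy.  If [h / w] is bounded, then [w + eps h] is another
    solution.  In general, divide [h] by [G = prod_(i < r) (x - y_i)], where
    [y_i] lies slightly to the left of [x_i].  By Lagrange interpolation the
    sums [sum_m h_m p(x_m) / G(x_m)] are combinations of the [p(y_i)]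
    ([newpt_quadrature]), and because the signs of [h] alternate, all the
    coefficients have one sign.  For [r] large, moving a small multiple of
    [h / G] into point masses at the [y_i] gives a positive measure with the
    same moments ([second_solution]).

    Non-extremality.  Let [u_n] be the n-th Fourier coefficient of
    [1 / (x - z)] with respect to the orthonormal polynomials.  Green's formula
    for the three-term recurrence and the Plücker relation between Wronskians
    express [sum_n |u_n|^2] through the Nevanlinna functions
    ([projection_norm]); if the Stieltjes transform were the one of a constant
    parameter, [sum_n |u_n|^2] would equal the squared norm of [1 / (x - z)].
    But [h / w] divided by a suitable power of [x - z] is orthogonal to the
    polynomials and not to [1 / (x - z)] ([annihilator_at]), so Bessel's
    inequality is strict ([second_fun_strict]).  The same sequences show that
    the values of the orthonormal polynomials at [z] and at [0] are
    square-summable ([ceval_l2]), as needed for the Nevanlinna functions to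
    converge. *)

(** * Rapidly decreasing and tame sequences *)

(** The sum of a series; it is used on convergent series only. *)
Definition ssum {R : realType} (u : nat -> R) : R := limn (series u).

(** [u_m = O(q^(k m))] for every [k], as for sequences of the size of
    [q^(m(m-1)/2)]. *)
Definition rapid {R : realType} (q : R) (u : nat -> R) : Prop :=
  forall k : nat, exists K : R, forall m, `|u m| <= K * q ^+ (k * m).

(** At most geometric growth, [f_m = O(q^(-k m))] for some [k].  Tame sequences
    form an algebra, and multiplying by them preserves rapid decrease, so that
    all the sums below converge absolutely. *)
Definition tame {R : realType} (q : R) (f : nat -> R) : Prop :=
  exists k : nat, exists K : R, forall m, `|f m| * q ^+ (k * m) <= K.

Section RapidTame.
Context {R : realType} (q : R) (q0 : 0 < q) (q1 : q < 1).
Implicit Types u v f g : nat -> R.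

Lemma expq_gt0 n : 0 < q ^+ n. Proof. exact: exprn_gt0. Qed.

Lemma expq_ge0 n : 0 <= q ^+ n. Proof. exact/ltW/expq_gt0. Qed.

Lemma expq_le1 n : q ^+ n <= 1.
Proof. by rewrite exprn_ile1 ?ltW. Qed.

Lemma rapid_bound_ge0 u k K : (forall m, `|u m| <= K * q ^+ (k * m)) -> 0 <= K.
Proof. by move/(_ 0); rewrite muln0 mulr1; exact: le_trans. Qed.

Lemma rapid_normed_cvg u : rapid q u -> cvgn [normed series u].
Proof.
move=> /(_ 1%N)[K HK].
apply: (@series_le_cvg _ (fun m => `|u m|) (geometric K q)) => [m|m|m|].
- exact: normr_ge0.
- by rewrite /geometric /= mulr_ge0 ?(rapid_bound_ge0 HK)// exprn_ge0 ?ltW.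
- by have := HK m; rewrite mul1n.
- by apply: is_cvg_geometric_series; rewrite ger0_norm ?ltW.
Qed.

Lemma rapid_cvg u : rapid q u -> cvgn (series u).
Proof. by move=> /rapid_normed_cvg/normed_cvg. Qed.

Lemma rapid_cvg_to u : rapid q u -> series u @ \oo --> ssum u.
Proof. exact: rapid_cvg. Qed.

Lemma rapid_cvg0 u : rapid q u -> u @ \oo --> (0 : R).
Proof. by move=> /rapid_cvg /cvg_series_cvg_0. Qed.

Lemma rapid_le u v : (forall m, `|u m| <= `|v m|) -> rapid q v -> rapid q u.
Proof.
by move=> uv rv k; have [K HK] := rv k; exists K => m; exact: le_trans (HK m).
Qed.

Lemma rapid_norm u : rapid q u -> rapid q (fun m => `|u m|).
Proof. by apply: rapid_le => m; rewrite normr_id. Qed.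

Lemma rapidD u v : rapid q u -> rapid q v -> rapid q (fun m => u m + v m).
Proof.
move=> ru rv k; have [K HK] := ru k; have [L HL] := rv k.
by exists (K + L) => m; rewrite mulrDl (le_trans (ler_normD _ _))// lerD.
Qed.

Lemma rapidZ c u : rapid q u -> rapid q (fun m => c * u m).
Proof.
move=> ru k; have [K HK] := ru k.
by exists (`|c| * K) => m; rewrite normrM -mulrA ler_wpM2l.
Qed.

Lemma rapidMtame u f : rapid q u -> tame q f -> rapid q (fun m => u m * f m).
Proof.
move=> ru [k [K HK]] j; have [L HL] := ru (k + j)%N.
have L0 := rapid_bound_ge0 HL.
exists (L * K) => m; rewrite normrM.
apply: (@le_trans _ _ (L * q ^+ ((k + j) * m) * `|f m|)).
  by rewrite ler_wpM2r.
rewrite mulnDl exprD (_ : L * _ * _ = L * q ^+ (j * m) * (`|f m| * q ^+ (k * m))).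
  by rewrite [leRHS]mulrAC ler_wpM2l// mulr_ge0 ?expq_ge0.
by ring.
Qed.

Lemma tame_cst c : tame q (fun=> c).
Proof. by exists 0%N, `|c| => m; rewrite mul0n mulr1. Qed.

Lemma tame_le f g : (forall m, `|f m| <= `|g m|) -> tame q g -> tame q f.
Proof.
move=> fg [k [K HK]]; exists k, K => m; apply: le_trans (HK m).
by rewrite ler_wpM2r ?expq_ge0.
Qed.

Lemma tameD f g : tame q f -> tame q g -> tame q (fun m => f m + g m).
Proof.
move=> [k [K HK]] [j [L HL]]; exists (k + j)%N, (K + L) => m.
rewrite mulnDl exprD.
apply: (@le_trans _ _ ((`|f m| + `|g m|) * (q ^+ (k * m) * q ^+ (j * m)))).
  by rewrite ler_wpM2r ?ler_normD// mulr_ge0 ?expq_ge0.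
rewrite mulrDl lerD//.
  rewrite mulrA; apply: le_trans (HK m).
  by rewrite ler_piMr ?expq_le1// mulr_ge0 ?expq_ge0.
rewrite mulrCA; apply: le_trans (HL m).
by rewrite ler_piMl ?expq_le1// mulr_ge0 ?expq_ge0.
Qed.

Lemma tameM f g : tame q f -> tame q g -> tame q (fun m => f m * g m).
Proof.
move=> [k [K HK]] [j [L HL]]; exists (k + j)%N, (K * L) => m.
rewrite mulnDl exprD normrM mulrACA ler_pM//.
all: by rewrite mulr_ge0 ?expq_ge0.
Qed.

Lemma tameZ c f : tame q f -> tame q (fun m => c * f m).
Proof. by move=> tf; apply: tameM => //; exact: tame_cst. Qed.

Lemma tameN f : tame q f -> tame q (fun m => - f m).
Proof. by apply: tame_le => m; rewrite normrN. Qed.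

Lemma tame_sum (I : Type) (r : seq I) (F : I -> nat -> R) :
  (forall i, tame q (F i)) -> tame q (fun m => \sum_(i <- r) F i m).
Proof.
move=> tF; elim: r => [|i r IH].
  by apply: tame_le (tame_cst 0) => m; rewrite big_nil.
by apply: tame_le (tameD (tF i) IH) => m; rewrite big_cons.
Qed.

Lemma tame_exp f n : tame q f -> tame q (fun m => f m ^+ n).
Proof.
move=> tf; elim: n => [|n IH]; first exact: (tame_cst 1).
by apply: tame_le (tameM tf IH) => m; rewrite exprS.
Qed.

Lemma tame_horner (p : {poly R}) f : tame q f -> tame q (fun m => p.[f m]).
Proof.
move=> tf; apply: tame_le (tame_sum (index_enum 'I_(size p))
  (fun i => tameZ p`_i (tame_exp i tf))) => m.
by rewrite horner_coef.
Qed.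

Lemma ratio_tame f C : (forall m, `|f m.+1| <= C * `|f m|) -> tame q f.
Proof.
move=> Hf; have [k Ck] : exists k : nat, C * q ^+ k <= 1.
  have : (fun k => C * q ^+ k) @ \oo --> C * 0.
    by apply: cvgM; [exact: cvg_cst|apply: cvg_expr; rewrite ger0_norm ?ltW].
  rewrite mulr0 => /cvgr_le /(_ 1 ltr01) [k _ Hk].
  by exists k; apply: Hk => /=.
exists k, `|f 0| => m; elim: m => [|m IH]; first by rewrite muln0 mulr1.
apply: le_trans IH; rewrite mulnS exprD.
apply: (@le_trans _ _ (C * `|f m| * (q ^+ k * q ^+ (k * m)))).
  by rewrite ler_wpM2r// mulr_ge0 ?expq_ge0.
rewrite mulrACA ler_piMl// mulr_ge0 ?expq_ge0//.
Qed.

Lemma ratio_rapid u C : (forall m, `|u m.+1| <= C * q ^+ m * `|u m|) ->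
  rapid q u.
Proof.
move=> Hu k.
have [N CN] : exists N : nat, forall m, (N <= m)%N -> C * q ^+ m <= q ^+ k.
  have : (fun k => C * q ^+ k) @ \oo --> C * 0.
    by apply: cvgM; [exact: cvg_cst|apply: cvg_expr; rewrite ger0_norm ?ltW].
  rewrite mulr0 => /cvgr_le /(_ _ (expq_gt0 k)) [N _ HN].
  by exists N => m Nm; apply: HN.
pose K := \sum_(i < N.+1) `|u i| / q ^+ (k * i).
have HK i : (i <= N)%N -> `|u i| <= K * q ^+ (k * i).
  rewrite -ltnS => iN; rewrite -ler_pdivrMr ?expq_gt0//.
  rewrite /K (bigD1 (Ordinal iN)) //= lerDl sumr_ge0// => j _.
  by rewrite divr_ge0 ?expq_ge0.
exists K => m; case: (leqP m N) => [/HK//|]; elim: m => // m IH.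
rewrite ltnS leq_eqVlt => Nm.
have {IH} IH : `|u m| <= K * q ^+ (k * m).
  by case/orP: Nm => [/eqP <-|/IH //]; exact: HK.
have Nm' : (N <= m)%N by case/orP: Nm => [/eqP <-|/ltnW].
apply: (le_trans (Hu m)).
apply: (@le_trans _ _ (q ^+ k * `|u m|)); first by rewrite ler_wpM2r ?CN.
by rewrite mulnS exprD mulrCA ler_wpM2l ?expq_ge0.
Qed.

Lemma ssumE u v : u =1 v -> ssum u = ssum v.
Proof. by move=> /funext ->. Qed.

Lemma ssumD u v : rapid q u -> rapid q v ->
  ssum (fun m => u m + v m) = ssum u + ssum v.
Proof. by move=> /rapid_cvg cu /rapid_cvg cv; rewrite -lim_seriesD. Qed.

Lemma ssumZ c u : rapid q u -> ssum (fun m => c * u m) = c * ssum u.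
Proof. by move=> /rapid_cvg cu; exact: (lim_seriesZ c cu). Qed.

Lemma ler_ssum u v : rapid q u -> rapid q v -> (forall m, u m <= v m) ->
  ssum u <= ssum v.
Proof. by move=> /rapid_cvg cu /rapid_cvg cv uv; exact: lim_series_le. Qed.

Lemma ssum0 : ssum (fun=> 0 : R) = 0.
Proof.
apply/cvg_lim => //; rewrite (_ : series _ = cst 0); first exact: cvg_cst.
by apply/funext => n; rewrite /series /= big1.
Qed.

Lemma ssum_ge0 u : rapid q u -> (forall m, 0 <= u m) -> 0 <= ssum u.
Proof.
move=> ru u0; rewrite -ssum0; apply: ler_ssum => //.
by apply: rapid_le ru => m; rewrite normr0.
Qed.

Lemma ler_norm_ssum u : rapid q u -> `|ssum u| <= ssum (fun m => `|u m|).
Proof. by move=> ru; exact/lim_series_norm/rapid_normed_cvg. Qed.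

Lemma rapid_shift u : rapid q u -> rapid q (fun m => u m.+1).
Proof.
move=> ru k; have [K HK] := ru k; exists K => m; apply: le_trans (HK _) _.
rewrite ler_wpM2l ?(rapid_bound_ge0 HK)// mulnS exprD.
by rewrite ler_piMl ?expq_le1 ?expq_ge0.
Qed.

Lemma ssum_recl u : rapid q u -> ssum u = u 0%N + ssum (fun m => u m.+1).
Proof.
move=> ru; apply/cvg_lim => //; rewrite -cvg_shiftS.
rewrite (_ : (fun _ => _) =
    (fun n => u 0%N + series (fun m => u m.+1) n)); last first.
  by apply/funext => n; rewrite /series /= big_nat_recl.
by apply: cvgD; [exact: cvg_cst|exact/rapid_cvg/rapid_shift].
Qed.

Lemma ssum_ge_term u i : rapid q u -> (forall m, 0 <= u m) -> u i <= ssum u.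
Proof.
move=> ru u0; apply: (@le_trans _ _ (series u i.+1)).
  by rewrite /series /= big_nat_recr//= lerDr sumr_ge0.
apply: nondecreasing_cvgn_le; last exact: rapid_cvg.
by apply/nondecreasing_seqP => n; rewrite /series /= big_nat_recr//= lerDl.
Qed.

End RapidTame.

(** * q-shifted factorials and the weights *)

Section Qpoch.
Context {R : realType}.
Implicit Types q x y : R.

Lemma qpoch0 q x : qpoch q x 0 = 1.
Proof. by rewrite /qpoch big_ord0. Qed.

Lemma qpochSr q x k : qpoch q x k.+1 = qpoch q x k * (1 - x * q ^+ k).
Proof. by rewrite /qpoch big_ord_recr. Qed.

Lemma qpochSl q x k : qpoch q x k.+1 = (1 - x) * qpoch q (x * q) k.
Proof.
rewrite /qpoch big_ord_recl expr0 mulr1; congr (_ * _).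
by apply: eq_bigr => j _; rewrite /= /bump /= add1n exprS mulrA.
Qed.

Lemma triS m : ((m.+1 * m)./2 = (m * m.-1)./2 + m)%N.
Proof. by rewrite -{1}[m]/(m.+1.-1) -!bin2 binS bin1. Qed.

Context (q : R) (q0 : 0 < q) (q1 : q < 1).

Let qge0 n : 0 <= q ^+ n. Proof. by rewrite exprn_ge0 ?ltW. Qed.
Let qle1 n : q ^+ n <= 1. Proof. by rewrite exprn_ile1 ?ltW. Qed.

Lemma mulq_lt1 x k : 0 <= x < 1 -> x * q ^+ k < 1.
Proof.
move=> /andP[x0 x1]; apply: le_lt_trans x1.
by rewrite ler_piMr.
Qed.

Lemma qpoch_gt0 x k : x < 1 -> 0 < qpoch q x k.
Proof.
move=> x1; apply: prodr_gt0 => j _; rewrite subr_gt0.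
have [x0|x0] := leP 0 x; first by rewrite mulq_lt1 ?x0.
by apply: lt_trans ltr01; rewrite nmulr_rlt0 ?exprn_gt0.
Qed.

Lemma qpoch_neq0 x k : x < 1 -> qpoch q x k != 0.
Proof. by move=> x1; rewrite gt_eqF ?qpoch_gt0. Qed.

Lemma qpoch_le1 x k : 0 <= x < 1 -> qpoch q x k <= 1.
Proof.
move=> x1; apply: prodr_ile1 => j _; rewrite subr_ge0 ltW ?mulq_lt1//=.
by rewrite gerBl mulr_ge0 ?qge0//; case/andP: x1.
Qed.

Lemma qpoch_ge1 x k : x <= 0 -> 1 <= qpoch q x k.
Proof.
move=> x0; elim: k => [|k IH]; first by rewrite qpoch0.
rewrite qpochSr -[leLHS]mulr1 ler_pM// lerDl oppr_ge0.
by rewrite mulr_le0_ge0.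
Qed.

Lemma qpoch_antimono x y k : x <= y -> y < 1 -> qpoch q y k <= qpoch q x k.
Proof.
move=> xy y1; elim: k => [|k IH]; first by rewrite !qpoch0.
rewrite !qpochSr ler_pM//.
- by rewrite ltW ?qpoch_gt0.
- rewrite subr_ge0; have [y0|y0] := leP 0 y; first by rewrite ltW ?mulq_lt1 ?y0.
  by apply: le_trans ler01; rewrite nmulr_rle0 ?qge0.
- by rewrite lerB// ler_wpM2r ?qge0.
Qed.

(** A product of factors [1 + O(q^n)] is bounded. *)
Lemma growth_bounded (u : nat -> R) C : 0 <= C -> (forall n, 0 <= u n) ->
  (forall n, u n.+1 <= (1 + C * q ^+ n) * u n) ->
  forall n, u n <= expR (C / (1 - q)) * u 0%N.
Proof.
move=> C0 u0 uS n.
have H : u n <= expR (C * \sum_(j < n) q ^+ j) * u 0%N.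
  elim: n => [|n IH]; first by rewrite big_ord0 mulr0 expR0 mul1r.
  apply: le_trans (uS n) _; rewrite big_ord_recr /= mulrDr expRD.
  apply: (@le_trans _ _ ((1 + C * q ^+ n) * (expR (C * \sum_(j < n) q ^+ j) * u 0%N))).
    by rewrite ler_wpM2l// addr_ge0// mulr_ge0 ?qge0.
  rewrite mulrA [X in _ <= X * _]mulrC ler_wpM2r//.
  by rewrite ler_wpM2r ?expR_ge0// expR_ge1Dx.
apply: le_trans H _; rewrite ler_wpM2r// ler_expR ler_wpM2l//.
have -> : \sum_(j < n) q ^+ j = (1 - q ^+ n) / (1 - q).
  by rewrite -opprB subrX1 -mulNr opprB mulrAC mulfV ?mul1r// subr_eq0 gt_eqF.
by rewrite ler_pdivrMr ?subr_gt0// mulVf ?subr_eq0 ?gt_eqF// gerBl exprn_ge0 ?ltW.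
Qed.

(** For [x <= 0] the products increase; for [0 <= x < 1] their inverses do. *)
Lemma qpoch_bounded x : x <= 0 -> exists K, forall n, qpoch q x n <= K.
Proof.
move=> x0; exists (expR (- x / (1 - q)) * qpoch q x 0).
have x1 : x < 1 := le_lt_trans x0 ltr01.
apply: growth_bounded => [|n|n]; first by rewrite oppr_ge0.
  by rewrite ltW ?qpoch_gt0.
by rewrite qpochSr mulrC mulNr.
Qed.

Lemma qpochV_bounded x : 0 <= x < 1 -> exists K, forall n, (qpoch q x n)^-1 <= K.
Proof.
move=> /andP[x0 x1]; exists (expR (x / (1 - x) / (1 - q)) * (qpoch q x 0)^-1).
have x1' : 0 < 1 - x by rewrite subr_gt0.
apply: (@growth_bounded (fun n => (qpoch q x n)^-1)) => [|n|n].
- by rewrite divr_ge0// ltW.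
- by rewrite invr_ge0 ltW ?qpoch_gt0.
- have p0 : 0 <= (qpoch q x n)^-1 by rewrite invr_ge0 ltW ?qpoch_gt0.
  rewrite qpochSr invfM mulrC ler_wpM2r//.
  have qn : 0 < q ^+ n by rewrite exprn_gt0.
  have qn1 : q ^+ n <= 1 by rewrite exprn_ile1 ?ltW.
  have H : 0 < 1 - x * q ^+ n by rewrite subr_gt0 mulq_lt1 ?x0.
  rewrite -[X in X <= _]mul1r ler_pdivrMr//.
  rewrite -subr_ge0.
  rewrite (_ : _ - 1 = x ^+ 2 * q ^+ n * (1 - q ^+ n) / (1 - x)); last by field; rewrite gt_eqF.
  by rewrite divr_ge0 ?mulr_ge0 ?sqr_ge0 ?subr_ge0// ltW.
Qed.

Lemma qpoch_cvg x : x < 1 -> cvgn (qpoch q x).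
Proof.
move=> x1; have [x0|x0] := leP 0 x.
  apply: (@nonincreasing_is_cvgn _ (qpoch q x)).
    apply/nonincreasing_seqP => n; rewrite qpochSr ler_piMr//; first by rewrite ltW ?qpoch_gt0.
    by rewrite gerBl mulr_ge0 ?qge0.
  by exists 0 => _ [n _ <-]; rewrite ltW ?qpoch_gt0.
have [K HK] := qpoch_bounded (ltW x0).
apply: (@nondecreasing_is_cvgn _ (qpoch q x)).
  apply/nondecreasing_seqP => n; rewrite qpochSr ler_peMr//; first by rewrite ltW ?qpoch_gt0// (lt_trans x0).
  by rewrite lerDl oppr_ge0 mulr_le0_ge0// ltW.
by exists K => _ [n _ <-].
Qed.

Lemma qpoch_inf_cvg x : x < 1 -> qpoch q x n @[n --> \oo] --> qpoch_inf q x.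
Proof. exact: qpoch_cvg. Qed.

Lemma qpoch_inf_gt0 x : x < 1 -> 0 < qpoch_inf q x.
Proof.
move=> x1; have [x0|x0] := leP 0 x; last first.
  apply: lt_le_trans ltr01 _; apply: limr_ge; first exact: qpoch_cvg.
  by apply: nearW => n; apply/qpoch_ge1/ltW.
have /qpochV_bounded[K HK] : 0 <= x < 1 by rewrite x0.
have K0 : 0 < K.
  by apply: lt_le_trans (HK 0%N); rewrite qpoch0 invr1.
apply: (@lt_le_trans _ _ K^-1); first by rewrite invr_gt0.
apply: limr_ge; first exact: qpoch_cvg.
apply: nearW => n.
by rewrite -[leRHS]invrK lef_pV2// posrE ?invr_gt0 ?qpoch_gt0.
Qed.

End Qpoch.

(** The well-poised factor [(1 - B q^(2m)) (B; q)_m / (1 - B)], with [1 - B]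
    cancelled so that it makes sense for [B = 1]. *)
Definition wpoised {R : realType} (q B : R) (m : nat) : R :=
  if m is k.+1 then (1 - B * q ^+ (2 * m)) * qpoch q (B * q) k else 1.

(** The hypotheses on the parameters; they are stable under the shifts by
    powers of [q] that are needed. *)
Definition params {R : realType} (q a b c : R) : Prop :=
  [/\ 0 < a, a * q < 1, 0 < b, b * q < 1 & c < 0].

Section Weight.
Context {R : realType} (q : R) (q0 : 0 < q) (q1 : q < 1).
Implicit Types a b c : R.

Let qge0 n : 0 <= q ^+ n. Proof. by rewrite exprn_ge0 ?ltW. Qed.
Let qle1 n : q ^+ n <= 1. Proof. by rewrite exprn_ile1 ?ltW. Qed.

Lemma weightE a b c m : dbqJ_weight q a b c m =
  wpoised q (a * b * q) m *
  (qpoch q (a * q) m * qpoch q (a * b * q / c) m /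
   (qpoch q (b * q) m * qpoch q (c * q) m * qpoch q q m)) *
  (- c / a) ^+ m * q ^+ (m * m.-1)./2.
Proof.
rewrite /dbqJ_weight /wpoised; do 3 congr (_ * _).
by case: m => // k; rewrite exprS expr2 !mulrA.
Qed.

Lemma params_shift a b c j k l : params q a b c ->
  params q (a * q ^+ j) (b * q ^+ k) (c * q ^+ l).
Proof.
move=> [a0 aq b0 bq c0].
have H x n : 0 < x -> x * q < 1 -> x * q ^+ n * q < 1.
  move=> x0 xq; apply: le_lt_trans xq.
  by rewrite ler_wpM2r ?(ltW q0)// ler_piMr ?(ltW x0).
by split; rewrite ?mulr_gt0 ?H ?nmulr_rlt0 ?exprn_gt0.
Qed.

Lemma params_shiftc a b c j : params q a b c -> params q a b (c * q ^- j).
Proof.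
by move=> [a0 aq b0 bq c0]; split => //; rewrite nmulr_rlt0 ?invr_gt0 ?exprn_gt0.
Qed.

Lemma params_lt1 a b c : params q a b c ->
  [/\ 0 < a * q < 1, 0 < b * q < 1, c * q < 0, 0 < a * b * q ^+ 2 < 1 &
      a * b * q / c < 0].
Proof.
move=> [a0 aq b0 bq c0].
have abq : a * b * q ^+ 2 = (a * q) * (b * q) by ring.
split.
- by rewrite aq mulr_gt0.
- by rewrite bq mulr_gt0.
- by rewrite nmulr_rlt0.
- by rewrite abq !mulr_gt0//= mulr_ilt1// mulr_ge0// ltW.
- by rewrite pmulr_rlt0 ?invr_lt0// !mulr_gt0.
Qed.

Lemma wpoised_gt0_le1 B m : 0 <= B -> B * q < 1 -> 0 < wpoised q B m <= 1.
Proof.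
move=> B0 Bq; case: m => [|k] /=; first by rewrite ltr01 lexx.
have Bq' : 0 <= B * q < 1 by rewrite Bq mulr_ge0// ltW.
have H : B * q ^+ (2 * k.+1) < 1.
  rewrite (_ : B * _ = B * q * q ^+ (2 * k).+1) ?mulq_lt1//.
  by rewrite mulnS exprD expr2 exprS; ring.
apply/andP; split; first by rewrite mulr_gt0 ?qpoch_gt0 ?subr_gt0.
by rewrite mulr_ile1 ?qpoch_le1 ?gerBl ?mulr_ge0// ltW ?subr_gt0 ?qpoch_gt0.
Qed.

Lemma params_wpoised a b c m : params q a b c -> 0 < wpoised q (a * b * q) m <= 1.
Proof.
move=> H; have [_ _ _ /andP[_ abq] _] := params_lt1 H; case: H => a0 _ b0 _ _.
apply: wpoised_gt0_le1; first by rewrite !mulr_ge0// ltW.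
by rewrite expr2 mulrA in abq.
Qed.

Lemma weight_gt0 a b c m : params q a b c -> 0 < dbqJ_weight q a b c m.
Proof.
move=> H; rewrite weightE; have /andP[w0 _] := params_wpoised m H.
have [/andP[? ?] /andP[? ?] ? _ ?] := params_lt1 H; case: H => a0 _ b0 _ c0.
rewrite !mulr_gt0 ?exprn_gt0 ?invr_gt0 ?mulr_gt0 ?qpoch_gt0 ?oppr_gt0 ?invr_gt0//.
- exact: lt_trans ltr01.
- exact: lt_trans ltr01.
Qed.

(** The weights without their factors of absolute value at most [1]. *)
Definition wdom a b c m : R :=
  qpoch q (a * b * q / c) m / (qpoch q (b * q) m * qpoch q q m) *
  (- c / a) ^+ m * q ^+ (m * m.-1)./2.

Lemma wdom_gt0 a b c m : params q a b c -> 0 < wdom a b c m.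
Proof.
move=> H; have [/andP[? ?] /andP[? ?] ? _ ?] := params_lt1 H.
case: H => a0 _ b0 _ c0.
rewrite !mulr_gt0 ?exprn_gt0 ?invr_gt0 ?mulr_gt0 ?qpoch_gt0 ?oppr_gt0 ?invr_gt0//.
exact: lt_trans ltr01.
Qed.

Lemma wdom_rapid a b c : params q a b c -> rapid q (wdom a b c).
Proof.
move=> H; have [/andP[? ?] /andP[bq0 bq1] ? _ beta0] := params_lt1 H.
apply: (@ratio_rapid _ q q0 q1 _ ((1 - a * b * q / c) * (- c / a) / ((1 - b * q) * (1 - q)))).
move=> m; rewrite !gtr0_norm ?wdom_gt0//.
case: (H) => a0 _ b0 _ c0.
have ra : 0 < - c / a by rewrite divr_gt0 ?oppr_gt0.
rewrite [X in X <= _](_ : _ = (1 - a * b * q / c * q ^+ m) * (- c / a) /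
    ((1 - b * q * q ^+ m) * (1 - q * q ^+ m)) * q ^+ m * wdom a b c m); last first.
  rewrite /wdom /= triS !qpochSr exprS exprD !invfM; ring.
rewrite ler_wpM2r//; first by rewrite ltW ?wdom_gt0.
rewrite ler_wpM2r//.
have E x : 0 < x < 1 -> 0 < 1 - x /\ 1 - x <= 1 - x * q ^+ m.
  by move=> /andP[x0 x1]; rewrite subr_gt0 lerB// ler_piMr// ltW.
have [|d1 d2] := E (b * q); first exact/andP.
have [|e1 e2] := E q; first exact/andP.
have d3 := lt_le_trans d1 d2; have e3 := lt_le_trans e1 e2.
have f0 : 1 <= 1 - a * b * q / c * q ^+ m.
  by rewrite lerDl oppr_ge0 mulr_le0_ge0// ltW.
apply: ler_pM.
- by rewrite mulr_ge0 ?(ltW ra)// (le_trans ler01).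
- by rewrite invr_ge0 mulr_ge0// ltW.
- rewrite ler_wpM2r ?(ltW ra)// lerB// -[leLHS]mulr1.
  by rewrite ler_wnM2l// ltW.
- by rewrite lef_pV2 ?posrE ?mulr_gt0// ler_pM// ltW.
Qed.

(** Uniform domination along [(a, b q^n, c q^n)]. *)
Lemma weight_le a b c n m : params q a b c ->
  dbqJ_weight q a (b * q ^+ n) (c * q ^+ n) m <= q ^+ (n * m) * wdom a b c m.
Proof.
move=> H; have H' : params q a (b * q ^+ n) (c * q ^+ n).
  by have := params_shift 0 n n H; rewrite expr0 mulr1.
have [/andP[a0 a1] /andP[b0 b1] c0 _ beta0] := params_lt1 H.
have [_ /andP[b0' b1'] c0' _ _] := params_lt1 H'.
have [aa _ bb _ cc] := H.
have qn : q ^+ n != 0 by rewrite gt_eqF ?exprn_gt0.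
have bE : a * (b * q ^+ n) * q / (c * q ^+ n) = a * b * q / c.
  by field; rewrite qn lt_eqF.
rewrite weightE bE.
rewrite [X in X <= _](_ : _ = (wpoised q (a * (b * q ^+ n) * q) m *
    qpoch q (a * q) m * (qpoch q (c * q ^+ n * q) m)^-1) *
    (qpoch q (a * b * q / c) m * ((qpoch q (b * q ^+ n * q) m)^-1 * (qpoch q q m)^-1) *
   ((- c / a) ^+ m * q ^+ (m * m.-1)./2 * q ^+ (n * m)))); last first.
  rewrite exprM (_ : - (c * q ^+ n) / a = q ^+ n * (- c / a)); last by ring.
  rewrite exprMn !invfM; move: (- c / a) => r.
  by move: (r ^+ m) (q ^+ n ^+ m) => rm qnm; ring.
have rm : 0 <= (- c / a) ^+ m * q ^+ (m * m.-1)./2 * q ^+ (n * m).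
  by rewrite !mulr_ge0// exprn_ge0// divr_ge0 ?oppr_ge0// ltW.
have qp x : x < 1 -> 0 <= qpoch q x m by move=> ?; rewrite ltW ?qpoch_gt0.
have beta1 := lt_trans beta0 ltr01; have c1' := lt_trans c0' ltr01.
apply: (@le_trans _ _ (1 * (qpoch q (a * b * q / c) m * ((qpoch q (b * q) m)^-1 *
    (qpoch q q m)^-1) * ((- c / a) ^+ m * q ^+ (m * m.-1)./2 * q ^+ (n * m))))); last first.
  by rewrite mul1r /wdom invfM le_eqVlt; apply/orP; left; apply/eqP; ring.
have /andP[w0 w1] := params_wpoised m H'.
apply: ler_pM.
- by rewrite !mulr_ge0 ?invr_ge0 ?qp ?(ltW w0).
- rewrite mulr_ge0// mulr_ge0 ?qp// mulr_ge0 ?invr_ge0 ?qp//.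
- rewrite mulr_ile1 ?mulr_ge0 ?invr_ge0 ?qp ?(ltW w0)//.
    by rewrite mulr_ile1 ?qp ?(ltW w0) ?qpoch_le1// (ltW a0).
  by rewrite invf_le1 ?qpoch_gt0//; apply/qpoch_ge1/ltW.
- rewrite ler_wpM2r// ler_wpM2l ?qp// ler_wpM2r ?invr_ge0 ?qp//.
  rewrite lef_pV2 ?posrE ?qpoch_gt0//; apply: qpoch_antimono => //.
  by rewrite ler_wpM2r ?(ltW q0)// ler_piMr// ltW.
Qed.

Lemma weight_rapid a b c : params q a b c -> rapid q (dbqJ_weight q a b c).
Proof.
move=> H; apply: rapid_le (wdom_rapid H) => m.
have := weight_le 0 m H; rewrite !expr0 !mulr1 mul1r => wle.
by rewrite !gtr0_norm ?weight_gt0 ?wdom_gt0.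
Qed.

End Weight.

(** * The total mass *)

Section Mass.
Context {R : realType} (q : R) (q0 : 0 < q) (q1 : q < 1).
Implicit Types a b c : R.

Let qneq0 : q != 0. Proof. by rewrite gt_eqF. Qed.

(** The total mass of the unnormalized weights. *)
Definition mass a b c : R := ssum (dbqJ_weight q a b c).

Lemma mass_gt0 a b c : params q a b c -> 0 < mass a b c.
Proof.
move=> H; apply: lt_le_trans (weight_gt0 q0 q1 0 H) _.
apply: (ssum_ge_term q0 q1); first exact: weight_rapid.
by move=> m; rewrite ltW ?weight_gt0.
Qed.

(** Boundary term of the telescoping comparison of the weights at [(a, b, c)]
    and at [(a, b q, c q)]. *)
Definition mass_cert a b c m : R :=
  - ((1 - b * q) * (1 - c * q)) * qpoch q (a * b * q ^+ 2) m *
  (qpoch q (a * q) m.+1 * qpoch q (a * b * q / c) m.+1 /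
   (qpoch q (b * q) m.+1 * qpoch q (c * q) m.+1 * qpoch q q m)) *
  (- c / a) ^+ m.+1 * q ^+ (m.+1 * m)./2.

Lemma mass_telescope a b c m : params q a b c ->
  (1 - b * q) * (1 - c * q) * series (dbqJ_weight q a b c) m.+1 -
  (1 - a * b * q ^+ 2) * (1 - c / a) *
    series (dbqJ_weight q a (b * q) (c * q)) m.+1 = mass_cert a b c m.
Proof.
move=> H; have [_ /andP[_ b1] c1 /andP[_ ab1] _] := params_lt1 q0 H.
case: (H) => a0 _ b0 _ c0.
have an0 : a != 0 by rewrite gt_eqF.
have cn0 : c != 0 by rewrite lt_eqF.
have c1' : c * q < 1 := lt_trans c1 ltr01.
have bE : a * (b * q) * q / (c * q) = a * b * q / c by field; rewrite qneq0 cn0.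
elim: m => [|m IH].
  rewrite /series /= !big_nat1 /mass_cert /dbqJ_weight !qpoch0 !qpochSr !qpoch0 /=.
  rewrite !expr0 !expr1; field.
  by rewrite an0 cn0 !subr_eq0 !(eq_sym 1) !lt_eqF.
set w := dbqJ_weight q a b c in IH *.
set w' := dbqJ_weight q a (b * q) (c * q) in IH *.
have sS (u : nat -> R) : series u m.+2 = series u m.+1 + u m.+1.
  by rewrite /series /= big_nat_recr.
have split4 (X Y u v x y : R) :
  X * (u + x) - Y * (v + y) = (X * u - Y * v) + (X * x - Y * y) by ring.
rewrite !sS split4 {}IH /w /w' !weightE bE /wpoised /mass_cert.
have -> : a * (b * q) * q * q = a * b * q ^+ 2 * q by ring.
have -> : a * b * q * q = a * b * q ^+ 2 by ring.
have bS := qpochSl q (b * q) m.+1.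
have cS := qpochSl q (c * q) m.+1.
have aS := qpochSl q (a * b * q ^+ 2) m.
move: bS cS aS.
rewrite (qpochSr q (b * q) m.+1) (qpochSr q (c * q) m.+1)
  (qpochSr q (a * b * q ^+ 2) m) (qpochSr q q m)
  (qpochSr q (a * q) m.+1) (qpochSr q (a * b * q / c) m.+1).
have : qpoch q (b * q * q) m.+1 != 0.
  rewrite qpoch_neq0//; apply: le_lt_trans b1.
  by rewrite ler_piMr ?ltW ?mulr_gt0.
have : qpoch q (c * q * q) m.+1 != 0.
  by rewrite qpoch_neq0// (lt_trans _ ltr01)// !nmulr_rlt0.
have b1n : 1 - b * q != 0 by rewrite subr_eq0 eq_sym lt_eqF.
have c1n : 1 - c * q != 0 by rewrite subr_eq0 eq_sym lt_eqF.
have qmn : 1 - q * q ^+ m != 0.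
  by rewrite subr_eq0 eq_sym lt_eqF// -exprS exprn_ilt1 ?ltW.
have bqn : 1 - b * q * q ^+ m.+1 != 0.
  rewrite subr_eq0 eq_sym lt_eqF// mulq_lt1// b1 andbT.
  by rewrite mulr_ge0// ltW.
have cqn : 1 - c * q * q ^+ m.+1 != 0.
  rewrite subr_eq0 eq_sym lt_eqF// (lt_trans _ ltr01)//.
  by rewrite !nmulr_rlt0 ?exprn_gt0.
have := qpoch_neq0 q0 q1 m q1; have := qpoch_neq0 q0 q1 m.+1 b1.
have := qpoch_neq0 q0 q1 m.+1 c1'.
have Em : (m.+2 * m.+1)./2 = ((m.+1 * m)./2 + m.+1)%N := triS m.+1.
rewrite Em (_ : m.+1.-1 = m)// exprD.
have -> : q ^+ (2 * m.+1) = q ^+ m.+1 ^+ 2 by rewrite mulnC exprM.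
have -> : - (c * q) / a = (- c / a) * q by ring.
rewrite (exprMn _ (- c / a) q) (exprS _ m.+1).
have qmS : q ^+ m.+1 = q * q ^+ m by rewrite exprS.
move: bqn cqn; rewrite !qmS.
move: (qpoch q (b * q * q) m.+1) (qpoch q (c * q * q) m.+1) (qpoch q q m)
  (qpoch q (b * q) m.+1) (qpoch q (c * q) m.+1) (qpoch q (a * b * q ^+ 2 * q) m)
  (qpoch q (a * b * q ^+ 2) m) (qpoch q (a * q) m.+1)
  (qpoch q (a * b * q / c) m.+1) => BQ CQ Q Bm Cm AQ Am am bm.
move: qmn; move: (q ^+ (m.+1 * m)./2) (q ^+ m) ((- c / a) ^+ m.+1) => t y r.
move=> qmn bqn cqn Cm0 Bm0 Q0 CQ0 BQ0 BE CE AE.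
have {BE} BE : BQ = Bm * (1 - b * q * (q * y)) / (1 - b * q).
  by rewrite BE mulrC mulKf.
have {CE} CE : CQ = Cm * (1 - c * q * (q * y)) / (1 - c * q).
  by rewrite CE mulrC mulKf.
rewrite [X in _ + (_ - X) = _](_ : _ = (1 - c / a) *
    ((1 - a * b * q ^+ 2 * (q * y) ^+ 2) * ((1 - a * b * q ^+ 2) * AQ) *
    (am * bm /
    (BQ * CQ * (Q * (1 - q * y)))) * (r * (q * y)) * t)).
  rewrite -AE BE CE. field.
  by rewrite qmn bqn cqn Cm0 Bm0 Q0 b1n c1n an0 cn0.
by ring.
Qed.

Lemma mass_cert_rapid a b c : params q a b c -> rapid q (mass_cert a b c).
Proof.
move=> H; have [/andP[a0 a1] /andP[b0 b1] c1 /andP[ab0 ab1] _] := params_lt1 q0 H.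
have c1' : c * q < 1 := lt_trans c1 ltr01.
apply: rapid_le (rapidZ ((1 - b * q) * (1 - c * q)) (rapid_shift q0 q1 (wdom_rapid q0 q1 H))) => m.
rewrite [X in `|X| <= _](_ : _ = - (qpoch q (a * b * q ^+ 2) m * qpoch q (a * q) m.+1 *
  (qpoch q (c * q) m.+1)^-1 * (1 - q * q ^+ m)) *
  ((1 - b * q) * (1 - c * q) * wdom q a b c m.+1)); last first.
  rewrite /mass_cert /wdom qpochSr.
  rewrite (qpochSr q q) !invfM; field.
  rewrite !qpoch_neq0// !andbT.
  by rewrite subr_eq0 eq_sym lt_eqF// -exprS exprn_ilt1 ?ltW.
have qm : q * q ^+ m <= 1 by rewrite -exprS exprn_ile1 ?ltW.
have qm0 : 0 <= q * q ^+ m by rewrite -exprS exprn_ge0 ?ltW.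
rewrite normrM ler_piMl// normrN !normrM !ger0_norm ?invr_ge0 ?subr_ge0//;
  try by rewrite ltW ?qpoch_gt0.
have aS : 0 <= qpoch q (a * q) m.+1 <= 1.
  by rewrite ltW ?qpoch_gt0//= qpoch_le1// ltW.
have abS : 0 <= qpoch q (a * b * q ^+ 2) m <= 1.
  by rewrite ltW ?qpoch_gt0//= qpoch_le1// ltW.
have cS : 0 <= (qpoch q (c * q) m.+1)^-1 <= 1.
  by rewrite invr_ge0 ltW ?qpoch_gt0//= invf_le1 ?qpoch_gt0// qpoch_ge1// ltW.
case/andP: aS => ? ?; case/andP: abS => ? ?; case/andP: cS => ? ?.
by do ![apply: mulr_ile1 => //|apply: mulr_ge0 => //]; rewrite ?subr_ge0 ?gerBl.
Qed.

Lemma mass_step a b c : params q a b c ->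
  (1 - b * q) * (1 - c * q) * mass a b c =
  (1 - a * b * q ^+ 2) * (1 - c / a) * mass a (b * q) (c * q).
Proof.
move=> H; have H' : params q a (b * q) (c * q).
  by have := params_shift q0 q1 0 1 1 H; rewrite expr0 !expr1 mulr1.
apply/eqP; rewrite -subr_eq0; apply/eqP.
have cv := rapid_cvg_to q0 q1 (weight_rapid q0 q1 H).
have cv' := rapid_cvg_to q0 q1 (weight_rapid q0 q1 H').
have H1 : (fun m => (1 - b * q) * (1 - c * q) * series (dbqJ_weight q a b c) m.+1 -
  (1 - a * b * q ^+ 2) * (1 - c / a) *
    series (dbqJ_weight q a (b * q) (c * q)) m.+1) @ \oo -->
  (1 - b * q) * (1 - c * q) * mass a b c -
  (1 - a * b * q ^+ 2) * (1 - c / a) * mass a (b * q) (c * q).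
  apply: cvgB; apply: cvgM; try exact: cvg_cst.
    by move: cv; rewrite -cvg_shiftS.
  by move: cv'; rewrite -cvg_shiftS.
have H0 := rapid_cvg0 q0 q1 (mass_cert_rapid H).
rewrite (funext (fun m => mass_telescope m H)) in H1.
exact: cvg_unique H1 H0.
Qed.

Lemma mass_iter a b c n : params q a b c ->
  qpoch q (b * q) n * qpoch q (c * q) n * mass a b c =
  qpoch q (a * b * q ^+ 2) n * qpoch q (c / a) n *
    mass a (b * q ^+ n) (c * q ^+ n).
Proof.
move=> H; elim: n => [|n IH]; first by rewrite !qpoch0 expr0 !mulr1.
have H' : params q a (b * q ^+ n) (c * q ^+ n).
  by have := params_shift q0 q1 0 n n H; rewrite expr0 mulr1.
have E := mass_step H'.
have xS (x : R) : x * q ^+ n.+1 = x * q ^+ n * q by rewrite exprSr mulrA.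
rewrite !xS !qpochSr.
transitivity ((1 - b * q * q ^+ n) * (1 - c * q * q ^+ n) *
  (qpoch q (b * q) n * qpoch q (c * q) n * mass a b c)); first by ring.
rewrite {}IH.
transitivity (qpoch q (a * b * q ^+ 2) n * qpoch q (c / a) n *
  ((1 - b * q ^+ n * q) * (1 - c * q ^+ n * q) * mass a (b * q ^+ n) (c * q ^+ n))).
  by ring.
by rewrite E; ring.
Qed.

(** As [b] and [c] tend to [0] only the term [m = 0] survives. *)
Lemma mass_limit a b c : params q a b c ->
  mass a (b * q ^+ n) (c * q ^+ n) @[n --> \oo] --> (1 : R).
Proof.
move=> H; pose K := ssum (fun m => wdom q a b c m.+1).
have rd := rapid_shift q0 q1 (wdom_rapid q0 q1 H).
have H' n : params q a (b * q ^+ n) (c * q ^+ n).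
  by have := params_shift q0 q1 0 n n H; rewrite expr0 mulr1.
have E n : mass a (b * q ^+ n) (c * q ^+ n) =
    1 + ssum (fun m => dbqJ_weight q a (b * q ^+ n) (c * q ^+ n) m.+1).
  rewrite /mass (ssum_recl q0 q1); last exact: weight_rapid.
  congr (_ + _).
  rewrite /dbqJ_weight !qpoch0 /= !mulr1 invr1. rewrite ?expr0 ?mulr1 ?mul1r ?divr1 //.
apply: (@squeeze_cvgr _ _ _ _ (fun=> 1) (fun n => 1 + q ^+ n * K)).
- apply: nearW => n; rewrite E lerDl lerD2l; apply/andP; split.
    apply: (ssum_ge0 q0 q1); first exact/rapid_shift/weight_rapid.
    by move=> m; rewrite ltW ?weight_gt0.
  rewrite /K -(ssumZ q0 q1 _ rd); apply: (ler_ssum q0 q1).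
  + exact/rapid_shift/weight_rapid.
  + exact: rapidZ.
  + move=> m; apply: le_trans (weight_le q0 q1 n m.+1 H) _.
    apply: ler_wpM2r; first by rewrite ltW ?wdom_gt0.
    by rewrite mulnS exprD ler_piMr ?exprn_ge0 ?exprn_ile1 ?ltW.
- exact: cvg_cst.
- rewrite -[X in _ --> X]addr0 -[X in _ + X](mul0r K).
  apply: cvgD; first exact: cvg_cst.
  apply: cvgM; last exact: cvg_cst.
  by apply: cvg_expr; rewrite ger0_norm ?ltW.
Qed.

(** The limiting case [d -> oo] of the nonterminating very-well-poised
    [6phi5] sum. *)
Lemma massE a b c : params q a b c ->
  mass a b c = qpoch_inf q (a * b * q ^+ 2) * qpoch_inf q (c / a) /
    (qpoch_inf q (b * q) * qpoch_inf q (c * q)).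
Proof.
move=> H; have [/andP[a0 a1] /andP[b0 b1] c1 /andP[ab0 ab1] _] := params_lt1 q0 H.
have [a0' _ _ _ c0'] := H.
have c1' : c * q < 1 := lt_trans c1 ltr01.
have ca : c / a < 1 by rewrite (lt_trans _ ltr01)// ltr_pdivrMr// mul0r.
have bi := qpoch_inf_gt0 q0 q1 b1; have ci := qpoch_inf_gt0 q0 q1 c1'.
apply: (@mulfI _ (qpoch_inf q (b * q) * qpoch_inf q (c * q))).
  by rewrite mulf_neq0 ?gt_eqF.
rewrite [RHS]mulrC divfK ?mulf_neq0 ?gt_eqF//.
rewrite -[RHS]mulr1.
apply: (@cvg_unique _ (@Rhausdorff R) ((fun n => qpoch q (b * q) n * qpoch q (c * q) n * mass a b c) @ \oo)).
  apply: cvgM; last exact: cvg_cst.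
  by apply: cvgM; exact: qpoch_inf_cvg.
rewrite (_ : (fun n => _) = (fun n => qpoch q (a * b * q ^+ 2) n * qpoch q (c / a) n *
    mass a (b * q ^+ n) (c * q ^+ n))); last first.
  by apply/funext => n; exact: mass_iter.
apply: cvgM; last exact: mass_limit.
by apply: cvgM; exact: qpoch_inf_cvg.
Qed.

End Mass.

(** * Orthogonality *)

Section Span.
Context {F : fieldType} (f : nat -> {poly F}).
Hypothesis size_f : forall k, size (f k) = k.+1.

(** A polynomial in terms of a family with one polynomial in each degree; only
    the top coefficient is made explicit. *)
Lemma poly_span n (p : {poly F}) : (size p <= n.+1)%N ->
  exists c : nat -> F,
    p = \sum_(k < n) c k *: f k + (p`_n / (f n)`_n) *: f n.
Proof.
have lcf k : (f k)`_k != 0.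
  by have := lead_coef_eq0 (f k); rewrite lead_coefE size_f /= -size_poly_eq0 size_f => ->.
elim: n p => [|n IH] p sp.
  exists (fun=> 0); rewrite big_ord0 add0r.
  have /size_poly1P[u u0 fE] : size (f 0%N) == 1%N by rewrite size_f.
  rewrite [p in LHS]size1_polyC// fE coefC eqxx -mul_polyC -polyCM divfK//.
pose p' := p - (p`_n.+1 / (f n.+1)`_n.+1) *: f n.+1.
have sp' : (size p' <= n.+1)%N.
  apply/leq_sizeP => j; rewrite leq_eqVlt => /orP[/eqP <-|nj].
    by rewrite coefB coefZ divfK ?subrr.
  have fj : (f n.+1)`_j = 0 by rewrite nth_default ?size_f.
  by rewrite coefB coefZ fj mulr0 subr0 nth_default// (leq_trans sp).
have [c pE] := IH p' sp'.
exists (fun k => if (k < n)%N then c k else p'`_n / (f n)`_n).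
rewrite big_ord_recr /= ltnn.
under eq_bigr do rewrite ltn_ord.
by rewrite -pE subrK.
Qed.

End Span.

Section Moments.
Context {R : realType} (q : R) (q0 : 0 < q) (q1 : q < 1).
Implicit Types (a b c A : R) (p : {poly R}).

Let qn0 n : q ^+ n != 0. Proof. by rewrite gt_eqF ?exprn_gt0. Qed.
Let qneq0 : q != 0. Proof. by rewrite gt_eqF. Qed.

Lemma lattice_tame a b : tame q (dual_lattice q a b).
Proof.
apply: tameD => //.
  exists 1%N, 1 => m; rewrite mul1n gtr0_norm ?invr_gt0 ?exprn_gt0//.
  by rewrite mulVf.
apply: tameZ => //; exists 0%N, 1 => m.
by rewrite mul0n mulr1 ger0_norm ?exprn_ge0 ?exprn_ile1 ?ltW.
Qed.

(** The polynomials in the lattice variable equal to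
    [(q^-m, a b q^(m+1); q)_k] at [dual_lattice q a b m]. *)
Definition phi_poly a b k : {poly R} :=
  \prod_(j < k) ((1 + a * b * q ^+ (2 * j).+1)%:P - q ^+ j *: 'X).

(** The polynomials equal to [(a b q^(m+1) / c, q^-m / c; q)_k] at
    [dual_lattice q a b m]. *)
Definition psi_poly a b c k : {poly R} :=
  \prod_(j < k) ((1 + a * b * q ^+ (2 * j).+1 / c ^+ 2)%:P - (q ^+ j / c) *: 'X).

Lemma size_linear (u v : R) : v != 0 -> size (u%:P - v *: 'X) = 2%N.
Proof.
move=> v0; rewrite addrC size_polyDl size_polyN size_scale// size_polyX//.
by rewrite ltnS size_polyC leq_b1.
Qed.

Lemma size_phi a b k : size (phi_poly a b k) = k.+1.
Proof.
rewrite size_prod => [|j _]; last by rewrite -size_poly_eq0 size_linear.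
under eq_bigr do rewrite size_linear//.
by rewrite sum_nat_const card_ord muln2 -addnn -addSn addnK.
Qed.

Lemma size_psi a b c k : c != 0 -> size (psi_poly a b c k) = k.+1.
Proof.
move=> c0.
have qc j : q ^+ j / c != 0 by rewrite mulf_neq0 ?invr_eq0.
rewrite size_prod => [|j _]; last by rewrite -size_poly_eq0 size_linear.
under eq_bigr do rewrite size_linear//.
by rewrite sum_nat_const card_ord muln2 -addnn -addSn addnK.
Qed.

Lemma lead_coef_prod_linear n (u v : nat -> R) : (forall j, v j != 0) ->
  (\prod_(j < n) ((u j)%:P - v j *: 'X))`_n = \prod_(j < n) - v j.
Proof.
move=> v0.
have sz : size (\prod_(j < n) ((u j)%:P - v j *: 'X)) = n.+1.
  rewrite size_prod => [|j _]; last by rewrite -size_poly_eq0 size_linear.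
  under eq_bigr do rewrite size_linear//.
  by rewrite sum_nat_const card_ord muln2 -addnn -addSn addnK.
have -> : (\prod_(j < n) ((u j)%:P - v j *: 'X))`_n =
  lead_coef (\prod_(j < n) ((u j)%:P - v j *: 'X)) by rewrite lead_coefE sz.
rewrite lead_coef_prod; apply: eq_bigr => j _.
by rewrite lead_coefE size_linear//= coefB coefC coefZ coefX mulr1 sub0r.
Qed.

Lemma phi_lattice a b k m :
  (phi_poly a b k).[dual_lattice q a b m] =
  qpoch q (q ^- m) k * qpoch q (a * b * q ^+ m.+1) k.
Proof.
rewrite -qpoch_lattice// horner_prod; apply: eq_bigr => j _.
by rewrite hornerD hornerN hornerZ hornerX hornerC.
Qed.

Lemma psi_lattice a b c k m : c != 0 ->
  (psi_poly a b c k).[dual_lattice q a b m] =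
  qpoch q (a * b * q / c * q ^+ m) k * qpoch q (q ^- m / c) k.
Proof.
move=> c0; rewrite horner_prod /qpoch -big_split /=; apply: eq_bigr => j _.
rewrite hornerD hornerN hornerZ hornerX hornerC /dual_lattice !exprS mulnC exprM expr0.
by move: (qn0 m); move: (q ^+ m) (q ^+ j) => u v u0; field; rewrite c0 u0.
Qed.

Lemma phi_step0 a b k : (phi_poly a b k.+1).[dual_lattice q a b 0] = 0.
Proof. by rewrite phi_lattice qpochSl expr0 invr1 subrr !mul0r. Qed.

Lemma phi_stepS a b k m : (phi_poly a b k.+1).[dual_lattice q a b m.+1] =
  (1 - q ^- m.+1) * (1 - a * b * q * q ^+ m.+1) *
  (phi_poly (a * q) (b * q) k).[dual_lattice q (a * q) (b * q) m].
Proof.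
rewrite !phi_lattice !qpochSl.
have -> : q ^- m.+1 * q = q ^- m by rewrite exprS; field; rewrite qneq0 qn0.
have -> : a * b * q ^+ m.+2 * q = a * q * (b * q) * q ^+ m.+1.
  by rewrite (exprS _ m.+1); ring.
by rewrite (exprS _ m.+1) mulrA; ring.
Qed.

Lemma wpoised_shift A m : wpoised q A m.+1 * (1 - A * q ^+ m.+1) =
  (1 - A * q) * (1 - A * q ^+ 2) * wpoised q (A * q ^+ 2) m.
Proof.
case: m => [|k]; first by rewrite /= qpoch0 expr1 muln1; ring.
have E : qpoch q (A * q) k.+1 * (1 - A * q ^+ k.+2) =
    (1 - A * q) * ((1 - A * q ^+ 2) * qpoch q (A * q ^+ 2 * q) k).
  rewrite (exprS q k.+1) mulrA -qpochSr qpochSl qpochSl.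
  by have -> : A * q ^+ 2 = A * q * q by ring.
transitivity ((1 - A * q ^+ (2 * k.+2)) *
  (qpoch q (A * q) k.+1 * (1 - A * q ^+ k.+2))); first by rewrite [RHS]mulrA.
rewrite E {E} /wpoised.
have -> : A * q ^+ (2 * k.+2) = A * q ^+ 2 * q ^+ (2 * k.+1).
  by rewrite (mulnS 2 k.+1) exprD [LHS]mulrA.
ring.
Qed.

(** Multiplication by the factor of [phi_poly] that vanishes at [m = 0] shifts
    the lattice and the parameters by one step. *)
Lemma weight_shift a b c m : params q a b c ->
  dbqJ_weight q a b c m.+1 * ((1 - q ^- m.+1) * (1 - a * b * q * q ^+ m.+1)) =
  c / (a * q) * (1 - a * q) * (1 - a * b * q / c) * (1 - a * b * q ^+ 2) *
  (1 - a * b * q ^+ 3) / ((1 - b * q) * (1 - c * q)) *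
  dbqJ_weight q (a * q) (b * q) (c * q) m.
Proof.
move=> H; have [/andP[_ a1] /andP[_ b1] c1 _ _] := params_lt1 q0 H.
have H' := params_shift q0 q1 1 1 1 H; rewrite !expr1 in H'.
have [/andP[_ a1'] /andP[_ b1'] c1' _ _] := params_lt1 q0 H'.
case: (H) => a0 _ b0 _ c0.
have an0 : a != 0 by rewrite gt_eqF.
have cn0 : c != 0 by rewrite lt_eqF.
rewrite !weightE.
have := wpoised_shift (a * b * q) m.
have -> : a * q * (b * q) * q = a * b * q * q ^+ 2 by ring.
have -> : a * b * q * q ^+ 2 / (c * q) = a * b * q / c * q by field; rewrite qneq0 cn0.
have -> : - (c * q) / (a * q) = - c / a by field; rewrite qneq0 an0.
rewrite (qpochSl _ (a * q)) (qpochSl _ (b * q)) (qpochSl _ (c * q))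
  (qpochSl _ (a * b * q / c)) (qpochSr _ q).
have := qpoch_neq0 q0 q1 m b1'; have := qpoch_neq0 q0 q1 m (lt_trans c1' ltr01).
have := qpoch_neq0 q0 q1 m q1.
have bn : 1 - b * q != 0 by rewrite subr_eq0 eq_sym lt_eqF.
have cn : 1 - c * q != 0 by rewrite subr_eq0 eq_sym lt_eqF// (lt_trans c1).
have qmn : 1 - q * q ^+ m != 0.
  by rewrite subr_eq0 eq_sym lt_eqF// -exprS exprn_ilt1 ?ltW.
have Em : (m.+1 * m.+1.-1)./2 = ((m * m.-1)./2 + m)%N := triS m.
rewrite Em exprD (exprS (- c / a)) (exprS q m).
move: (wpoised q (a * b * q) m.+1) (wpoised q (a * b * q * q ^+ 2) m)
  (qpoch q (a * q * q) m) (qpoch q (b * q * q) m) (qpoch q (c * q * q) m)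
  (qpoch q (a * b * q / c * q) m) (qpoch q q m) (q ^+ (m * m.-1)./2)
  ((- c / a) ^+ m) => W W' Aq Bq Cq Be Q t r.
move: qmn (qn0 m); move: (q ^+ m) => y qmn y0 Q0 Cq0 Bq0 WE.
rewrite (_ : _ * _ = (W * (1 - a * b * q * (q * y))) *
  ((1 - a * q) * Aq * ((1 - a * b * q / c) * Be) /
   ((1 - b * q) * Bq * ((1 - c * q) * Cq) * (Q * (1 - q * y))) *
   (- c / a * r) * (t * y) * (1 - (q * y)^-1))); last by ring.
rewrite WE; field.
by rewrite qneq0 an0 cn0 bn cn qmn y0 Q0 Cq0 Bq0.
Qed.

Lemma weightMpoly_rapid a b c p : params q a b c ->
  rapid q (fun m => dbqJ_weight q a b c m * p.[dual_lattice q a b m]).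
Proof.
move=> H; apply: rapidMtame => //; first exact: weight_rapid.
exact/tame_horner/lattice_tame.
Qed.

(** The moment functional of the weights. *)
Definition wmom a b c p : R :=
  ssum (fun m => dbqJ_weight q a b c m * p.[dual_lattice q a b m]).

Lemma wmomD a b c p p' : params q a b c ->
  wmom a b c (p + p') = wmom a b c p + wmom a b c p'.
Proof.
move=> H; rewrite /wmom -(ssumD q0 q1); try exact: weightMpoly_rapid.
by apply: ssumE => m; rewrite hornerD mulrDr.
Qed.

Lemma wmomZ a b c k p : params q a b c -> wmom a b c (k *: p) = k * wmom a b c p.
Proof.
move=> H; rewrite /wmom -(ssumZ q0 q1); last exact: weightMpoly_rapid.
by apply: ssumE => m; rewrite hornerZ mulrCA.
Qed.

Lemma wmom_sum a b c (I : Type) (r : seq I) (F : I -> {poly R}) : params q a b c ->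
  wmom a b c (\sum_(i <- r) F i) = \sum_(i <- r) wmom a b c (F i).
Proof.
move=> H; elim: r => [|i r IH].
  by rewrite !big_nil -(scale0r (0 : {poly R})) wmomZ ?mul0r.
by rewrite !big_cons wmomD ?IH.
Qed.

Lemma qpoch_inf_step x : x < 1 -> qpoch_inf q x = (1 - x) * qpoch_inf q (x * q).
Proof.
move=> x1; have xq1 : x * q < 1.
  have [x0|x0] := leP 0 x; first by rewrite -[q]expr1 mulq_lt1 ?x0.
  by rewrite (lt_trans _ ltr01)// nmulr_rlt0.
have := qpoch_inf_cvg q0 q1 x1; rewrite -cvg_shiftS => H1.
rewrite (_ : (fun n => _) = (fun n => (1 - x) * qpoch q (x * q) n)) in H1; last first.
  by apply/funext => n; exact: qpochSl.
have H2 : (fun n => (1 - x) * qpoch q (x * q) n) @ \oo -->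
    (1 - x) * qpoch_inf q (x * q).
  by apply: cvgM; [exact: cvg_cst|exact: qpoch_inf_cvg].
exact: cvg_unique H1 H2.
Qed.

Lemma mass_shift a b c : params q a b c ->
  mass q a b c = (1 - a * b * q ^+ 2) * (1 - a * b * q ^+ 3) /
    ((1 - b * q) * (1 - c * q)) * mass q (a * q) (b * q) (c * q).
Proof.
move=> H; have [/andP[_ a1] /andP[_ b1] c1 /andP[ab0 ab1] _] := params_lt1 q0 H.
have H' := params_shift q0 q1 1 1 1 H; rewrite !expr1 in H'.
have [_ /andP[_ b1'] c1' _ _] := params_lt1 q0 H'.
case: (H) => a0 _ b0 _ c0.
have an0 : a != 0 by rewrite gt_eqF.
have c1n : c * q < 1 := lt_trans c1 ltr01.
have c1n' : c * q * q < 1 := lt_trans c1' ltr01.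
have ab3 : a * b * q ^+ 2 * q < 1.
  by rewrite (le_lt_trans _ ab1)// ler_piMr ?ltW.
rewrite !massE// (qpoch_inf_step ab1) (qpoch_inf_step ab3).
rewrite (qpoch_inf_step b1) (qpoch_inf_step c1n).
have -> : a * q * (b * q) * q ^+ 2 = a * b * q ^+ 2 * q * q by ring.
have -> : c * q / (a * q) = c / a by field; rewrite qneq0 an0.
have -> : a * b * q ^+ 3 = a * b * q ^+ 2 * q by ring.
have b1n : 1 - b * q != 0 by rewrite subr_eq0 eq_sym lt_eqF.
have c1nn : 1 - c * q != 0 by rewrite subr_eq0 eq_sym lt_eqF.
have bi : qpoch_inf q (b * q * q) != 0 by rewrite gt_eqF ?qpoch_inf_gt0.
have ci : qpoch_inf q (c * q * q) != 0 by rewrite gt_eqF ?qpoch_inf_gt0.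
by field; rewrite b1n c1nn bi ci.
Qed.

Lemma wmom_phi a b c k : params q a b c ->
  wmom a b c (phi_poly a b k) =
  qpoch q (a * q) k * qpoch q (a * b * q / c) k * (c / (a * q)) ^+ k * mass q a b c.
Proof.
elim: k a b c => [|k IH] a b c H.
  rewrite !qpoch0 expr0 !mul1r; apply: ssumE => m.
  by rewrite /phi_poly big_ord0 hornerC mulr1.
have H' := params_shift q0 q1 1 1 1 H; rewrite !expr1 in H'.
have [/andP[_ a1] /andP[_ b1] c1 _ _] := params_lt1 q0 H.
case: (H) => a0 _ b0 _ c0.
rewrite /wmom (ssum_recl q0 q1); last exact: weightMpoly_rapid.
rewrite phi_step0 mulr0 add0r.
under ssumE do rewrite phi_stepS mulrA weight_shift// -mulrA.
rewrite (ssumZ q0 q1); last exact: weightMpoly_rapid.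
rewrite -/(wmom (a * q) (b * q) (c * q) (phi_poly (a * q) (b * q) k)) IH//.
rewrite (mass_shift H) !(qpochSl _ _ k) (exprS (c / (a * q)) k).
have an0 : a != 0 by rewrite gt_eqF.
have cn0 : c != 0 by rewrite lt_eqF.
have -> : c * q / (a * q * q) = c / (a * q) by field; rewrite qneq0 an0.
have -> : a * q * (b * q) * q / (c * q) = a * b * q / c * q by field; rewrite qneq0 cn0.
move: ((c / (a * q)) ^+ k) => r; ring.
Qed.

(** Multiplication by the first factor of [psi_poly] divides [c] by [q]. *)
Lemma weight_psi1 a b c m : params q a b c ->
  dbqJ_weight q a b c m * ((1 - a * b * q / c * q ^+ m) * (1 - q ^- m / c)) =
  (1 - a * b * q / c) * (1 - c^-1) * dbqJ_weight q a b (c / q) m.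
Proof.
move=> H; have [/andP[_ a1] /andP[_ b1] c1 _ be] := params_lt1 q0 H.
case: (H) => a0 _ b0 _ c0.
have an0 : a != 0 by rewrite gt_eqF.
have cn0 : c != 0 by rewrite lt_eqF.
rewrite !weightE.
have -> : a * b * q / (c / q) = a * b * q / c * q by field; rewrite qneq0 cn0.
have -> : c / q * q = c by rewrite divfK.
have -> : - (c / q) / a = (- c / a) * q^-1 by ring.
rewrite (exprMn _ (- c / a)) exprVn.
have := qpochSl q (a * b * q / c) m; rewrite qpochSr.
have := qpochSl q c m; rewrite qpochSr.
have := qpoch_neq0 q0 q1 m (lt_trans c0 ltr01).
have := qpoch_neq0 q0 q1 m (lt_trans c1 ltr01).
have := qpoch_neq0 q0 q1 m b1; have := qpoch_neq0 q0 q1 m q1.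
have cm0 : 1 - c * q ^+ m != 0.
  by rewrite subr_eq0 eq_sym lt_eqF// (lt_trans _ ltr01)// nmulr_rlt0 ?exprn_gt0.
have c1n : 1 - c != 0 by rewrite subr_eq0 eq_sym lt_eqF// (lt_trans c0).
have be1 : 1 - a * b * q / c != 0 by rewrite subr_eq0 eq_sym lt_eqF// (lt_trans be).
move: (wpoised _ _ _) (qpoch q (a * q) m) (qpoch q (b * q) m) (qpoch q (c * q) m)
  (qpoch q (a * b * q / c * q) m) (qpoch q (a * b * q / c) m) (qpoch q c m)
  (qpoch q q m) (q ^+ (m * m.-1)./2) ((- c / a) ^+ m) => W Aq Bq Cq Beq Be Cc Q t r.
move: cm0 (qn0 m); move: (q ^+ m) => y cm0 y0 Q0 Bq0 Cq0 Cc0 CE BE.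
have {CE} -> : Cq = Cc * (1 - c * y) / (1 - c) by rewrite CE mulrC mulKf.
have {BE} -> : Beq = Be * (1 - a * b * q / c * y) / (1 - a * b * q / c).
  by rewrite BE mulrC mulKf.
move: be1; rewrite [1 - _](_ : _ = (c - a * b * q) / c); last by field; rewrite cn0.
rewrite mulf_eq0 negb_or => /andP[be1 _].
field.
by rewrite cn0 y0 Q0 Bq0 Cc0 c1n cm0 be1.
Qed.

Lemma weight_psi a b c j m : params q a b c ->
  dbqJ_weight q a b c m * (psi_poly a b c j).[dual_lattice q a b m] =
  qpoch q (a * b * q / c) j * qpoch q c^-1 j * dbqJ_weight q a b (c * q ^- j) m.
Proof.
elim: j c => [|j IH] c H.
  by rewrite !qpoch0 expr0 invr1 !mulr1 /psi_poly big_ord0 hornerC mulr1 !mul1r.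
case: (H) => a0 _ b0 _ c0.
have cn0 : c != 0 by rewrite lt_eqF.
have H' : params q a b (c / q) by have := params_shiftc q0 1 H; rewrite expr1.
have cqn0 : c / q != 0 by case: H' => _ _ _ _ ?; rewrite lt_eqF.
have E : c / q * q ^- j = c * q ^- j.+1 by rewrite exprS invfM mulrA.
have := IH _ H'; rewrite E !psi_lattice//.
have -> : a * b * q / (c / q) = a * b * q / c * q by field; rewrite qneq0 cn0.
have -> : (c / q)^-1 = c^-1 * q by rewrite invf_div mulrC.
rewrite !(qpochSl _ _ j) => IHc.
have -> : a * b * q / c * q ^+ m * q = a * b * q / c * q * q ^+ m by ring.
have -> : q ^- m / c * q = q ^- m * (c^-1 * q) by rewrite mulrA.
rewrite [LHS](_ : _ = (dbqJ_weight q a b c m *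
   ((1 - a * b * q / c * q ^+ m) * (1 - q ^- m / c))) *
   (qpoch q (a * b * q / c * q * q ^+ m) j * qpoch q (q ^- m * (c^-1 * q)) j)); last by ring.
by rewrite weight_psi1// -[LHS]mulrA IHc; ring.
Qed.

Lemma wmom_psi a b c p j : params q a b c ->
  wmom a b c (p * psi_poly a b c j) =
  qpoch q (a * b * q / c) j * qpoch q c^-1 j * wmom a b (c * q ^- j) p.
Proof.
move=> H; have H' := params_shiftc q0 j H.
rewrite /wmom -(ssumZ q0 q1); last exact: weightMpoly_rapid.
apply: ssumE => m; rewrite hornerM mulrCA weight_psi//; ring.
Qed.

(** The q-Vandermonde sum. *)
Lemma q_vandermonde n x y z : y <= 0 -> z * x = y ->
  \sum_(k < n.+1) qpoch q (q ^- n) k / qpoch q q k * q ^+ n ^+ k *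
    (qpoch q x k / qpoch q y k * z ^+ k) = qpoch q z n / qpoch q y n.
Proof.
(* [e n k] is a signed q-binomial coefficient, and [eS] is q-Pascal's rule *)
pose e n k := qpoch q (q ^- n) k / qpoch q q k * q ^+ n ^+ k.
have qk k : qpoch q q k != 0 by exact: qpoch_neq0.
have qk1 k : 1 - q ^+ k.+1 != 0 by rewrite subr_eq0 eq_sym lt_eqF ?exprn_ilt1 ?ltW.
have e0 i : e i 0%N = 1 by rewrite /e !qpoch0 invr1 expr0 !mulr1.
have eS i k : e i.+1 k.+1 = q ^+ k.+1 * e i k.+1 - q ^+ k * e i k.
  rewrite /e qpochSl.
  have -> : q ^- i.+1 * q = q ^- i by rewrite exprS; field; rewrite qneq0 qn0.
  rewrite !(qpochSr _ _ k).
  have -> : q ^+ i.+1 ^+ k.+1 = q * q ^+ i * (q ^+ k * q ^+ i ^+ k).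
    by rewrite (exprS _ k) (exprS q i) exprMn.
  rewrite (exprS (q ^+ i) k); move: (qk1 k); rewrite (exprS q k) (exprS q i).
  move: (qk k) (qn0 i).
  move: (qpoch q q k) (qpoch q (q ^- i) k) (q ^+ i ^+ k) (q ^+ k) (q ^+ i).
  by move=> Q P w u v Q0 v0 uq; field; rewrite Q0 uq v0 qneq0.
have en i : e i i.+1 = 0.
  by rewrite /e qpochSr mulVf// subrr mulr0 !mul0r.
elim: n y z => [|n IH] y z y0 xyz.
  by rewrite big_ord_recr big_ord0 /= !qpoch0 !expr0 invr1 !mulr1 add0r.
have y1 : y < 1 by exact: le_lt_trans ltr01.
have yk k : qpoch q y k != 0 by exact: qpoch_neq0.
have yq0 : y * q <= 0 by rewrite mulr_le0_ge0// ltW.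
have ymk k : 1 - y * q ^+ k != 0.
  by rewrite subr_eq0 eq_sym lt_eqF// (le_lt_trans _ ltr01)// mulr_le0_ge0// exprn_ge0 ?ltW.
pose g k := qpoch q x k / qpoch q y k * z ^+ k.
have g0 : g 0%N = 1 by rewrite /g !qpoch0 invr1 expr0 !mulr1.
rewrite (_ : \sum_(k < n.+2) _ = \sum_(k < n.+2) e n.+1 k * g k)//.
rewrite big_ord_recl e0 g0 mulr1.
under eq_bigr do rewrite lift0 eS mulrBl.
rewrite big_split /= addrA sumrN.
have -> : 1 + \sum_(k < n.+1) q ^+ k.+1 * e n k.+1 * g k.+1 =
    \sum_(k < n.+1) q ^+ k * e n k * g k.
  transitivity (\sum_(k < n.+2) q ^+ k * e n k * g k).
    rewrite [RHS]big_ord_recl /= expr0 e0 g0 !mulr1; congr (_ + _).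
  by rewrite big_ord_recr /= en mulr0 mul0r addr0.
rewrite -sumrB.
have -> : qpoch q z n.+1 / qpoch q y n.+1 =
    (1 - z) / (1 - y) * (qpoch q (z * q) n / qpoch q (y * q) n).
  by rewrite !qpochSl invfM; ring.
rewrite -IH//; last by rewrite mulrAC xyz.
rewrite mulr_sumr; apply: eq_bigr => k _.
rewrite /e /g !exprMn (exprS z).
have := qpochSl q y k; rewrite !(qpochSr _ _ k) => yE.
have yqk : qpoch q (y * q) k != 0.
  by rewrite qpoch_neq0// (le_lt_trans _ ltr01).
have y1n : 1 - y != 0 by rewrite subr_eq0 eq_sym lt_eqF.
move: (yk k) (ymk k) (qk k) yqk yE => /=.
rewrite -xyz.
move: y1n; rewrite -xyz.
move: (qpoch q (z * x) k) (qpoch q (z * x * q) k) (qpoch q q k)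
  (qpoch q (q ^- n) k) (qpoch q x k) (z ^+ k) (q ^+ n ^+ k) (q ^+ k)
  => Y Yq Q P X Z N K y1n Y0 yK0 Q0 Yq0 yE.
have {Yq0} -> : Yq = Y * (1 - z * x * K) / (1 - z * x) by rewrite yE mulrC mulKf.
by field; rewrite y1n Y0 yK0 Q0.
Qed.

End Moments.

Section Orthogonality.
Context {R : realType} (q : R) (q0 : 0 < q) (q1 : q < 1).
Implicit Types (a b c : R) (p : {poly R}).

Let qn0 n : q ^+ n != 0. Proof. by rewrite gt_eqF ?exprn_gt0. Qed.
Let qneq0 : q != 0. Proof. by rewrite gt_eqF. Qed.

Lemma qpoch_reverse (x : R) n : x != 0 ->
  qpoch q (x * q ^- n) n = (- x) ^+ n * q ^- (n.+1 * n)./2 * qpoch q (q / x) n.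
Proof.
move=> x0; elim: n => [|n IH]; first by rewrite !qpoch0 !expr0 invr1 !mulr1.
rewrite qpochSl (_ : x * q ^- n.+1 * q = x * q ^- n); last first.
  by rewrite exprS; field; rewrite qneq0 qn0.
have En : (n.+2 * n.+1)./2 = ((n.+1 * n)./2 + n.+1)%N := triS n.+1.
rewrite IH qpochSr En exprD invfM !exprS.
move: (qn0 n) (qn0 (n.+1 * n)./2); move: (q ^+ n) (q ^+ (n.+1 * n)./2) => y t y0 t0.
by field; rewrite qneq0 x0 y0 t0.
Qed.

Lemma qpochVn_gt k n : (k < n)%N -> qpoch q (q ^- k) n = 0.
Proof.
by move=> kn; rewrite /qpoch (bigD1 (Ordinal kn)) //= mulVf// subrr mul0r.
Qed.

Lemma qpoch_inf_split (x : R) n : x < 1 ->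
  qpoch_inf q x = qpoch q x n * qpoch_inf q (x * q ^+ n).
Proof.
move=> x1; elim: n => [|n IH]; first by rewrite qpoch0 expr0 mul1r mulr1.
rewrite IH qpochSr exprSr mulrA -mulrA -(qpoch_inf_step q0 q1)//.
have [x0|x0] := leP 0 x; first by rewrite mulq_lt1// x0.
by rewrite (lt_trans _ ltr01)// nmulr_rlt0 ?exprn_gt0.
Qed.

(** Comparison of the total masses at [c q^-n] and at [c]. *)
Lemma mass_shiftc a b c n : params q a b c ->
  mass q a b (c * q ^- n) * qpoch q c^-1 n = q ^- n * a ^- n * qpoch q (a * q / c) n * mass q a b c.
Proof.
move=> H; have [/andP[_ a1] /andP[_ b1] c1 /andP[ab0 ab1] _] := params_lt1 q0 H.
have H' := params_shiftc q0 n H.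
case: (H) => a0 _ b0 _ c0; case: (H') => _ _ _ _ cn.
have an0 : a != 0 by rewrite gt_eqF.
have cn0 : c != 0 by rewrite lt_eqF.
rewrite !massE//.
have ca x : x < 0 -> x / a < 1 by move=> x0; rewrite (lt_trans _ ltr01)// ltr_pdivrMr// mul0r.
have cq x : x < 0 -> x * q < 1 by move=> x0; rewrite (lt_trans _ ltr01)// nmulr_rlt0.
rewrite (qpoch_inf_split n (ca _ cn)) (qpoch_inf_split n (cq _ cn)).
have -> : c * q ^- n / a = c / a * q ^- n by rewrite mulrAC.
have -> : c * q ^- n * q = c * q * q ^- n by rewrite mulrAC.
rewrite !divfK// !qpoch_reverse ?mulf_neq0 ?invr_eq0//.
have -> : q / (c / a) = a * q / c by field; rewrite cn0 an0.
have -> : q / (c * q) = c^-1 by field; rewrite cn0 qneq0.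
have bi : qpoch_inf q (b * q) != 0 by rewrite gt_eqF ?qpoch_inf_gt0.
have ci : qpoch_inf q (c * q) != 0 by rewrite gt_eqF ?qpoch_inf_gt0// cq.
have c1n : qpoch q c^-1 n != 0 by rewrite qpoch_neq0// (lt_trans _ ltr01)// invr_lt0.
have -> : - (c / a) = - c / a by rewrite mulNr.
have -> : - (c * q) = - c * q by rewrite mulNr.
rewrite !exprMn exprVn.
have cNn : (- c) ^+ n != 0 by rewrite expf_neq0// oppr_eq0.
have aNn : a ^+ n != 0 by rewrite expf_neq0.
move: (qn0 n) (qn0 (n.+1 * n)./2) bi ci c1n cNn aNn.
move: (q ^+ n) (q ^+ (n.+1 * n)./2) (qpoch_inf q (b * q)) (qpoch_inf q (c * q))
  (qpoch q c^-1 n) ((- c) ^+ n) (a ^+ n) => y t B C D e f y0 t0 B0 C0 D0 e0 f0.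
by field; rewrite y0 t0 B0 C0 D0 e0 f0.
Qed.

Lemma size_dbqJ a b c n : params q a b c -> size (dbqJ q a b c n) = n.+1.
Proof.
move=> H; have [/andP[_ a1] _ _ _ be] := params_lt1 q0 H.
case: (H) => a0 _ b0 _ c0.
rewrite /dbqJ big_ord_recr /= addrC -/(phi_poly q a b n).
have cf : qpoch q (q ^- n) n / (qpoch q (a * q) n * qpoch q (a * b * q / c) n *
    qpoch q q n) * (a * q ^+ n.+1 / c) ^+ n != 0.
  rewrite !mulf_neq0 ?invr_neq0 ?mulf_neq0 ?expf_neq0 ?mulf_neq0 ?invr_neq0//.
  - rewrite -[q ^- n]mul1r qpoch_reverse ?oner_neq0// divr1.
    by rewrite !mulf_neq0 ?invr_neq0 ?expf_neq0 ?oppr_eq0 ?oner_neq0 ?qpoch_neq0.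
  - by rewrite qpoch_neq0.
  - by rewrite qpoch_neq0// (lt_trans be).
  - by rewrite qpoch_neq0.
  - by rewrite gt_eqF.
  - by rewrite lt_eqF.
rewrite size_polyDl size_scale// size_phi//.
apply: leq_ltn_trans (size_sum _ _ _) _.
rewrite ltnS; apply/bigmax_leqP => k _.
by apply: leq_trans (size_scale_leq _ _) _; rewrite size_phi.
Qed.

Lemma wmom_dbqJ_psi a b c n j : params q a b c ->
  wmom q a b c (dbqJ q a b c n * psi_poly q a b c j) =
  qpoch q (a * b * q / c) j * qpoch q c^-1 j *
  (qpoch q (q ^- j) n / qpoch q (a * b * q / c) n * mass q a b (c * q ^- j)).
Proof.
move=> H; rewrite wmom_psi//; congr (_ * _).
have H' := params_shiftc q0 j H.
have [/andP[_ a1] _ _ _ be] := params_lt1 q0 H.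
case: (H) => a0 _ b0 _ c0.
have an0 : a != 0 by rewrite gt_eqF.
have cn0 : c != 0 by rewrite lt_eqF.
rewrite /dbqJ wmom_sum//.
rewrite -(q_vandermonde q0 q1 n (x := a * b * q / c * q ^+ j)) ?(ltW be)//; last first.
  by rewrite mulrC mulfK.
rewrite mulr_suml; apply: eq_bigr => k _.
rewrite wmomZ// -/(phi_poly q a b k) wmom_phi//.
have -> : a * b * q / (c * q ^- j) = a * b * q / c * q ^+ j.
  by field; rewrite qn0 cn0.
have -> : a * q ^+ n.+1 / c = q ^+ n * (a * q / c) by rewrite exprS; ring.
have -> : c * q ^- j / (a * q) = q ^- j * (a * q / c)^-1.
  by rewrite invf_div; ring.
rewrite (exprMn _ (q ^+ n)) (exprMn _ (q ^- j)) (exprVn (a * q / c)).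
have ac : (a * q / c) ^+ k != 0 by rewrite expf_neq0// !mulf_neq0// invr_neq0.
have ak : qpoch q (a * q) k != 0 by rewrite qpoch_neq0.
have bk : qpoch q (a * b * q / c) k != 0 by rewrite qpoch_neq0// (lt_trans be).
have qk : qpoch q q k != 0 by rewrite qpoch_neq0.
move: ac ak bk qk; move: (qpoch q (a * b * q / c * q ^+ j) k) ((a * q / c) ^+ k)
  (qpoch q (a * q) k) (qpoch q (a * b * q / c) k) (qpoch q q k) => X Y Z W V Y0 Z0 W0 V0.
move: (q ^+ n ^+ k) (q ^- j ^+ k) (qpoch q (q ^- n) k) => M N P.
by field; rewrite Y0 Z0 W0 V0.
Qed.

(** [dbqJ] is orthogonal to [psi_poly] of lower degree, so only the top
    coefficient of [p] matters. *)
Lemma wmom_dbqJ_poly a b c n p : params q a b c -> (size p <= n.+1)%N ->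
  wmom q a b c (dbqJ q a b c n * p) =
  p`_n / (psi_poly q a b c n)`_n * wmom q a b c (dbqJ q a b c n * psi_poly q a b c n).
Proof.
move=> H sp; have cn0 : c != 0 by case: H => _ _ _ _ ?; rewrite lt_eqF.
have [k pE] := poly_span (fun j => size_psi q0 a b j cn0) sp.
rewrite {1}pE mulrDr wmomD// -scalerAr wmomZ// mulr_sumr wmom_sum//.
rewrite big1 ?add0r// => i _; rewrite -scalerAr wmomZ// wmom_dbqJ_psi//.
by rewrite qpochVn_gt// !mul0r !mulr0.
Qed.

Lemma wmom_dbqJ_lt a b c n p : params q a b c -> (size p <= n)%N ->
  wmom q a b c (dbqJ q a b c n * p) = 0.
Proof.
move=> H sp; rewrite wmom_dbqJ_poly//; last exact: leqW.
by rewrite nth_default// !mul0r.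
Qed.

Lemma dbqJ_normE a b c n : params q a b c -> dbqJ_norm q a b c n =
  mass q a b c * (qpoch q (a * q / c) n * qpoch q q n /
   (qpoch q (a * q) n * qpoch q (a * b * q / c) n * q ^+ n)).
Proof. by move=> H; rewrite massE. Qed.

Lemma dbqJ_norm_gt0 a b c n : params q a b c -> 0 < dbqJ_norm q a b c n.
Proof.
move=> H; rewrite dbqJ_normE//.
have [/andP[a0 a1] _ _ _ be] := params_lt1 q0 H.
have aqc : a * q / c < 1.
  by case: H => _ _ _ _ c0; rewrite (lt_trans _ ltr01)// pmulr_rlt0// invr_lt0.
by rewrite !mulr_gt0 ?mass_gt0 ?invr_gt0 ?mulr_gt0 ?qpoch_gt0 ?exprn_gt0// (lt_trans be).
Qed.

Lemma wmom_dbqJ_sq a b c n : params q a b c ->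
  wmom q a b c (dbqJ q a b c n * dbqJ q a b c n) = dbqJ_norm q a b c n.
Proof.
move=> H; have [/andP[_ a1] _ _ _ be] := params_lt1 q0 H.
case: (H) => a0 _ b0 _ c0.
have an0 : a != 0 by rewrite gt_eqF.
have cn0 : c != 0 by rewrite lt_eqF.
rewrite wmom_dbqJ_poly ?size_dbqJ// wmom_dbqJ_psi// dbqJ_normE//.
set Psi := (psi_poly q a b c n)`_n.
have PsiE : Psi * c ^+ n = (phi_poly q a b n)`_n.
  rewrite /Psi /psi_poly /phi_poly.
  rewrite (@lead_coef_prod_linear _ n (fun j => 1 + a * b * q ^+ (2 * j).+1)
    (fun j => q ^+ j))//.
  rewrite (@lead_coef_prod_linear _ n (fun j => 1 + a * b * q ^+ (2 * j).+1 / c ^+ 2)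
    (fun j => q ^+ j / c)); last by move=> j; rewrite mulf_neq0 ?invr_neq0.
  rewrite -[X in _ ^+ X]card_ord -prodr_const -big_split /=; apply: eq_bigr => j _.
  by rewrite mulNr divfK.
have Psi0 : Psi != 0.
  by have := lead_coef_eq0 (psi_poly q a b c n);
    rewrite lead_coefE -size_poly_eq0 size_psi//= /Psi => ->.
have DE : (dbqJ q a b c n)`_n = qpoch q (q ^- n) n / (qpoch q (a * q) n *
    qpoch q (a * b * q / c) n * qpoch q q n) * (a * q ^+ n.+1 / c) ^+ n *
    (Psi * c ^+ n).
  rewrite PsiE /dbqJ big_ord_recr /= coefD coefZ coef_sum big1 ?add0r// => k _.
  by rewrite coefZ -/(phi_poly q a b k) nth_default ?mulr0// size_phi.
rewrite DE.
have mE := mass_shiftc n H.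
rewrite [X in _ * X](_ : _ = qpoch q (q ^- n) n * (mass q a b (c * q ^- n) * qpoch q c^-1 n)); last first.
  have bn : qpoch q (a * b * q / c) n != 0 by rewrite qpoch_neq0// (lt_trans be).
  by field.
have qV : qpoch q (q ^- n) n = (-1) ^+ n * q ^- (n.+1 * n)./2 * qpoch q q n.
  by rewrite -{1}[q ^- n]mul1r qpoch_reverse ?oner_neq0// divr1.
have T2 : q ^- (n.+1 * n)./2 ^+ 2 = (q ^+ n.+1 ^+ n)^-1.
  rewrite exprVn -!exprM muln2 even_halfK ?oddM //=.
  by case: (odd n).
have S2 : (-1) ^+ n ^+ 2 = 1 :> R by rewrite -exprM mulnC exprM sqrrN expr1n expr1n.
rewrite mE qV !exprMn exprVn.
have an : a ^+ n != 0 by rewrite expf_neq0.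
have cn : c ^+ n != 0 by rewrite expf_neq0.
have qnn : q ^+ n.+1 ^+ n != 0 by rewrite expf_neq0.
have A0 : qpoch q (a * q) n != 0 by rewrite qpoch_neq0.
have B0 : qpoch q (a * b * q / c) n != 0 by rewrite qpoch_neq0// (lt_trans be).
have Q0 : qpoch q q n != 0 by rewrite qpoch_neq0.
clear DE PsiE; clearbody Psi.
move: an cn qnn A0 B0 Q0 S2 T2 (qn0 n) Psi0.
move: (a ^+ n) (c ^+ n) (q ^+ n.+1 ^+ n) (qpoch q (a * q) n)
  (qpoch q (a * b * q / c) n) (qpoch q q n) ((-1) ^+ n) (q ^- (n.+1 * n)./2)
  (q ^+ n) Psi (qpoch q (a * q / c) n) (mass q a b c).
move=> x y z A B Q s t u P X M x0 y0 z0 A0 B0 Q0 S2 T2 u0 P0.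
transitivity (s ^+ 2 * t ^+ 2 * z * (X * M * Q / (A * B * u))); last first.
  by rewrite S2 T2; field; rewrite A0 B0 u0 z0.
by field; rewrite x0 y0 A0 B0 Q0 u0 P0.
Qed.

Lemma dbqJ_orthogonality a b c n n' : params q a b c ->
  series (fun m => dbqJ_weight q a b c m *
    (dbqJ q a b c n).[dual_lattice q a b m] *
    (dbqJ q a b c n').[dual_lattice q a b m]) @ \oo -->
  dbqJ_norm q a b c n * (n == n')%:R.
Proof.
move=> H; set D := dbqJ q a b c.
have -> : dbqJ_norm q a b c n * (n == n')%:R = wmom q a b c (D n * D n').
  case: (ltngtP n n') => nn'.
  - by rewrite mulrC [RHS](_ : _ = 0) ?mul0r// mulrC wmom_dbqJ_lt// size_dbqJ.
  - by rewrite wmom_dbqJ_lt ?mulr0// size_dbqJ.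
  - by rewrite -nn' wmom_dbqJ_sq// mulr1.
rewrite (_ : (fun m => _) = (fun m => dbqJ_weight q a b c m *
    (D n * D n').[dual_lattice q a b m])); last first.
  by apply/funext => m; rewrite hornerM mulrA.
exact/(rapid_cvg_to q0 q1)/weightMpoly_rapid.
Qed.

End Orthogonality.

(** * Discrete probability measures on the line *)

Section DiscreteMeasure.
Context {R : realType}.
Implicit Types (v y : nat -> R).

(** [mu] is the sum of the point masses [v m] at [y m]; the points may
    coincide. *)
Definition discrete_like v y (mu : probability (measurableTypeR R) R) : Prop :=
  forall A : set (measurableTypeR R), measurable A ->
    mu A = (\sum_(0 <= m <oo) (v m)%:E * \d_(y m : measurableTypeR R) A)%E.

Lemma nneseries_ssum (u : nat -> R) : cvgn (series u) ->
  (\sum_(0 <= m <oo) (u m)%:E)%E = (ssum u)%:E.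
Proof.
move=> cu; rewrite /ssum -EFin_lim//; congr (limn _).
by apply/funext => n; rewrite /= sumEFin.
Qed.

Section Construction.
Variables (v : nat -> R) (y : nat -> R).
Hypotheses (v0 : forall m, 0 <= v m) (v1 : series v @ \oo --> (1 : R)).

Let pt m : measurableTypeR R := y m.

Let comp (m : nat) : {measure set (measurableTypeR R) -> \bar R} :=
  mscale (NngNum (v0 m)) (dirac (pt m)).

Let dm : {measure set (measurableTypeR R) -> \bar R} := mseries comp 0.

Let dmE A : dm A = (\sum_(0 <= m <oo) (v m)%:E * \d_(y m : measurableTypeR R) A)%E.
Proof. by []. Qed.

Let dm_setT : dm setT = 1%E.
Proof.
rewrite dmE; under eq_eseriesr do rewrite diracT mule1.
by rewrite nneseries_ssum; [congr (_%:E); exact/cvg_lim|exact: cvgP v1].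
Qed.

Lemma discrete_probability : exists mu, discrete_like v y mu.
Proof.
pose p : probability (measurableTypeR R) R :=
  HB.pack_for (probability (measurableTypeR R) R) (Measure.sort dm)
    (Measure_isProbability.Build _ _ _ (Measure.sort dm) dm_setT).
by exists p.
Qed.

(** Integrals against such a measure are series. *)
Lemma discrete_integral_ge0 mu (g : R -> R) : discrete_like v y mu ->
  (forall x, 0 <= g x) -> measurable_fun setT g ->
  cvgn (series (fun m => v m * g (y m))) ->
  (\int[mu]_x (g x)%:E = (ssum (fun m => v m * g (y m)))%:E)%E.
Proof.
move=> muE g0 mg cv.
have mg' : measurable_fun setT (EFin \o g) by exact/measurable_EFinP.
rewrite (@eq_measure_integral _ _ _ _ dm); last by move=> A mA _; exact: muE.
rewrite (@ge0_integral_measure_series _ _ R comp setT _ (fun x => (g x)%:E))//; last first.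
  by move=> x _; rewrite lee_fin.
rewrite -nneseries_ssum//; apply: eq_eseriesr => m _.
rewrite ge0_integral_mscale//; last by move=> x _; rewrite lee_fin.
by rewrite integral_dirac// diracT mul1e -EFinM.
Qed.

Lemma discrete_integrable mu (f : R -> R) : discrete_like v y mu ->
  measurable_fun setT f -> cvgn (series (fun m => v m * `|f (y m)|)) ->
  mu.-integrable setT (fun x : R => (f x)%:E).
Proof.
move=> muE mf cv; apply/integrableP; split; first exact/measurable_EFinP.
rewrite (_ : (fun x => _) = (fun x : R => (`|f x|)%:E)) //.
rewrite (@discrete_integral_ge0 mu (fun x => `|f x|))//; last first.
  exact: measurableT_comp.
exact: ltry.
Qed.

Lemma discrete_Rintegral mu (f : R -> R) : discrete_like v y mu ->
  measurable_fun setT f -> cvgn (series (fun m => v m * `|f (y m)|)) ->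
  Rintegral mu setT f = ssum (fun m => v m * f (y m)).
Proof.
move=> muE mf cv.
have mnf : measurable_fun setT (fun x : R => `|f x|) by exact: measurableT_comp.
have cf : cvgn (series (fun m => v m * f (y m))).
  apply: normed_cvg; rewrite (_ : [normed series _] = series (fun m => v m * `|f (y m)|))//.
  by apply/funext => n; rewrite /series /=; apply: eq_bigr => i _; rewrite normrM ger0_norm.
have cg : cvgn (series (fun m => v m * (`|f (y m)| - f (y m)))).
  have := is_cvg_seriesB cv cf.
  rewrite (_ : (fun m => _) - _ = (fun m => v m * (`|f (y m)| - f (y m))))//.
  by apply/funext => m; rewrite mulrBr.
(* [f] is a difference of the nonnegative functions [|f|] and [|f| - f] *)
have fE x : f x = `|f x| - (`|f x| - f x) by rewrite opprB addrC subrK.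
have E1 := discrete_integral_ge0 muE (fun x => normr_ge0 (f x)) mnf cv.
have g0 x : 0 <= `|f x| - f x by rewrite subr_ge0 ler_norm.
have mg : measurable_fun setT (fun x : R => `|f x| - f x) by exact: measurable_funB.
have E2 := discrete_integral_ge0 muE g0 mg cg.
have i1 : mu.-integrable setT (fun x : R => (`|f x|)%:E).
  apply: discrete_integrable => //.
  by under eq_fun do rewrite normr_id.
have i2 : mu.-integrable setT (fun x : R => (`|f x| - f x)%:E).
  apply: discrete_integrable => //.
  rewrite (_ : (fun m => _) = (fun m => v m * (`|f (y m)| - f (y m))))//.
  by apply/funext => m; rewrite ger0_norm.
rewrite (_ : f = (fun x => `|f x| - (`|f x| - f x))); last exact/funext.
rewrite RintegralB// /Rintegral E1 E2 /= -lim_seriesB//.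
by congr (limn (series _)); apply/funext => m /=; rewrite -?fE /=; rewrite !fctE; ring.
Qed.

End Construction.

Lemma measurable_horner (p : {poly R}) : measurable_fun setT (fun x : R => p.[x]).
Proof. by apply: continuous_measurable_fun => x; exact: continuous_horner. Qed.

End DiscreteMeasure.

(** * A square-summable sequence orthogonal to all polynomials *)

(** With [A = a b q], the inverse of the derivative at the lattice points of the
    canonical product over these points, up to a constant factor. *)
Definition annihilator {R : realType} (q A : R) (m : nat) : R :=
  wpoised q A m / qpoch q q m * (-1) ^+ m * q ^+ (m * m.-1)./2.

Section Annihilator.
Context {R : realType} (q : R) (q0 : 0 < q) (q1 : q < 1).
Implicit Types (a b c A : R) (p : {poly R}).

Let qn0 n : q ^+ n != 0. Proof. by rewrite gt_eqF ?exprn_gt0. Qed.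
Let qneq0 : q != 0. Proof. by rewrite gt_eqF. Qed.
Let qge0 n : 0 <= q ^+ n. Proof. by rewrite exprn_ge0 ?ltW. Qed.
Let qle1 n : q ^+ n <= 1. Proof. by rewrite exprn_ile1 ?ltW. Qed.

Lemma annihilator_sign a b c m : params q a b c ->
  0 < (-1) ^+ m * annihilator q (a * b * q) m.
Proof.
move=> H; have /andP[w0 _] := params_wpoised q0 q1 m H.
have e2 : (-1) ^+ m * (-1) ^+ m = 1 :> R by rewrite -exprMn mulrNN mulr1 expr1n.
rewrite [X in 0 < X](_ : _ = wpoised q (a * b * q) m / qpoch q q m * q ^+ (m * m.-1)./2).
  by rewrite !mulr_gt0 ?invr_gt0 ?qpoch_gt0 ?exprn_gt0//.
rewrite /annihilator; transitivity ((-1) ^+ m * (-1) ^+ m *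
  (wpoised q (a * b * q) m / qpoch q q m * q ^+ (m * m.-1)./2)); first by ring.
by rewrite e2 mul1r.
Qed.

(** The quotient of the annihilator by the weights. *)
Definition ann_quot a b c m : R :=
  qpoch q (b * q) m * qpoch q (c * q) m /
  (qpoch q (a * q) m * qpoch q (a * b * q / c) m) * (a / c) ^+ m.

Lemma annihilatorE a b c m : params q a b c ->
  annihilator q (a * b * q) m = dbqJ_weight q a b c m * ann_quot a b c m.
Proof.
move=> H; have [/andP[_ a1] /andP[_ b1] c1 _ be] := params_lt1 q0 H.
case: (H) => a0 _ b0 _ c0.
have cn0 : c != 0 by rewrite lt_eqF.
have an0 : a != 0 by rewrite gt_eqF.
have ra : (- c / a) ^+ m * (a / c) ^+ m = (-1) ^+ m.
  by rewrite -exprMn; congr (_ ^+ _); field; rewrite an0 cn0.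
rewrite weightE /annihilator /ann_quot -ra.
have := qpoch_neq0 q0 q1 m a1; have := qpoch_neq0 q0 q1 m b1.
have := qpoch_neq0 q0 q1 m q1.
have := qpoch_neq0 q0 q1 m (lt_trans c1 ltr01).
have := qpoch_neq0 q0 q1 m (lt_trans be ltr01).
move: (qpoch q (a * b * q / c) m) (qpoch q (c * q) m) (qpoch q q m)
  (qpoch q (b * q) m) (qpoch q (a * q) m) (wpoised _ _ _) ((- c / a) ^+ m)
  ((a / c) ^+ m) (q ^+ _) => X1 X2 X3 X4 X5 X6 X7 X8 X9 n1 n2 n3 n4 n5.
by field; rewrite n1 n2 n3 n4 n5.
Qed.

Lemma ann_quot_tame a b c : params q a b c -> tame q (ann_quot a b c).
Proof.
move=> H; have [/andP[a0' a1] /andP[b0' b1] c1 _ be] := params_lt1 q0 H.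
apply: (@ratio_tame _ q q0 q1 _ ((1 - c * q) / (1 - a * q) * `|a / c|)) => m.
have -> : ann_quot a b c m.+1 = (1 - b * q * q ^+ m) * (1 - c * q * q ^+ m) /
   ((1 - a * q * q ^+ m) * (1 - a * b * q / c * q ^+ m)) * (a / c) * ann_quot a b c m.
  by rewrite /ann_quot !qpochSr exprS !invfM; ring.
rewrite normrM ler_wpM2r// normrM ler_wpM2r//.
have bm : 0 <= 1 - b * q * q ^+ m <= 1.
  rewrite subr_ge0 gerBl mulr_ge0 ?(ltW b0')// andbT.
  by rewrite ltW// mulq_lt1// b1 ltW.
have am : 1 - a * q <= 1 - a * q * q ^+ m.
  by rewrite lerB// ler_piMr// ltW.
have am0 : 0 < 1 - a * q by rewrite subr_gt0.
have cm : 1 - c * q * q ^+ m <= 1 - c * q.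
  by rewrite lerB// -[leLHS]mulr1 ler_wnM2l// ltW.
have cm0 : 0 <= 1 - c * q * q ^+ m.
  by rewrite subr_ge0 (le_trans _ ler01)// mulr_le0_ge0// ltW.
have bem : 1 <= 1 - a * b * q / c * q ^+ m.
  by rewrite lerDl oppr_ge0 mulr_le0_ge0// ltW.
have am0' := lt_le_trans am0 am; have bem0 := lt_le_trans ltr01 bem.
case/andP: bm => b0 b1'.
rewrite ger0_norm; last by rewrite divr_ge0 ?mulr_ge0// ltW.
apply: ler_pM; rewrite ?mulr_ge0 ?invr_ge0//.
- by rewrite mulr_ge0// ltW.
- by rewrite -[leRHS]mul1r ler_pM.
- rewrite lef_pV2 ?posrE ?mulr_gt0// -[leLHS]mulr1 ler_pM//.
  exact: ltW.
Qed.

Lemma annihilator_rapid a b c : params q a b c -> rapid q (annihilator q (a * b * q)).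
Proof.
move=> H; have := rapidMtame q0 (weight_rapid q0 q1 H) (ann_quot_tame H).
by congr rapid; apply/funext => m; rewrite (annihilatorE m H).
Qed.

(** The partial sums have the closed form [s]. *)
Lemma annihilator_mass a b c : params q a b c -> ssum (annihilator q (a * b * q)) = 0.
Proof.
move=> H; have rh := annihilator_rapid H.
pose s m := (-1) ^+ m * q ^+ (m.+1 * m)./2 * qpoch q (a * b * q * q) m / qpoch q q m.
have sE m : series (annihilator q (a * b * q)) m.+1 = s m.
  elim: m => [|m IH].
    by rewrite /series /= big_nat1 /s /annihilator !qpoch0 /= !expr0 !mulr1 invr1.
  have -> : series (annihilator q (a * b * q)) m.+2 =
      series (annihilator q (a * b * q)) m.+1 + annihilator q (a * b * q) m.+1.
    by rewrite /series /= big_nat_recr.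
  rewrite IH /s /annihilator /wpoised.
  have Em : (m.+2 * m.+1)./2 = ((m.+1 * m)./2 + m.+1)%N := triS m.+1.
  rewrite Em (_ : m.+1.-1 = m)// exprD (exprS (-1)) !(qpochSr _ _ m).
  rewrite (_ : q ^+ (2 * m.+1) = q ^+ m.+1 ^+ 2); last by rewrite mulnC exprM.
  have qm0 : 1 - q * q ^+ m != 0.
    by rewrite subr_eq0 eq_sym lt_eqF// -exprS exprn_ilt1 ?ltW.
  have := qpoch_neq0 q0 q1 m q1; move: qm0; rewrite (exprS q m).
  move: (qpoch q q m) (q ^+ m) ((-1) ^+ m) (q ^+ (m.+1 * m)./2) (qpoch _ _ _)
    => Q y e t P qm0 Q0.
  by field; rewrite qm0 Q0.
have s0 : s @ \oo --> (0 : R).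
  apply: (rapid_cvg0 q0 q1).
  have [_ _ _ /andP[ab0 ab1] _] := params_lt1 q0 H.
  have ab1' : a * b * q * q < 1 by rewrite expr2 mulrA in ab1.
  apply: (@ratio_rapid _ q q0 q1 _ ((1 + `|a * b * q * q|) * q / (1 - q))) => m.
  rewrite [X in `|X| <= _](_ : _ = - ((1 - a * b * q * q * q ^+ m) / (1 - q * q ^+ m) *
    (q * q ^+ m) * s m)); last first.
    have Em : (m.+2 * m.+1)./2 = ((m.+1 * m)./2 + m.+1)%N := triS m.+1.
    by rewrite /s Em exprD (exprS (-1)) !(qpochSr _ _ m) (exprS q m) invfM; ring.
  set B := `|a * b * q * q|; rewrite normrN normrM ler_wpM2r// !normrM.
  rewrite (ger0_norm (qge0 m)) (ger0_norm (ltW q0)).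
  have qq : q * q ^+ m <= q by rewrite ler_piMr// ltW.
  have qm1 : 0 < 1 - q * q ^+ m by rewrite subr_gt0 (le_lt_trans qq).
  have q1' : 0 < 1 - q by rewrite subr_gt0.
  rewrite [leRHS](_ : _ = (1 + B) / (1 - q) * (q * q ^+ m)); last by ring.
  rewrite ler_wpM2r ?mulr_ge0 ?(ltW q0)//.
  apply: ler_pM => //.
    apply: le_trans (ler_normB _ _) _; rewrite normr1 lerD2l normrM -/B.
    by rewrite (ger0_norm (qge0 m)) ler_piMr// /B normr_ge0.
  by rewrite ger0_norm ?invr_ge0 ?(ltW qm1)// lef_pV2 ?posrE// lerB.
have cv := rapid_cvg_to q0 q1 rh.
move: cv; rewrite -cvg_shiftS (_ : (fun n => _) = s); last exact/funext.
by move=> cv; exact: cvg_unique cv s0.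
Qed.

Lemma annihilator_shift a b c m : params q a b c ->
  annihilator q (a * b * q) m.+1 * ((1 - q ^- m.+1) * (1 - a * b * q * q ^+ m.+1)) =
  (1 - a * b * q ^+ 2) * (1 - a * b * q ^+ 3) / q *
  annihilator q (a * q * (b * q) * q) m.
Proof.
move=> H; have := wpoised_shift q (a * b * q) m.
rewrite /annihilator (_ : a * q * (b * q) * q = a * b * q * q ^+ 2); last by ring.
have Em : (m.+1 * m.+1.-1)./2 = ((m * m.-1)./2 + m)%N := triS m.
rewrite Em exprD (qpochSr _ q) (exprS (-1)) (exprS q m).
have qm0 : 1 - q * q ^+ m != 0.
  by rewrite subr_eq0 eq_sym lt_eqF// -exprS exprn_ilt1 ?ltW.
have := qpoch_neq0 q0 q1 m q1; move: qm0 (qn0 m).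
move: (wpoised q (a * b * q) m.+1) (wpoised q (a * b * q * q ^+ 2) m)
  (qpoch q q m) (q ^+ m) ((-1) ^+ m) (q ^+ (m * m.-1)./2).
move=> W W' Q y e t qm0 y0 Q0 WE.
rewrite (_ : _ * _ = (W * (1 - a * b * q * (q * y))) *
  ((Q * (1 - q * y))^-1 * (-1 * e) * (t * y) * (1 - (q * y)^-1))); last by ring.
by rewrite WE; field; rewrite qneq0 y0 Q0 qm0.
Qed.

Lemma annihilatorMpoly_rapid a b c p : params q a b c ->
  rapid q (fun m => annihilator q (a * b * q) m * p.[dual_lattice q a b m]).
Proof.
move=> H; apply: (rapidMtame q0); first exact: annihilator_rapid H.
exact/(tame_horner q0 q1)/lattice_tame.
Qed.

Lemma annihilator_phi a b c k : params q a b c ->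
  ssum (fun m => annihilator q (a * b * q) m *
    (phi_poly q a b k).[dual_lattice q a b m]) = 0.
Proof.
elim: k a b c => [|k IH] a b c H.
  rewrite -(annihilator_mass H); apply: ssumE => m.
  by rewrite /phi_poly big_ord0 hornerC mulr1.
have H' := params_shift q0 q1 1 1 1 H; rewrite !expr1 in H'.
rewrite (ssum_recl q0 q1); last exact: annihilatorMpoly_rapid H.
rewrite (phi_step0 q0) mulr0 add0r.
transitivity (ssum (fun m => (1 - a * b * q ^+ 2) * (1 - a * b * q ^+ 3) / q *
  (annihilator q (a * q * (b * q) * q) m *
  (phi_poly q (a * q) (b * q) k).[dual_lattice q (a * q) (b * q) m]))).
  by apply: ssumE => m; rewrite (phi_stepS q0) [LHS]mulrA (annihilator_shift _ H) [RHS]mulrA.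
rewrite (ssumZ q0 q1); last exact: annihilatorMpoly_rapid H'.
by rewrite (IH _ _ _ H') mulr0.
Qed.

Lemma annihilator_poly a b c p : params q a b c ->
  ssum (fun m => annihilator q (a * b * q) m * p.[dual_lattice q a b m]) = 0.
Proof.
move=> H; have [k pE] := poly_span (size_phi q0 a b) (leqnSn (size p)).
have E n : ssum (fun m => annihilator q (a * b * q) m *
   (\sum_(i < n) k i *: phi_poly q a b i).[dual_lattice q a b m]) = 0.
  elim: n => [|n IH].
    rewrite -[RHS](@ssum0 R); apply: ssumE => m.
    by rewrite big_ord0 horner0 mulr0.
  under ssumE do rewrite big_ord_recr hornerD hornerZ mulrDr mulrCA.
  rewrite (ssumD q0 q1).
  - rewrite IH (ssumZ q0 q1); last exact: annihilatorMpoly_rapid H.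
    by rewrite (annihilator_phi _ H) mulr0 addr0.
  - exact: annihilatorMpoly_rapid H.
  - exact/rapidZ/(annihilatorMpoly_rapid _ H).
rewrite pE nth_default// mul0r scale0r addr0; exact: E.
Qed.

(** Spacing and growth of the lattice. *)
Lemma lattice_gap a b c : params q a b c -> exists2 g, 0 < g &
  forall m, dual_lattice q a b m + g <= dual_lattice q a b m.+1.
Proof.
move=> H; have [_ _ _ /andP[ab0 ab1] _] := params_lt1 q0 H.
exists ((1 - q) * (1 - a * b * q ^+ 2)) => [|m]; first by rewrite mulr_gt0 ?subr_gt0.
rewrite -lerBrDl.
have -> : dual_lattice q a b m.+1 - dual_lattice q a b m =
    (1 - q) * (q ^- m.+1 * (1 - a * b * q ^+ 2 * q ^+ m * q ^+ m)).
  rewrite /dual_lattice !exprS; move: (qn0 m); move: (q ^+ m) => y y0.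
  by field; rewrite qneq0 y0.
rewrite ler_wpM2l ?subr_ge0 ?(ltW q1)//.
rewrite -[leLHS]mul1r ler_pM//.
- by rewrite subr_ge0 ltW.
- by rewrite invf_ge1 ?exprn_gt0.
- by rewrite lerB// -mulrA ler_piMr ?(ltW ab0)// mulr_ile1.
Qed.

Lemma lattice_gt0 a b c m : params q a b c -> 0 < dual_lattice q a b m.
Proof.
by move=> [a0 _ b0 _ _]; rewrite addr_gt0 ?invr_gt0 ?mulr_gt0 ?exprn_gt0.
Qed.

Lemma lattice_inv a b y : exists K, forall m,
  `|(dual_lattice q a b m - y)^-1| <= K * q ^+ m.
Proof.
have qc : (fun m => q ^+ m) @ \oo --> (0 : R).
  by apply: cvg_expr; rewrite ger0_norm ?ltW.
pose u m := 1 + a * b * q * (q ^+ m * q ^+ m) - y * q ^+ m.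
have uc : u @ \oo --> (1 : R).
  rewrite -[X in _ --> X](_ : 1 + a * b * q * (0 * 0) - y * 0 = _); last first.
    by rewrite !mulr0 subr0 addr0.
  apply: cvgB; last by apply: cvgM; [exact: cvg_cst|].
  apply: cvgD; first exact: cvg_cst.
  apply: cvgM; first exact: cvg_cst.
  exact: cvgM.
have : (fun m => (u m)^-1) @ \oo --> (1^-1 : R) by apply: cvgV => //; exact: oner_neq0.
move=> /cvgP/cvg_seq_bounded[M [_ HM]]; exists (M + 1) => m.
have -> : (dual_lattice q a b m - y)^-1 = (u m)^-1 * q ^+ m.
  rewrite -[q ^+ m in RHS]invrK -invfM; congr (_^-1).
  rewrite /u /dual_lattice exprS; move: (qn0 m); move: (q ^+ m) => z z0.
  by field; rewrite z0.
rewrite normrM (ger0_norm (qge0 m)) ler_wpM2r//.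
by apply: (HM (M + 1)) => //; rewrite ltrDl.
Qed.

End Annihilator.

(** * A second orthogonality measure *)

(** [x], [w] and [h] stand for increasing points with a positive gap, positive
    weights, and a sequence of alternating sign that annihilates the
    polynomials. *)
Section Perturbation.
Context {R : realType} (q : R) (q0 : 0 < q) (q1 : q < 1).

Lemma rapid_unshift (u : nat -> R) : rapid q (fun m => u m.+1) -> rapid q u.
Proof.
move=> ru k; have [K HK] := ru k; have K0 := rapid_bound_ge0 HK.
have qk : 0 < q ^+ k by rewrite exprn_gt0.
exists (K / q ^+ k + `|u 0%N|) => -[|m].
  by rewrite muln0 mulr1 lerDr divr_ge0// ltW.
apply: le_trans (HK m) _; rewrite mulnS exprD mulrA mulrDl divfK ?gt_eqF//.
by rewrite ler_wpM2r ?exprn_ge0 ?(ltW q0)// lerDl mulr_ge0// ltW.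
Qed.

Lemma rapid_addn (u : nat -> R) r : rapid q (fun m => u (m + r)%N) -> rapid q u.
Proof.
elim: r u => [|r IH] u ru.
  by move: ru; congr rapid; apply/funext => m; rewrite addn0.
apply: rapid_unshift; apply: IH.
by move: ru; congr rapid; apply/funext => m; rewrite addnS.
Qed.

Lemma ssum_addn (u : nat -> R) r : rapid q u ->
  ssum u = \sum_(i < r) u i + ssum (fun m => u (m + r)%N).
Proof.
elim: r u => [|r IH] u ru.
  by rewrite big_ord0 add0r; apply: ssumE => m; rewrite addn0.
rewrite (ssum_recl q0 q1)// (IH (fun m => u m.+1)); last exact: rapid_shift.
rewrite big_ord_recl addrA; congr (_ + _).
by apply: ssumE => m; rewrite addnS.
Qed.

Variables (x w h : nat -> R).
Hypotheses (w_gt0 : forall m, 0 < w m) (w_rapid : rapid q w) (x_tame : tame q x).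
Hypothesis h_sign : forall m, 0 < (-1) ^+ m * h m.
Hypothesis hw_tame : tame q (fun m => h m / w m).
Hypothesis h_poly : forall p : {poly R}, ssum (fun m => h m * p.[x m]) = 0.
Variable g : R.
Hypotheses (g_gt0 : 0 < g) (x_gap : forall m, x m + g <= x m.+1).
Hypothesis x_inv : forall y, exists K, forall m, `|(x m - y)^-1| <= K * q ^+ m.

Let h_rapid : rapid q h.
Proof.
have := rapidMtame q0 w_rapid hw_tame.
by congr rapid; apply/funext => m; rewrite mulrC divfK// gt_eqF.
Qed.

Let h_norm m : `|h m| = (-1) ^+ m * h m.
Proof. by rewrite -(gtr0_norm (h_sign m)) normrM normrX normrN1 expr1n mul1r. Qed.

Let H : R := ssum (fun m => `|h m|).

Let h_le m : `|h m| <= H.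
Proof. exact: (ssum_ge_term q0 q1 m (rapid_norm h_rapid)). Qed.

Let hn_gt0 m : 0 < `|h m|. Proof. by rewrite h_norm. Qed.

Let H_gt0 : 0 < H. Proof. exact: lt_le_trans (hn_gt0 0%N) (h_le _). Qed.

Lemma gap_lt m n : (m < n)%N -> x m + g <= x n.
Proof.
elim: n => // n IH; rewrite ltnS leq_eqVlt => /orP[/eqP -> //|/IH mn].
by apply: le_trans mn (le_trans _ (x_gap n)); rewrite lerDl ltW.
Qed.

(** The new points, slightly to the left of the old ones; the distance
    is proportional to [|h i|] and so small that the pole at [x i] decides the
    sign of the Stieltjes transform of [h] there. *)
Definition newpt i : R := x i - g / 4 * (`|h i| / H).

Let shift_bd i : 0 < g / 4 * (`|h i| / H) <= g / 4.
Proof.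
have g4 : 0 < g / 4 by rewrite divr_gt0.
by rewrite mulr_gt0 ?divr_gt0//= ler_piMr ?(ltW g4)// ler_pdivrMr// mul1r.
Qed.

Lemma newpt_gap i m : m != i -> g / 2 <= `|x m - newpt i|.
Proof.
rewrite /newpt; move: (shift_bd i); move: (g / 4 * (`|h i| / H)) => d /andP[d0 d4].
case: ltngtP => // mi _.
- have e := gap_lt mi; have g0 := g_gt0; rewrite ltr0_norm; lra.
- have e := gap_lt mi; have g0 := g_gt0; rewrite gtr0_norm; lra.
Qed.

Lemma newpt_neq i m : x m != newpt i.
Proof.
have [->|mi] := eqVneq m i.
  have /andP[d0 _] := shift_bd i.
  by rewrite gt_eqF// /newpt ltrBlDr ltrDl.
have := newpt_gap mi; rewrite -subr_eq0 -normr_eq0; apply: contraTneq => ->.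
by rewrite -ltNge divr_gt0.
Qed.

Lemma newpt_lt i j : (i < j)%N -> newpt i < newpt j.
Proof.
move=> ij; have e := gap_lt ij; rewrite /newpt.
move: (shift_bd i) (shift_bd j); move: (g / 4 * _) (g / 4 * _) => d d'.
by move=> /andP[d0 d4] /andP[d0' d4']; have g0 := g_gt0; lra.
Qed.

Let inv_tame y : tame q (fun m => (x m - y)^-1).
Proof.
have [K HK] := x_inv y; exists 0%N, K => m; rewrite mul0n mulr1.
apply: le_trans (HK m) _; rewrite ler_piMr ?exprn_ile1 ?(ltW q0) ?(ltW q1)//.
by have := HK 0%N; rewrite mulr1; exact: le_trans.
Qed.

(** The Stieltjes transform of the signed measure [h]. *)
Definition hstieltjes y : R := ssum (fun m => h m / (x m - y)).

Lemma hstieltjes_sign i : 0 < (-1) ^+ i * hstieltjes (newpt i).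
Proof.
have ru : rapid q (fun m => h m / (x m - newpt i)).
  exact: (rapidMtame q0 h_rapid (inv_tame _)).
have rn := rapid_norm h_rapid.
(* adding a multiple of [|h|] makes all terms nonnegative, so that the sum is
   at least its [i]-th term *)
pose v m := (-1) ^+ i * (h m / (x m - newpt i)) + 2 / g * `|h m|.
have rv : rapid q v by apply: rapidD; apply: rapidZ.
have vE : ssum v = (-1) ^+ i * hstieltjes (newpt i) + 2 / g * H.
  rewrite (ssumD q0 q1); [|exact: rapidZ|exact: rapidZ].
  by rewrite (ssumZ q0 q1)// (ssumZ q0 q1).
have vi : v i = 4 * H / g + 2 / g * `|h i|.
  rewrite /v mulrA -h_norm /newpt opprB addrCA subrr addr0; congr (_ + _).
  by field; rewrite !gt_eqF.
have v0 m : 0 <= v m.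
  have [->|mi] := eqVneq m i.
    by rewrite vi addr_ge0// !mulr_ge0 ?invr_ge0 ?(ltW H_gt0) ?(ltW g_gt0).
  have := newpt_gap mi => gm.
  have gm0 : 0 < `|x m - newpt i| by apply: lt_le_trans gm; rewrite divr_gt0.
  have : `|(-1) ^+ i * (h m / (x m - newpt i))| <= 2 / g * `|h m|.
    rewrite normrM normrX normrN1 expr1n mul1r normrM mulrC ler_wpM2r// normfV.
    by rewrite -[leRHS]invrK lef_pV2 ?posrE ?invr_gt0 ?divr_gt0// invf_div.
  by rewrite ler_norml /v => /andP[? _]; lra.
have := ssum_ge_term q0 q1 i rv v0; rewrite vi vE => le1.
have h2 : 0 < 2 / g * `|h i| by rewrite mulr_gt0 ?divr_gt0.
have H2 : 0 < H / g by rewrite divr_gt0.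
have -> : (-1) ^+ i * hstieltjes (newpt i) =
  ((-1) ^+ i * hstieltjes (newpt i) + 2 / g * H) - 2 * (H / g) by ring.
have e4 : 4 * H / g = 4 * (H / g) by rewrite mulrA.
rewrite e4 in le1; lra.
Qed.

Lemma newpt_inj : injective newpt.
Proof.
by move=> i j e; case: (ltngtP i j) => // ij; have := newpt_lt ij; rewrite e ltxx.
Qed.

(** The derivative of [G] at the [i]-th of [r] new points. *)
Definition newdiff i r : R :=
  \prod_(j < r | (j : nat) != i) (newpt i - newpt j).

Lemma newdiff_sign i r : (i < r)%N -> 0 < (-1) ^+ r.-1 * (-1) ^+ i * newdiff i r.
Proof.
elim: r => // r IH; rewrite ltnS leq_eqVlt => /orP[/eqP <-|ir].
  rewrite -exprMn mulrNN mulr1 expr1n mul1r /newdiff.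
  apply: prodr_gt0 => j ji; rewrite subr_gt0 newpt_lt//.
  by rewrite ltn_neqAle ji -ltnS ltn_ord.
have := IH ir; rewrite /newdiff big_mkcond [in X in _ -> X]big_mkcond big_ord_recr /=.
rewrite (_ : (r != i)) ?gtn_eqF//.
case: r ir {IH} => // r ir; rewrite exprS.
have n0 : newpt i - newpt r.+1 < 0 by rewrite subr_lt0 newpt_lt.
set P := \prod_(_ < _) _; rewrite [r.+1.-1]/= => p0.
rewrite (_ : _ * _ = - ((-1) ^+ r * (-1) ^+ i * P * (newpt i - newpt r.+1))); last by ring.
by rewrite oppr_gt0 pmulr_rlt0.
Qed.

Lemma newdiff_neq0 i r : newdiff i r != 0.
Proof.
apply/prodf_neq0 => j ji; rewrite subr_eq0.
by case: (ltngtP (j : nat) i) ji => // ij _; [rewrite gt_eqF|rewrite lt_eqF]; rewrite ?newpt_lt.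
Qed.

(** [G] at the old points. *)
Let Gm r m : R := \prod_(j < r) (x m - newpt j).

(** Lagrange interpolation at the new points: [p] minus its interpolant is a
    multiple of [G], which [h / G] annihilates. *)
Lemma newpt_quadrature r (p : {poly R}) :
  ssum (fun m => h m / Gm r m * p.[x m]) =
  \sum_(i < r) p.[newpt i] * (hstieltjes (newpt i) / newdiff i r).
Proof.
pose ell (i : 'I_r) : {poly R} := \prod_(j < r | (j : nat) != i) ('X - (newpt j)%:P).
pose L := \sum_(i < r) (p.[newpt i] / newdiff i r) *: ell i.
have ellE (i : 'I_r) y : (ell i).[y] = \prod_(j < r | (j : nat) != i) (y - newpt j).
  by rewrite horner_prod; apply: eq_bigr => j _; rewrite hornerXsubC.
have Lk (k : 'I_r) : L.[newpt k] = p.[newpt k].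
  rewrite horner_sum (bigD1 k)//= hornerZ ellE divfK ?newdiff_neq0//.
  rewrite big1 ?addr0// => i ik; rewrite hornerZ ellE (bigD1 k)/=; last by rewrite eq_sym.
  by rewrite subrr mul0r mulr0.
have [Q pE] : exists Q, p - L = Q * \prod_(j <- [seq newpt (k : 'I_r) | k <- enum 'I_r]) ('X - j%:P).
  apply: uniq_roots_prod_XsubC.
    by apply/allP => _ /mapP[k _ ->]; rewrite /root hornerD hornerN Lk subrr.
  by rewrite uniq_rootsE map_inj_uniq ?enum_uniq// => i j /newpt_inj/val_inj.
have G0 m : Gm r m != 0 by apply/prodf_neq0 => j _; rewrite subr_eq0 newpt_neq.
have {}pE m : h m / Gm r m * p.[x m] = h m * Q.[x m] +
    \sum_(i < r) p.[newpt i] / newdiff i r * (h m / (x m - newpt i)).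
  have pxE : p.[x m] = Q.[x m] * Gm r m + L.[x m].
    rewrite -{1}(subrK L p) pE hornerD hornerM big_map big_enum /= horner_prod.
    by congr (_ * _ + _); apply: eq_bigr => j _; rewrite hornerXsubC.
  rewrite {1}pxE mulrDr; congr (_ + _); first by rewrite mulrCA divfK// mulrC.
  rewrite horner_sum mulr_sumr; apply: eq_bigr => i _; rewrite hornerZ.
  have GE : Gm r m = (x m - newpt i) * (ell i).[x m] by rewrite ellE /Gm (bigD1 i).
  have := G0 m; rewrite GE mulf_eq0 negb_or => /andP[xi0 li0].
  by field; rewrite xi0 li0 newdiff_neq0.
have rH (i : 'I_r) : rapid q (fun m => p.[newpt i] / newdiff i r * (h m / (x m - newpt i))).
  exact/rapidZ/(rapidMtame q0 h_rapid)/inv_tame.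
have E n (F : 'I_n -> nat -> R) : (forall i, rapid q (F i)) ->
    rapid q (fun m => \sum_(i < n) F i m) /\
    ssum (fun m => \sum_(i < n) F i m) = \sum_(i < n) ssum (F i).
  elim: n F => [|n IH] F rF.
    rewrite big_ord0 -[X in _ = X](@ssum0 R); split; last first.
      by apply: ssumE => m; rewrite big_ord0.
    by move=> k; exists 0 => m; rewrite big_ord0 normr0 mul0r.
  have [rF' FE] := IH (fun i => F (widen_ord (leqnSn n) i)) (fun i => rF _).
  have -> : (fun m => \sum_(i < n.+1) F i m) = (fun m =>
      \sum_(i < n) F (widen_ord (leqnSn n) i) m + F ord_max m).
    by apply/funext => m; rewrite big_ord_recr.
  split; first exact: rapidD.
  by rewrite (ssumD q0 q1)// FE big_ord_recr.
have [rs sE] := E r (fun i m => p.[newpt i] / newdiff i r * (h m / (x m - newpt i))) rH.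
rewrite (ssumE pE) (ssumD q0 q1)//; last first.
  exact/(rapidMtame q0 h_rapid)/(tame_horner q0 q1).
rewrite h_poly add0r sE; apply: eq_bigr => i _.
rewrite (ssumZ q0 q1); last exact/(rapidMtame q0 h_rapid)/inv_tame.
by rewrite -/(hstieltjes _); ring.
Qed.

(** Each factor of [G] gains a factor [q^m] over [h / w]. *)
Lemma Gm_bound : exists r : nat, exists2 C, 0 <= C &
  forall m, `|h m / Gm r.+1 m| <= C * w m.
Proof.
have [k [K HK]] := hw_tame.
exists k.
have [L HL] : exists L, forall m, `|(Gm k.+1 m)^-1| <= L * q ^+ (k.+1 * m).
  elim: (k.+1) => [|r [L HL]].
    by exists 1 => m; rewrite /Gm big_ord0 invr1 normr1 mul0n mulr1.
  have [M HM] := x_inv (newpt r).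
  exists (L * M) => m; rewrite /Gm big_ord_recr /= invfM normrM.
  rewrite mulSn addnC exprD mulrACA ler_pM//; exact: HL.
have L0 : 0 <= L by have := HL 0%N; rewrite muln0 mulr1; exact: le_trans.
have K0 : 0 <= K by have := HK 0%N; rewrite muln0 mulr1; exact: le_trans.
exists (K * L); first exact: mulr_ge0.
move=> m; rewrite normrM.
have -> : h m = w m * (h m / w m) by rewrite mulrC divfK ?gt_eqF.
rewrite normrM gtr0_norm// -mulrA mulrC ler_wpM2r ?(ltW (w_gt0 m))//.
apply: (@le_trans _ _ (`|h m / w m| * (L * q ^+ (k.+1 * m)))).
  by rewrite ler_wpM2l.
rewrite mulrCA [leRHS]mulrC ler_wpM2l//; apply: le_trans (HK m).
by rewrite ler_wpM2l// mulSn addnC exprD ler_piMr ?exprn_ge0 ?exprn_ile1 ?(ltW q0) ?(ltW q1).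
Qed.

(** The perturbed measure: the weights [w + eps (-1)^r h / G] on the old
    points and positive masses at the [r] new points. *)
Lemma second_solution : exists v y : nat -> R,
  [/\ forall m, 0 <= v m, forall p : {poly R}, rapid q (fun m => v m * p.[y m]),
      forall p : {poly R}, ssum (fun m => v m * p.[y m]) = ssum (fun m => w m * p.[x m]) &
      exists2 i, 0 < v i & forall m, x m != y i].
Proof.
have [k [C C0 HC]] := Gm_bound; set r := k.+1 in HC.
pose eps := (C + 1)^-1; have eps0 : 0 < eps by rewrite invr_gt0 ltr_wpDl.
pose s : R := (-1) ^+ r.
pose w' m := w m + eps * s * (h m / Gm r m).
pose e i := - s * (hstieltjes (newpt i) / newdiff i r).
have e0 i : (i < r)%N -> 0 < e i.
  move=> ir; have d0 := newdiff_sign ir; have f0 := hstieltjes_sign i.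
  rewrite /e /s exprS mulN1r opprK.
  have n0 := newdiff_neq0 i r.
  have s2 : (-1) ^+ k * (-1) ^+ k = 1 :> R by rewrite -exprMn mulrNN mulr1 expr1n.
  rewrite (_ : _ * _ = ((-1) ^+ i * hstieltjes (newpt i)) /
    ((-1) ^+ r.-1 * (-1) ^+ i * newdiff i r)); first by rewrite divr_gt0.
  have i0 : (-1) ^+ i != 0 :> R by rewrite signr_eq0.
  have k0 : (-1) ^+ k != 0 :> R by rewrite signr_eq0.
  rewrite /=; move: (hstieltjes (newpt i)) (newdiff i r) n0 => F G n0.
  move: ((-1) ^+ i) ((-1) ^+ k) i0 k0 s2 => t1 t2 i0 k0 s2.
  transitivity (t2 * t2 * (F / (t2 * G))); first by field; rewrite k0 n0.
  by rewrite s2; field; rewrite i0 k0 n0.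
have s1 : `|s| = 1 by rewrite /s normrX normrN1 expr1n.
have w'0 m : 0 <= w' m.
  have : `|eps * s * (h m / Gm r m)| <= w m.
    rewrite normrM normrM s1 mulr1 gtr0_norm// /eps ler_pdivrMl ?ltr_wpDl//.
    by apply: le_trans (HC m) _; rewrite ler_wpM2r ?(ltW (w_gt0 m))// lerDl.
  by rewrite ler_norml /w' => /andP[? _]; lra.
have rGm : rapid q (fun m => h m / Gm r m).
  apply: rapid_le (rapidZ C w_rapid) => m.
  by rewrite [leRHS]ger0_norm// mulr_ge0// ltW.
pose v m := if (m < r)%N then eps * e m else w' (m - r)%N.
pose y m := if (m < r)%N then newpt m else x (m - r)%N.
have vy (p : {poly R}) m : v (m + r)%N * p.[y (m + r)%N] = w' m * p.[x m].
  by rewrite /v /y ltnNge leq_addl /= addnK.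
have rw' (p : {poly R}) : rapid q (fun m => w m * p.[x m]) /\
    rapid q (fun m => (h m / Gm r m) * p.[x m]).
  by split; apply: (rapidMtame q0) => //; exact: (tame_horner q0 q1).
have w'E (p : {poly R}) m : w' m * p.[x m] = w m * p.[x m] + eps * s * ((h m / Gm r m) * p.[x m]).
  by rewrite /w'; move: (h m / Gm r m) => t; ring.
exists v, y; split.
- by move=> m; rewrite /v; case: ltnP => // mr; rewrite mulr_ge0 ?(ltW eps0)// ltW ?e0.
- move=> p; apply: (@rapid_addn _ r); have [r1 r2] := rw' p.
  rewrite (_ : (fun m => _) = (fun m => w m * p.[x m] + eps * s * ((h m / Gm r m) * p.[x m]))).
    by apply: rapidD => //; exact: rapidZ.
  by apply/funext => m; rewrite vy w'E.
- move=> p; have [r1 r2] := rw' p.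
  rewrite (@ssum_addn _ r); last first.
    apply: (@rapid_addn _ r).
    rewrite (_ : (fun m => _) = (fun m => w m * p.[x m] + eps * s * ((h m / Gm r m) * p.[x m]))).
      by apply: rapidD => //; exact: rapidZ.
    by apply/funext => m; rewrite vy w'E.
  rewrite (ssumE (fun m => vy p m)) (ssumE (w'E p)) (ssumD q0 q1)//; last exact: rapidZ.
  rewrite (ssumZ q0 q1)// newpt_quadrature addrCA -[RHS]addr0; congr (_ + _).
  rewrite mulr_sumr -big_split big1// => i _ /=.
  by rewrite /v /y ltn_ord /e; ring.
- by exists 0%N; [rewrite /v /= mulr_gt0 ?e0|move=> m; exact: newpt_neq].
Qed.

End Perturbation.

(** * Orthonormal polynomials in a weighted sequence space *)

Section Weighted.
Context {R : realType} (q : R) (q0 : 0 < q) (q1 : q < 1).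
Variables (w x : nat -> R).
Hypotheses (w_gt0 : forall m, 0 < w m) (w_rapid : rapid q w) (x_tame : tame q x).
Implicit Types f g : nat -> R.

(** Integration against the weights; it is used on tame sequences only. *)
Definition wsum f : R := ssum (fun m => w m * f m).

Lemma wtame_rapid f : tame q f -> rapid q (fun m => w m * f m).
Proof. exact: rapidMtame. Qed.

Lemma wsumE f g : f =1 g -> wsum f = wsum g.
Proof. by move=> /funext ->. Qed.

Lemma wsumD f g : tame q f -> tame q g ->
  wsum (fun m => f m + g m) = wsum f + wsum g.
Proof.
move=> tf tg; rewrite /wsum -(ssumD q0 q1); try exact: wtame_rapid.
by apply: ssumE => m; rewrite mulrDr.
Qed.

Lemma wsumZ c f : tame q f -> wsum (fun m => c * f m) = c * wsum f.
Proof.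
move=> tf; rewrite /wsum -(ssumZ q0 q1); last exact: wtame_rapid.
by apply: ssumE => m; rewrite mulrCA.
Qed.

Lemma wsumB f g : tame q f -> tame q g ->
  wsum (fun m => f m - g m) = wsum f - wsum g.
Proof.
move=> tf tg; rewrite -[in RHS]mulN1r -wsumZ// -wsumD//; last exact: tameZ.
by apply: wsumE => m; rewrite mulN1r.
Qed.

Lemma wsum_ge0 f : tame q f -> (forall m, 0 <= f m) -> 0 <= wsum f.
Proof.
move=> tf f0; apply: (ssum_ge0 q0 q1); first exact: wtame_rapid.
by move=> m; rewrite mulr_ge0// ltW.
Qed.

Lemma wsum_sum n (F : 'I_n -> nat -> R) : (forall i, tame q (F i)) ->
  wsum (fun m => \sum_(i < n) F i m) = \sum_(i < n) wsum (F i).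
Proof.
elim: n F => [|n IH] F tF.
  rewrite big_ord0 -[RHS](mul0r (wsum (fun=> 0))) -wsumZ; last exact: tame_cst.
  by apply: wsumE => m; rewrite big_ord0 mul0r.
rewrite big_ord_recr /= -(IH (fun i => F (widen_ord (leqnSn n) i)))// -wsumD//; last exact: tame_sum.
by apply: wsumE => m; rewrite big_ord_recr.
Qed.

Lemma poly_tame (p : {poly R}) : tame q (fun m => p.[x m]).
Proof. exact: tame_horner. Qed.

Lemma tameB f g : tame q f -> tame q g -> tame q (fun m => f m - g m).
Proof. by move=> tf tg; apply: tameD => //; exact: tameN. Qed.

Section Bessel.
Variable e : nat -> nat -> R.
Hypotheses (e_tame : forall n, tame q (e n)).
Hypothesis e_orth : forall n k, wsum (fun m => e n m * e k m) = (n == k)%:R.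

(** [f] minus its projection on the span of the first [n] members of [e]. *)
Let defect f n m := f m - \sum_(j < n) wsum (fun m => f m * e j m) * e j m.

Let defect_tame f n : tame q f -> tame q (defect f n).
Proof. by move=> tf; apply: tameB => //; apply: tame_sum => // i; exact: tameZ. Qed.

Let coefM_tame f g : tame q f -> tame q g -> tame q (fun m => f m * g m).
Proof. exact: tameM. Qed.

Let defect_orth f n k : tame q f -> (k < n)%N ->
  wsum (fun m => defect f n m * e k m) = 0.
Proof.
move=> tf kn.
transitivity (wsum (fun m => f m * e k m -
    \sum_(j < n) wsum (fun m => f m * e j m) * (e j m * e k m))).
  apply: wsumE => m; rewrite /defect mulrBl mulr_suml; congr (_ - _).
  by apply: eq_bigr => j _; rewrite mulrA.
have te (j : 'I_n) : tame q (fun m => wsum (fun m => f m * e j m) * (e j m * e k m)).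
  by apply: tameZ => //; exact: coefM_tame.
rewrite wsumB; [|exact: coefM_tame|exact: tame_sum].
rewrite wsum_sum// (bigD1 (Ordinal kn))//= big1 => [|j jk].
  rewrite wsumZ; last exact: coefM_tame.
  by rewrite e_orth eqxx mulr1 addr0 subrr.
rewrite wsumZ; last exact: coefM_tame.
rewrite e_orth (_ : (j : nat) == k = false) ?mulr0//.
by apply: contraNF jk => /eqP jk; apply/eqP/val_inj.
Qed.

(** Bessel's identity. *)
Lemma defect_sq f n : tame q f -> wsum (fun m => defect f n m * defect f n m) =
  wsum (fun m => f m * f m) - \sum_(j < n) wsum (fun m => f m * e j m) ^+ 2.
Proof.
move=> tf; have td := defect_tame n tf.
transitivity (wsum (fun m => defect f n m * f m -
    \sum_(j < n) wsum (fun m => f m * e j m) * (defect f n m * e j m))).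
  apply: wsumE => m; rewrite {2}/defect mulrBr mulr_sumr; congr (_ - _).
  by apply: eq_bigr => j _; rewrite mulrCA.
have te (j : 'I_n) : tame q (fun m => wsum (fun m => f m * e j m) * (defect f n m * e j m)).
  by apply: tameZ => //; exact: coefM_tame.
rewrite wsumB; [|exact: coefM_tame|exact: tame_sum].
rewrite wsum_sum// big1 => [|j _]; last first.
  by rewrite wsumZ ?defect_orth ?mulr0//; exact: coefM_tame.
rewrite subr0.
transitivity (wsum (fun m => f m * f m -
    \sum_(j < n) wsum (fun m => f m * e j m) * (f m * e j m))).
  apply: wsumE => m; rewrite /defect mulrBl mulr_suml; congr (_ - _).
  by apply: eq_bigr => j _; rewrite -mulrA (mulrC (e _ _)).
have tf' (j : 'I_n) : tame q (fun m => wsum (fun m => f m * e j m) * (f m * e j m)).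
  by apply: tameZ => //; exact: coefM_tame.
rewrite wsumB; [|exact: coefM_tame|exact: tame_sum].
rewrite wsum_sum//; congr (_ - _); apply: eq_bigr => j _.
by rewrite wsumZ ?expr2//; exact: coefM_tame.
Qed.

Lemma bessel f n : tame q f ->
  \sum_(j < n) wsum (fun m => f m * e j m) ^+ 2 <= wsum (fun m => f m * f m).
Proof.
move=> tf; rewrite -subr_ge0 -defect_sq//; apply: wsum_ge0.
  by apply: coefM_tame; exact: defect_tame.
by move=> m; rewrite -expr2 sqr_ge0.
Qed.

(** If [f] is not orthogonal to some [g] that is orthogonal to all the [e n],
    Bessel's inequality is strict, uniformly in the number of terms. *)
Lemma bessel_strict f g : tame q f -> tame q g ->
  (forall n, wsum (fun m => g m * e n m) = 0) -> wsum (fun m => f m * g m) != 0 ->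
  exists2 eta, 0 < eta & forall n,
  \sum_(j < n) wsum (fun m => f m * e j m) ^+ 2 <= wsum (fun m => f m * f m) - eta.
Proof.
move=> tf tg gorth; set X := wsum _ => X0.
set Y := wsum (fun m => g m * g m).
have Y0 : 0 <= Y.
  by apply: wsum_ge0 => [|m]; [exact: coefM_tame|rewrite -expr2 sqr_ge0].
have Y1 : 0 < Y + 1 by rewrite ltr_wpDl.
exists (X ^+ 2 / (Y + 1)); first by rewrite divr_gt0// exprn_even_gt0.
move=> n; have td := defect_tame n tf.
have dg : wsum (fun m => defect f n m * g m) = X.
  transitivity (wsum (fun m => f m * g m -
    \sum_(j < n) wsum (fun m => f m * e j m) * (g m * e j m))).
    apply: wsumE => m; rewrite /defect mulrBl mulr_suml; congr (_ - _).
    by apply: eq_bigr => j _; rewrite -mulrA (mulrC (e _ _)).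
  have te (j : 'I_n) : tame q (fun m => wsum (fun m => f m * e j m) * (g m * e j m)).
    by apply: tameZ => //; exact: coefM_tame.
  rewrite wsumB; [|exact: coefM_tame|exact: tame_sum].
  rewrite wsum_sum// big1 ?subr0// => j _.
  by rewrite wsumZ ?gorth ?mulr0//; exact: coefM_tame.
(* nearly the [s] that minimizes the norm of [defect f n - s g], with [Y + 1]
   for [Y] to avoid dividing by 0 *)
pose s := X / (Y + 1).
have : 0 <= wsum (fun m => (defect f n m - s * g m) * (defect f n m - s * g m)).
  apply: wsum_ge0 => [|m]; last by rewrite -expr2 sqr_ge0.
  by apply: coefM_tame; apply: tameB => //; exact: tameZ.
have -> : wsum (fun m => (defect f n m - s * g m) * (defect f n m - s * g m)) =
    wsum (fun m => defect f n m * defect f n m) - 2 * s * X + s ^+ 2 * Y.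
  transitivity (wsum (fun m => (defect f n m * defect f n m +
      (- (2 * s)) * (defect f n m * g m)) + s ^+ 2 * (g m * g m))).
    by apply: wsumE => m; ring.
  have t1 : tame q (fun m => defect f n m * defect f n m) by exact: coefM_tame.
  have t2 : tame q (fun m => defect f n m * g m) by exact: coefM_tame.
  have t3 : tame q (fun m => g m * g m) by exact: coefM_tame.
  rewrite wsumD; [|by apply: tameD => //; exact: tameZ|exact: tameZ].
  rewrite wsumD//; last exact: tameZ.
  by rewrite !wsumZ// dg -/Y; ring.
rewrite defect_sq// => le0.
have sX : 2 * s * X - s ^+ 2 * Y = X ^+ 2 / (Y + 1) + s ^+ 2.
  by rewrite /s; field; rewrite gt_eqF.
have s2 := sqr_ge0 s; move: le0 s2 sX.
move: (\sum_(j < n) _) (wsum _) (s ^+ 2 * Y) (2 * s * X) (X ^+ 2 / _) (s ^+ 2).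
by move=> A B S T U V le0 s2 sX; lra.
Qed.

End Bessel.

Section Recurrence.
Variable p : nat -> {poly R}.
Hypothesis p_size : forall n, size (p n) = n.+1.
Hypothesis p_orth : forall n k, wsum (fun m => (p n).[x m] * (p k).[x m]) = (n == k)%:R.

Lemma expansion (s : {poly R}) n : (size s <= n)%N ->
  s = \sum_(k < n) wsum (fun m => s.[x m] * (p k).[x m]) *: p k.
Proof.
case: n => [|n] sn.
  by rewrite big_ord0; apply/eqP; rewrite -size_poly_leq0.
have [c0 sE0] := poly_span p_size sn.
pose c k := if (k < n)%N then c0 k else s`_n / (p n)`_n.
have sE : s = \sum_(k < n.+1) c k *: p k.
  rewrite big_ord_recr /= /c ltnn {1}sE0; congr (_ + _).
  by apply: eq_bigr => i _; rewrite ltn_ord.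
rewrite {1}sE; apply: eq_bigr => k _; congr (_ *: _).
transitivity (wsum (fun m => \sum_(j < n.+1) c j * ((p j).[x m] * (p k).[x m]))); last first.
  apply: wsumE => m; rewrite sE horner_sum mulr_suml; apply: eq_bigr => j _.
  by rewrite hornerZ mulrA.
have tp i j : tame q (fun m => (p i).[x m] * (p j).[x m]) by apply: tameM => //; exact: poly_tame.
rewrite wsum_sum => [|j]; last exact: tameZ.
rewrite (bigD1 k)//= big1 ?addr0 => [|j jk]; last first.
  rewrite wsumZ// p_orth (_ : (j : nat) == k = false) ?mulr0//.
  by apply: contraNF jk => /eqP jk; apply/eqP/val_inj.
by rewrite wsumZ// p_orth eqxx mulr1.
Qed.

Lemma orth_lower (s : {poly R}) n : (size s <= n)%N ->
  wsum (fun m => s.[x m] * (p n).[x m]) = 0.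
Proof.
move=> sn.
have tp i j : tame q (fun m => (p i).[x m] * (p j).[x m]) by apply: tameM => //; exact: poly_tame.
transitivity (wsum (fun m => \sum_(j < n) wsum (fun m => s.[x m] * (p j).[x m]) *
   ((p j).[x m] * (p n).[x m]))).
  apply: wsumE => m; rewrite {1}(expansion sn) horner_sum mulr_suml.
  by apply: eq_bigr => j _; rewrite hornerZ mulrA.
rewrite wsum_sum => [|j]; last exact: tameZ.
by rewrite big1// => j _; rewrite wsumZ// p_orth ltn_eqF// mulr0.
Qed.

(** The entries of the Jacobi matrix. *)
Definition jacobi_b n := wsum (fun m => x m * (p n).[x m] * (p n.+1).[x m]).
Definition jacobi_a n := wsum (fun m => x m * (p n).[x m] * (p n).[x m]).

Let xpE i j m : x m * (p i).[x m] * (p j).[x m] = ('X * p i).[x m] * (p j).[x m].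
Proof. by rewrite hornerM hornerX. Qed.

Lemma recurrence0 : 'X * p 0%N = jacobi_b 0 *: p 1%N + jacobi_a 0 *: p 0%N.
Proof.
have sz : (size ('X * p 0%N)%R <= 2)%N by rewrite mulrC size_mulX -?size_poly_eq0 p_size.
rewrite [LHS](expansion sz) 2!big_ord_recr /= big_ord0 add0r. rewrite addrC.
by congr (_ *: _ + _ *: _); apply: wsumE => m; rewrite xpE.
Qed.

Lemma recurrenceS n : 'X * p n.+1 =
  jacobi_b n.+1 *: p n.+2 + jacobi_a n.+1 *: p n.+1 + jacobi_b n *: p n.
Proof.
have sz : (size ('X * p n.+1)%R <= n.+3)%N by rewrite mulrC size_mulX -?size_poly_eq0 p_size.
rewrite [LHS](expansion sz) !big_ord_recr /= big1 => [|j _]; last first.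
  rewrite (_ : wsum _ = 0) ?scale0r//.
  transitivity (wsum (fun m => ('X * p j).[x m] * (p n.+1).[x m])).
    by apply: wsumE => m; rewrite !hornerM !hornerX; ring.
  apply: orth_lower; rewrite mulrC size_mulX -?size_poly_eq0 p_size//.
  by rewrite !ltnS; exact: ltn_ord.
have E0 : wsum (fun m => ('X * p n.+1).[x m] * (p n).[x m]) = jacobi_b n.
  by apply: wsumE => m; rewrite hornerM hornerX; ring.
have E1 : wsum (fun m => ('X * p n.+1).[x m] * (p n.+1).[x m]) = jacobi_a n.+1.
  by apply: wsumE => m; rewrite xpE.
have E2 : wsum (fun m => ('X * p n.+1).[x m] * (p n.+2).[x m]) = jacobi_b n.+1.
  by apply: wsumE => m; rewrite xpE.
by rewrite E0 E1 E2 add0r addrC (addrC (_ *: p n)) addrA.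
Qed.

End Recurrence.
End Weighted.

(** * Complex-valued sums and Stieltjes transforms *)

Lemma cReM {R : realType} (u v : R[i]) :
  complex.Re (u * v) = complex.Re u * complex.Re v - complex.Im u * complex.Im v.
Proof. by case: u => a b; case: v => c d. Qed.

Lemma cImM {R : realType} (u v : R[i]) :
  complex.Im (u * v) = complex.Re u * complex.Im v + complex.Im u * complex.Re v.
Proof. by case: u => a b; case: v => c d. Qed.

Lemma cReD {R : realType} (u v : R[i]) :
  complex.Re (u + v) = complex.Re u + complex.Re v.
Proof. by case: u => a b; case: v. Qed.

Lemma cImD {R : realType} (u v : R[i]) :
  complex.Im (u + v) = complex.Im u + complex.Im v.
Proof. by case: u => a b; case: v. Qed.

Lemma complex_eq {R : realType} (u v : R[i]) :
  complex.Re u = complex.Re v -> complex.Im u = complex.Im v -> u = v.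
Proof. by case: u => a b; case: v => c d /= -> ->. Qed.

Lemma ler_Re_normc {R : realType} (u : R[i]) : `|complex.Re u| <= Normc.normc u.
Proof. by case: u => a b /=; rewrite -sqrtr_sqr ler_wsqrtr// lerDl sqr_ge0. Qed.

Lemma normc_exp {R : realType} (u : R[i]) n :
  Normc.normc (u ^+ n) = Normc.normc u ^+ n.
Proof.
elim: n => [|n IH]; first by rewrite !expr0 Normc.normc1.
by rewrite !exprS Normc.normcM IH.
Qed.

Section ComplexSum.
Context {R : realType} (q : R) (q0 : 0 < q) (q1 : q < 1).
Variables (w x : nat -> R).
Hypotheses (w_gt0 : forall m, 0 < w m) (w_rapid : rapid q w) (x_tame : tame q x).
Local Notation toC := (real_complex R).
Implicit Types (F G : nat -> R[i]) (z : R[i]).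

(** Complex analogues of [tame] and [wsum], by real and imaginary parts. *)
Definition ctame F : Prop :=
  tame q (fun m => complex.Re (F m)) /\ tame q (fun m => complex.Im (F m)).

Definition cwsum F : R[i] :=
  Complex (wsum w (fun m => complex.Re (F m))) (wsum w (fun m => complex.Im (F m))).

Lemma cwsumE F G : F =1 G -> cwsum F = cwsum G.
Proof. by move=> /funext ->. Qed.

Lemma ctameD F G : ctame F -> ctame G -> ctame (fun m => F m + G m).
Proof.
move=> [F1 F2] [G1 G2]; split; under eq_fun do rewrite ?cReD ?cImD.
- exact: tameD.
- exact: tameD.
Qed.

Lemma ctameM F G : ctame F -> ctame G -> ctame (fun m => F m * G m).
Proof.
move=> [F1 F2] [G1 G2]; split; under eq_fun do rewrite ?cReM ?cImM.
- by apply: tameB => //; apply: tameM.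
- by apply: tameD => //; apply: tameM.
Qed.

Lemma ctame_cst z : ctame (fun=> z).
Proof. by split; exact: tame_cst. Qed.

Lemma ctame_real (f : nat -> R) : tame q f -> ctame (fun m => toC (f m)).
Proof. by move=> tf; split => //=; exact: tame_cst. Qed.

Lemma ctame_exp F k : ctame F -> ctame (fun m => F m ^+ k).
Proof.
move=> tF; elim: k => [|k IH]; first exact: ctame_cst.
by under eq_fun do rewrite exprS; exact: ctameM.
Qed.

Lemma ctame_sum (I : Type) (r : seq I) (F : I -> nat -> R[i]) :
  (forall i, ctame (F i)) -> ctame (fun m => \sum_(i <- r) F i m).
Proof.
move=> tF; elim: r => [|i r IH].
  by under eq_fun do rewrite big_nil; exact: ctame_cst.
by under eq_fun do rewrite big_cons; exact: ctameD.
Qed.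

Lemma cwsumD F G : ctame F -> ctame G ->
  cwsum (fun m => F m + G m) = cwsum F + cwsum G.
Proof.
move=> [F1 F2] [G1 G2]; apply: complex_eq; rewrite ?cReD ?cImD /= -(wsumD q0 q1 w_rapid)//;
  by apply: wsumE => m; rewrite ?cReD ?cImD.
Qed.

Lemma cwsumZ z F : ctame F -> cwsum (fun m => z * F m) = z * cwsum F.
Proof.
move=> [F1 F2]; apply: complex_eq.
  rewrite cReM /= -!(wsumZ q0 q1 w_rapid)// -(wsumB q0 q1 w_rapid); try exact: tameZ.
  by apply: wsumE => m; rewrite cReM.
rewrite cImM /= -!(wsumZ q0 q1 w_rapid)// -(wsumD q0 q1 w_rapid); try exact: tameZ.
by apply: wsumE => m; rewrite cImM.
Qed.

Lemma cwsumB F G : ctame F -> ctame G ->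
  cwsum (fun m => F m - G m) = cwsum F - cwsum G.
Proof.
move=> tF tG; rewrite -[in RHS]mulN1r -cwsumZ// -cwsumD//; last first.
  by apply: ctameM => //; exact: ctame_cst.
by apply: cwsumE => m; rewrite mulN1r.
Qed.

Lemma cwsum_sum n (F : 'I_n -> nat -> R[i]) : (forall i, ctame (F i)) ->
  cwsum (fun m => \sum_(i < n) F i m) = \sum_(i < n) cwsum (F i).
Proof.
elim: n F => [|n IH] F tF.
  rewrite big_ord0 -[RHS](mul0r (cwsum (fun=> 0))) -cwsumZ; last exact: ctame_cst.
  by apply: cwsumE => m; rewrite big_ord0 mul0r.
rewrite big_ord_recr /= -(IH (fun i => F (widen_ord (leqnSn n) i)))// -cwsumD//; last first.
  exact: ctame_sum.
by apply: cwsumE => m; rewrite big_ord_recr.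
Qed.

Lemma cwsum_real (f : nat -> R) : cwsum (fun m => toC (f m)) = toC (wsum w f).
Proof.
apply: complex_eq => //=; rewrite /wsum -[RHS](@ssum0 R); apply: ssumE => m.
by rewrite mulr0.
Qed.

Lemma ceval_tame (p : {poly R[i]}) : ctame (fun m => p.[toC (x m)]).
Proof.
under eq_fun do rewrite horner_coef.
apply: ctame_sum => i; apply: ctameM; first exact: ctame_cst.
by apply: ctame_exp; exact: ctame_real.
Qed.

Lemma ceval_toC (p : {poly R}) (y : R) : ceval p (toC y) = toC p.[y].
Proof. by rewrite /ceval horner_map. Qed.

(** A point [z] off the support, strictly closer to [x 0] than to the other
    points. *)
Variable z : R[i].
Let rz m := (toC (x m) - z)^-1.
Hypothesis rz_tame : ctame rz.
Hypothesis z_neq : forall m, toC (x m) - z != 0.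
Variable theta : R.
Hypotheses (theta0 : 0 <= theta) (theta1 : theta < 1).
Hypothesis z_far : forall m,
  Normc.normc ((toC (x 0%N) - z) / (toC (x m.+1) - z)) <= theta.

Variable h : nat -> R.
Hypotheses (h0 : h 0%N != 0) (hw_tame : tame q (fun m => h m / w m)).
Hypothesis h_poly : forall p : {poly R}, ssum (fun m => h m * p.[x m]) = 0.

Let f m := h m / w m.

Let wf m : w m * f m = h m.
Proof. by rewrite mulrC divfK ?gt_eqF. Qed.

Let h_rapid : rapid q h.
Proof.
have := rapidMtame q0 w_rapid hw_tame.
by congr rapid; apply/funext => m; rewrite -/(f m) wf.
Qed.

Let gk k m := toC (f m) * rz m ^+ k.

Let gk_tame k : ctame (gk k).
Proof. by apply: ctameM; [exact: ctame_real|exact: ctame_exp]. Qed.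

(** Otherwise the sums of [h_m ((x_0 - z) / (x_m - z))^k] would vanish for all
    [k >= 1], whereas they tend to [h_0]. *)
Let gk_nonzero : exists k, cwsum (gk k.+1) != 0.
Proof.
apply: contrapT => /forallNP Hk.
have Gk k : cwsum (gk k.+1) = 0 by apply/eqP; have /negP := Hk k; rewrite negbK.
pose rho m := (toC (x 0%N) - z) * rz m.
have rho_tame : ctame rho by apply: ctameM => //; exact: ctame_cst.
have E k : ssum (fun m => h m * complex.Re (rho m ^+ k.+1)) = 0.
  have : complex.Re ((toC (x 0%N) - z) ^+ k.+1 * cwsum (gk k.+1)) = 0.
    by rewrite Gk mulr0.
  rewrite -cwsumZ// /= /wsum => <-; apply: ssumE => m.
  rewrite -wf -mulrA; congr (_ * _).
  rewrite /gk mulrCA /rho -exprMn cReM /= mul0r subr0; ring.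
pose K := ssum (fun m => `|h m.+1|).
have hr := rapid_shift q0 q1 h_rapid.
have bd k : `|h 0%N| <= theta ^+ k.+1 * K.
  have rr : rapid q (fun m => h m * complex.Re (rho m ^+ k.+1)).
    by apply: (rapidMtame q0) => //; case: (ctame_exp k.+1 rho_tame).
  have := E k; rewrite (ssum_recl q0 q1)//.
  have -> : rho 0%N = 1 by rewrite /rho /rz mulfV.
  rewrite expr1n /= mulr1 => /eqP; rewrite addr_eq0 => /eqP ->; rewrite normrN.
  apply: le_trans (ler_norm_ssum q0 q1 (rapid_shift q0 q1 rr)) _.
  rewrite /K -(ssumZ q0 q1); last exact: rapid_norm.
  apply: (ler_ssum q0 q1).
  - exact/rapid_norm/(rapid_shift q0 q1 rr).
  - exact/rapidZ/rapid_norm.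
  - move=> m; rewrite normrM mulrC ler_wpM2r//.
    apply: le_trans (ler_Re_normc _) _; rewrite normc_exp.
    by rewrite ler_pXn2r ?nnegrE//; [exact: z_far|
      exact: le_trans (normr_ge0 _) (ler_Re_normc _)].
have tc : (fun k => theta ^+ k.+1 * K) @ \oo --> 0 * K.
  apply: cvgM; last exact: cvg_cst.
  by rewrite (cvg_shiftS (fun k => theta ^+ k)); apply: cvg_expr; rewrite ger0_norm.
have : `|h 0%N| <= 0.
  rewrite -[leRHS](mul0r K) -(cvg_lim _ tc)//; apply: limr_ge; first exact: cvgP tc.
  exact: nearW.
by rewrite normr_le0 (negPf h0).
Qed.

(** A tame sequence that, against the weights, annihilates the polynomials but
    not [1 / (x - z)].  It is [h / w] divided by the least power of [x - z]
    that works: for a smaller power, dividing once more by [x - z] still gives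
    an annihilator. *)
Lemma annihilator_at : exists g : nat -> R[i], [/\ ctame g,
  forall p : {poly R[i]}, cwsum (fun m => g m * p.[toC (x m)]) = 0 &
  cwsum (fun m => g m * rz m) != 0].
Proof.
case: (ex_minnP gk_nonzero) => k Gk kmin; exists (gk k); split => //; last first.
  by rewrite (_ : (fun m => _) = gk k.+1)//; apply/funext => m; rewrite /gk exprSr mulrA.
have : forall j, (j <= k)%N -> forall p : {poly R[i]},
    cwsum (fun m => gk j m * p.[toC (x m)]) = 0; last exact.
elim => [_ p|j IH jk p].
  transitivity (cwsum (fun m => \sum_(i < size p) p`_i * toC (f m * x m ^+ i))).
    apply: cwsumE => m; rewrite /gk expr0 mulr1 horner_coef mulr_sumr.
    apply: eq_bigr => i _; rewrite mulrCA; congr (_ * _).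
    by rewrite [RHS](rmorphM toC) (rmorphXn toC).
  have tfx i : tame q (fun m => f m * x m ^+ i) by apply: tameM => //; exact: tame_exp.
  rewrite cwsum_sum => [|i]; last first.
    by apply: ctameM; [exact: ctame_cst|exact: ctame_real].
  apply: big1 => i _; rewrite cwsumZ; last exact: ctame_real.
  rewrite cwsum_real (_ : wsum w _ = 0) ?mulr0//.
  rewrite -[RHS](h_poly 'X^i); apply: ssumE => m.
  by rewrite mulrA wf hornerXn.
have /factor_theorem[p1 p1E] : root (p - p.[z]%:P) z.
  by rewrite /root hornerD hornerN hornerC subrr.
transitivity (cwsum (fun m => p.[z] * gk j.+1 m + gk j m * p1.[toC (x m)])).
  apply: cwsumE => m.
  have -> : p.[toC (x m)] = p1.[toC (x m)] * (toC (x m) - z) + p.[z].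
    by rewrite -{1}(subrK p.[z]%:P p) p1E hornerD hornerM hornerXsubC hornerC.
  rewrite /gk exprSr /rz; move: (z_neq m); move: (toC (x m) - z) => d d0.
  by field.
have tp1 : ctame (fun m => gk j m * p1.[toC (x m)]) by apply: ctameM => //; exact: ceval_tame.
rewrite cwsumD//; last by apply: ctameM => //; exact: ctame_cst.
rewrite IH ?(ltnW jk)// addr0 cwsumZ//.
have -> : cwsum (gk j.+1) = 0; last by rewrite mulr0.
by apply/eqP; apply: contraTT jk => Gj; rewrite -leqNgt; exact: kmin.
Qed.

(** The squared modulus, in the reals. *)
Definition sqn (u : R[i]) : R := complex.Re u ^+ 2 + complex.Im u ^+ 2.

Lemma sqn_ge0 u : 0 <= sqn u.
Proof. by rewrite addr_ge0 ?sqr_ge0. Qed.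

(** Square-summable complex sequences. *)
Definition cl2 (u : nat -> R[i]) : Prop :=
  exists K, forall n, \sum_(j < n) sqn (u j) <= K.

Lemma cl2D u v : cl2 u -> cl2 v -> cl2 (fun n => u n + v n).
Proof.
move=> [K HK] [L HL]; exists (2 * K + 2 * L) => n.
apply: le_trans (lerD (ler_wpM2l _ (HK n)) (ler_wpM2l _ (HL n))) => //.
rewrite !mulr_sumr -big_split /=; apply: ler_sum => j _.
rewrite /sqn cReD cImD; move: (u j) (v j) => [a b] [c d] /=.
have := sqr_ge0 (a - c); have := sqr_ge0 (b - d); nra.
Qed.

Lemma cl2Z c u : cl2 u -> cl2 (fun n => c * u n).
Proof.
move=> [K HK]; exists (sqn c * K) => n.
apply: le_trans (ler_wpM2l (sqn_ge0 c) (HK n)).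
rewrite mulr_sumr; apply: ler_sum => j _.
rewrite /sqn cReM cImM; move: c (u j) => [a b] [d e] /=.
by rewrite le_eqVlt; apply/orP; left; apply/eqP; ring.
Qed.

Variable p : nat -> {poly R}.
Hypothesis p_orth : forall n k, wsum w (fun m => (p n).[x m] * (p k).[x m]) = (n == k)%:R.

Let p_tame n : tame q (fun m => (p n).[x m]).
Proof. exact: tame_horner. Qed.

Let coefE F n : cwsum (fun m => F m * toC (p n).[x m]) =
  Complex (wsum w (fun m => complex.Re (F m) * (p n).[x m]))
          (wsum w (fun m => complex.Im (F m) * (p n).[x m])).
Proof.
apply: complex_eq => /=; apply: wsumE => m; rewrite ?cReM ?cImM /=.
  by rewrite mulr0 subr0.
by rewrite mulr0 add0r.
Qed.

Lemma cl2_coef F : ctame F -> cl2 (fun n => cwsum (fun m => F m * toC (p n).[x m])).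
Proof.
move=> [tF1 tF2].
exists (wsum w (fun m => complex.Re (F m) * complex.Re (F m)) +
        wsum w (fun m => complex.Im (F m) * complex.Im (F m))) => n.
under eq_bigr do rewrite coefE /sqn /=.
rewrite big_split /= lerD//.
- exact: (bessel q0 q1 w_gt0 w_rapid p_tame p_orth).
- exact: (bessel q0 q1 w_gt0 w_rapid p_tame p_orth).
Qed.

(** The functions of the second kind, which are the Fourier coefficients of
    [1 / (x - z)]. *)
Definition second_fun n : R[i] := cwsum (fun m => rz m * toC (p n).[x m]).

Lemma second_fun_l2 : cl2 second_fun.
Proof. exact: cl2_coef. Qed.

(** If [g] annihilates the polynomials, the sum of [w g p_n / (x - z)] is
    [p_n(z)] times the sum of [w g / (x - z)]; these sums are Fourier
    coefficients. *)
Lemma ceval_l2 : cl2 (fun n => ceval (p n) z).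
Proof.
have [g [tg gp Gz]] := annihilator_at; set G := cwsum _ in Gz.
have E n : ceval (p n) z = G^-1 * cwsum (fun m => g m * rz m * toC (p n).[x m]).
  rewrite (_ : cwsum _ = ceval (p n) z * G); first by rewrite mulrC mulfK.
  set pc := map_poly (real_complex R) (p n).
  have /factor_theorem[p1 p1E] : root (pc - pc.[z]%:P) z.
    by rewrite /root hornerD hornerN hornerC subrr.
  transitivity (cwsum (fun m => pc.[z] * (g m * rz m) + g m * p1.[toC (x m)])).
    apply: cwsumE => m.
    have -> : toC (p n).[x m] = p1.[toC (x m)] * (toC (x m) - z) + pc.[z].
      rewrite -ceval_toC /ceval -/pc -{1}(subrK pc.[z]%:P pc) p1E.
      by rewrite hornerD hornerM hornerXsubC hornerC.
    rewrite /rz; move: (z_neq m); move: (toC (x m) - z) => d d0.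
    by field.
  have t1 : ctame (fun m => g m * rz m) by exact: ctameM.
  have t2 : ctame (fun m => g m * p1.[toC (x m)]) by apply: ctameM => //; exact: ceval_tame.
  rewrite cwsumD//; last by apply: ctameM => //; exact: ctame_cst.
  by rewrite gp addr0 cwsumZ.
have : cl2 (fun n => G^-1 * cwsum (fun m => g m * rz m * toC (p n).[x m])).
  by apply/cl2Z/cl2_coef; exact: ctameM.
by congr cl2; apply/funext => n; rewrite E.
Qed.

Lemma second_fun_strict : exists2 eta, 0 < eta & forall n,
  \sum_(j < n) sqn (second_fun j) <= wsum w (fun m => sqn (rz m)) - eta.
Proof.
have [g [tg gp Gz]] := annihilator_at; case: (tg) => tg1 tg2.
case: (rz_tame) => tr1 tr2.
have gpR n : wsum w (fun m => complex.Re (g m) * (p n).[x m]) = 0 /\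
    wsum w (fun m => complex.Im (g m) * (p n).[x m]) = 0.
  have := gp (map_poly (real_complex R) (p n)).
  under cwsumE do rewrite horner_map /=.
  by rewrite coefE => /eqP; rewrite eq_complex /= => /andP[/eqP -> /eqP ->].
have sE : wsum w (fun m => sqn (rz m)) =
    wsum w (fun m => complex.Re (rz m) * complex.Re (rz m)) +
    wsum w (fun m => complex.Im (rz m) * complex.Im (rz m)).
  rewrite -(wsumD q0 q1 w_rapid); try exact: tameM.
  by apply: wsumE => m; rewrite /sqn !expr2.
have sumE n : \sum_(j < n) sqn (second_fun j) =
    \sum_(j < n) wsum w (fun m => complex.Re (rz m) * (p j).[x m]) ^+ 2 +
    \sum_(j < n) wsum w (fun m => complex.Im (rz m) * (p j).[x m]) ^+ 2.
  by rewrite -big_split; apply: eq_bigr => j _; rewrite /second_fun coefE.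
have bes := bessel q0 q1 w_gt0 w_rapid p_tame p_orth.
have bst := bessel_strict q0 q1 w_gt0 w_rapid p_tame p_orth.
(* one of the real and imaginary parts of 1/(x - z) is not orthogonal to one
   of the real and imaginary parts of g *)
have [[g' tg' [gp' gr]]|[g' tg' [gp' gr]]] :
  (exists2 g', tame q g' & (forall n, wsum w (fun m => g' m * (p n).[x m]) = 0) /\
    wsum w (fun m => complex.Re (rz m) * g' m) != 0) \/
  (exists2 g', tame q g' & (forall n, wsum w (fun m => g' m * (p n).[x m]) = 0) /\
    wsum w (fun m => complex.Im (rz m) * g' m) != 0).
- have gp1 n := (gpR n).1; have gp2 n := (gpR n).2.
  have [z11|] := eqVneq (wsum w (fun m => complex.Re (rz m) * complex.Re (g m))) 0;
    last by move=> ?; left; exists (fun m => complex.Re (g m)).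
  have [z12|] := eqVneq (wsum w (fun m => complex.Re (rz m) * complex.Im (g m))) 0;
    last by move=> ?; left; exists (fun m => complex.Im (g m)).
  have [z21|] := eqVneq (wsum w (fun m => complex.Im (rz m) * complex.Re (g m))) 0;
    last by move=> ?; right; exists (fun m => complex.Re (g m)).
  have [z22|] := eqVneq (wsum w (fun m => complex.Im (rz m) * complex.Im (g m))) 0;
    last by move=> ?; right; exists (fun m => complex.Im (g m)).
  exfalso; move/eqP: Gz; apply; apply: complex_eq => /=.
    transitivity (wsum w (fun m => complex.Re (rz m) * complex.Re (g m)) -
      wsum w (fun m => complex.Im (rz m) * complex.Im (g m))); last by rewrite z11 z22 subrr.
    rewrite -(wsumB q0 q1 w_rapid); try exact: tameM.
    by apply: wsumE => m; rewrite cReM mulrC (mulrC (complex.Im (g m))).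
  transitivity (wsum w (fun m => complex.Re (rz m) * complex.Im (g m)) +
    wsum w (fun m => complex.Im (rz m) * complex.Re (g m))); last by rewrite z12 z21 addr0.
  rewrite -(wsumD q0 q1 w_rapid); try exact: tameM.
  by apply: wsumE => m; rewrite cImM addrC; congr (_ + _); rewrite mulrC.
- have [eta eta0 Heta] := bst _ _ tr1 tg' gp' gr.
  by exists eta => // n; rewrite sumE sE addrAC lerD//; exact: bes.
- have [eta eta0 Heta] := bst _ _ tr2 tg' gp' gr.
  by exists eta => // n; rewrite sumE sE -addrA lerD//; exact: bes.
Qed.

End ComplexSum.

(** * Wronskians and the Nevanlinna functions *)

Section ComplexLimits.
Context {R : realType}.
Implicit Types (u v : nat -> R[i]) (l k : R[i]).

(** Convergence in the complex plane, by real and imaginary parts. *)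
Definition ccvg u l : Prop :=
  (fun n => complex.Re (u n)) @ \oo --> complex.Re l /\
  (fun n => complex.Im (u n)) @ \oo --> complex.Im l.

Lemma ccvg_cst l : ccvg (fun=> l) l.
Proof. by split; exact: cvg_cst. Qed.

Lemma ccvgD u v l k : ccvg u l -> ccvg v k -> ccvg (fun n => u n + v n) (l + k).
Proof.
move=> [u1 u2] [v1 v2]; split; rewrite ?cReD ?cImD.
- by under eq_fun do rewrite cReD; exact: cvgD.
- by under eq_fun do rewrite cImD; exact: cvgD.
Qed.

Lemma ccvgM u v l k : ccvg u l -> ccvg v k -> ccvg (fun n => u n * v n) (l * k).
Proof.
move=> [u1 u2] [v1 v2]; split; rewrite ?cReM ?cImM.
- by under eq_fun do rewrite cReM; apply: cvgB; exact: cvgM.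
- by under eq_fun do rewrite cImM; apply: cvgD; exact: cvgM.
Qed.

Lemma ccvgZ c u l : ccvg u l -> ccvg (fun n => c * u n) (c * l).
Proof. by apply: ccvgM; exact: ccvg_cst. Qed.

Lemma ccvgB u v l k : ccvg u l -> ccvg v k -> ccvg (fun n => u n - v n) (l - k).
Proof.
move=> cu cv; rewrite -[- k]mulN1r (_ : (fun n => _) = (fun n => u n + (-1) * v n)).
  by apply: ccvgD => //; exact: ccvgZ.
by apply/funext => n; rewrite mulN1r.
Qed.

Lemma ccvg_conj u l : ccvg u l -> ccvg (fun n => conjc (u n)) (conjc l).
Proof.
have cE (y : R[i]) : conjc y = Complex (complex.Re y) (- complex.Im y) by case: y.
move=> [u1 u2]; split; rewrite cE /=.
- by under eq_fun do rewrite cE.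
- by under eq_fun do rewrite cE /=; exact: cvgN.
Qed.

Lemma ccvg_unique u l k : ccvg u l -> ccvg u k -> l = k.
Proof.
by move=> [u1 u2] [v1 v2]; apply: complex_eq; [exact: cvg_unique u1 v1|exact: cvg_unique u2 v2].
Qed.

Lemma ccvg_shift u l : ccvg u l -> ccvg (fun n => u n.+1) l.
Proof. by move=> [u1 u2]; split; [rewrite (cvg_shiftS (fun n => complex.Re (u n)))
  |rewrite (cvg_shiftS (fun n => complex.Im (u n)))]. Qed.

Lemma cl2_cvg u : cl2 u -> cvgn (series (fun n => sqn (u n))).
Proof.
move=> [K HK]; apply: (@nondecreasing_is_cvgn _ (series (fun n => sqn (u n)))).
  by apply/nondecreasing_seqP => n; rewrite /series /= big_nat_recr//= lerDl sqn_ge0.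
by exists K => _ [n _ <-]; rewrite /series /= big_mkord.
Qed.

Lemma ReIm_sum u n : complex.Re (\sum_(j < n) u j) = series (fun j => complex.Re (u j)) n /\
  complex.Im (\sum_(j < n) u j) = series (fun j => complex.Im (u j)) n.
Proof.
rewrite /series /= !big_mkord; elim: n => [|n [IH1 IH2]]; first by rewrite !big_ord0.
by rewrite !big_ord_recr /= cReD cImD IH1 IH2.
Qed.

(** A product of square-summable sequences is summable. *)
Lemma cseries_ccvg u v : cl2 u -> cl2 v ->
  ccvg (fun n => \sum_(j < n) u j * v j) (cseries (fun n => u n * v n)).
Proof.
move=> /cl2_cvg cu /cl2_cvg cv.
have cuv : cvgn (series (fun n => sqn (u n) + sqn (v n))).
  exact: (is_cvg_seriesD cu cv).
have bd (r : nat -> R) : (forall n, `|r n| <= sqn (u n) + sqn (v n)) -> cvgn (series r).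
  move=> H; apply: normed_cvg.
  apply: (series_le_cvg _ _ H cuv) => n; first exact: normr_ge0.
  by rewrite addr_ge0 ?sqn_ge0.
have sq (a b c d : R) : `|a * c - b * d| <= a ^+ 2 + b ^+ 2 + (c ^+ 2 + d ^+ 2).
  have := sqr_ge0 (a - c); have := sqr_ge0 (a + c); have := sqr_ge0 (b - d).
  have := sqr_ge0 (b + d); rewrite ler_norml => *; apply/andP; split; nra.
split.
  rewrite (_ : (fun n => _) = series (fun n => complex.Re (u n * v n))).
    by apply: bd => n; rewrite cReM /sqn.
  by apply/funext => n; case: (ReIm_sum (fun n => u n * v n) n).
rewrite (_ : (fun n => _) = series (fun n => complex.Im (u n * v n))).
  apply: bd => n; rewrite cImM /sqn; move: (u n) (v n) => [a b] [c d] /=.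
  by have := sq a (- b) d c; rewrite mulNr opprK sqrrN [d ^+ 2 + _]addrC.
by apply/funext => n; case: (ReIm_sum (fun n => u n * v n) n).
Qed.

End ComplexLimits.

Section Green.
Context {F : comPzRingType} (a b : nat -> F).

(** Solutions of the three-term recurrence, with a source term at [0]. *)
Definition recurrence (z rho : F) (u : nat -> F) : Prop :=
  z * u 0%N = b 0%N * u 1%N + a 0%N * u 0%N - rho /\
  forall n, z * u n.+1 = b n.+1 * u n.+2 + a n.+1 * u n.+1 + b n * u n.

(** Discrete Wronskian, normalized by the recurrence coefficient. *)
Definition wronskian (u v : nat -> F) n : F := b n * (u n.+1 * v n - u n * v n.+1).

Lemma green z z' rho rho' u v n : recurrence z rho u -> recurrence z' rho' v ->
  (z - z') * (\sum_(j < n.+1) u j * v j) =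
  wronskian u v n - rho * v 0%N + rho' * u 0%N.
Proof.
move=> [u0 uS] [v0 vS].
have step i : (z - z') * (u i * v i) = (z * u i) * v i - u i * (z' * v i) by ring.
elim: n => [|n IH].
  by rewrite big_ord_recr big_ord0 /= add0r step u0 v0 /wronskian; ring.
by rewrite big_ord_recr /= mulrDr IH step uS vS /wronskian; ring.
Qed.

(** The Plücker relation between the six Wronskians of four sequences. *)
Lemma wronskian_plucker (u1 u2 u3 u4 : nat -> F) n :
  wronskian u1 u2 n * wronskian u3 u4 n =
  wronskian u1 u3 n * wronskian u2 u4 n - wronskian u1 u4 n * wronskian u2 u3 n.
Proof. by rewrite /wronskian; ring. Qed.

End Green.

Lemma recurrence_conj {R : realType} (a b : nat -> R) (z : R[i]) u :
  recurrence (fun n => real_complex R (a n)) (fun n => real_complex R (b n)) z 1 u ->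
  recurrence (fun n => real_complex R (a n)) (fun n => real_complex R (b n))
    (conjc z) 1 (fun n => conjc (u n)).
Proof.
have cjM (c d : R[i]) : conjc (c * d) = conjc c * conjc d by exact: rmorphM.
have cjD (c d : R[i]) : conjc (c + d) = conjc c + conjc d by exact: rmorphD.
have cjB (c d : R[i]) : conjc (c - d) = conjc c - conjc d by exact: rmorphB.
have cjC (y : R) : conjc (real_complex R y) = real_complex R y.
  by rewrite /conjc /= oppr0.
move=> [h0 hS]; split=> [|n].
  by have := congr1 conjc h0; rewrite cjM cjB cjD !cjM conjc1 !cjC.
by have := congr1 conjc (hS n); rewrite cjM !cjD !cjM !cjC.
Qed.

Section Quotient.
Context {R : realType}.
Local Notation toC := (real_complex R).

(** Coefficient [j] of the difference quotient of [p], as a polynomial in the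
    second variable. *)
Definition quot_coef (p : {poly R}) (j : nat) : {poly R} :=
  \sum_(i < size p) p`_i *: \sum_(k < i) (k == j :> nat)%:R *: 'X^(i.-1 - k).

Lemma diff_quotE (p : {poly R}) (y : R) :
  (p - p.[y]%:P) %/ ('X - y%:P) =
  \sum_(i < size p) p`_i *: \sum_(k < i) (y ^+ (i.-1 - k)) *: 'X^k.
Proof.
set S := \sum_(i < _) _.
suff -> : p - p.[y]%:P = S * ('X - y%:P) by rewrite mulpK ?polyXsubC_eq0.
have -> : p - p.[y]%:P = \sum_(i < size p) p`_i *: ('X^i - y%:P ^+ i).
  rewrite -{1}(coefK p) poly_def horner_coef rmorph_sum -sumrB.
  apply: eq_bigr => i _; rewrite scalerBr; congr (_ - _).
  by rewrite /= polyCM mul_polyC rmorphXn.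
rewrite /S mulr_suml; apply: eq_bigr => i _; rewrite -scalerAl; congr (_ *: _).
rewrite -opprB subrXX -mulNr opprB mulrC; congr (_ * _).
by apply: eq_bigr => k _; rewrite -mul_polyC rmorphXn.
Qed.

Lemma diff_quot_coef (p : {poly R}) (y : R) j :
  ((p - p.[y]%:P) %/ ('X - y%:P))`_j = (quot_coef p j).[y].
Proof.
rewrite diff_quotE coef_sum horner_sum; apply: eq_bigr => i _.
rewrite coefZ hornerZ; congr (_ * _); rewrite coef_sum horner_sum.
by apply: eq_bigr => k _; rewrite coefZ hornerZ !hornerXn coefXn mulrC eq_sym.
Qed.

Lemma ceval_diff_quot (p : {poly R}) (y : R) (z : R[i]) : toC y - z != 0 ->
  ceval ((p - p.[y]%:P) %/ ('X - y%:P)) z = (toC p.[y] - ceval p z) / (toC y - z).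
Proof.
move=> yz; apply: (mulIf yz); rewrite divfK//.
have /eqP pE : ('X - y%:P) %| (p - p.[y]%:P).
  by rewrite dvdp_XsubCl /root hornerD hornerN hornerC subrr.
have : ceval (p - p.[y]%:P) z =
    ceval ((p - p.[y]%:P) %/ ('X - y%:P)) z * (z - toC y).
  have dv : ('X - y%:P) %| (p - p.[y]%:P).
    by rewrite dvdp_XsubCl /root hornerD hornerN hornerC subrr.
  rewrite -{1}(divpK dv) /ceval rmorphM hornerM; congr (_ * _).
  by rewrite rmorphB /= map_polyX map_polyC hornerXsubC.
have -> : ceval (p - p.[y]%:P) z = ceval p z - toC p.[y].
  by rewrite /ceval rmorphB /= map_polyC hornerD hornerN hornerC.
by move=> E; rewrite -[RHS]opprB E; ring.
Qed.

Lemma size_diff_quot (p : {poly R}) (y : R) :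
  (size ((p - p.[y]%:P) %/ ('X - y%:P))%R <= size p)%N.
Proof.
rewrite diff_quotE; apply: leq_trans (size_sum _ _ _) _; apply/bigmax_leqP => i _.
apply: leq_trans (size_scale_leq _ _) _; apply: leq_trans (size_sum _ _ _) _.
apply/bigmax_leqP => k _; apply: leq_trans (size_scale_leq _ _) _.
by rewrite size_polyXn (leq_trans (ltn_ord k))// ltnW.
Qed.

End Quotient.

Section Nevanlinna.
Context {R : realType} (q : R) (q0 : 0 < q) (q1 : q < 1).
Variables (w x : nat -> R).
Hypotheses (w_gt0 : forall m, 0 < w m) (w_rapid : rapid q w) (x_tame : tame q x).
Local Notation toC := (real_complex R).

Variables (mu : probability (measurableTypeR R) R) (P : nat -> {poly R}).
Hypothesis mu_poly : forall s : {poly R},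
  Rintegral mu setT (fun y : R => s.[y]) = wsum w (fun m => s.[x m]).
Let p := orthonormalized mu P.
Hypothesis p_size : forall n, size (p n) = n.+1.
Hypothesis p_orth : forall n k, wsum w (fun m => (p n).[x m] * (p k).[x m]) = (n == k)%:R.
Hypothesis p0 : p 0%N = 1.

Let rz z m := (toC (x m) - z)^-1.
Let Q z n := second_fun w x z p n.
Let W z := cwsum w (rz z).

Let p_tame n : tame q (fun m => (p n).[x m]).
Proof. exact: tame_horner. Qed.

Section Point.
Variable z : R[i].
Hypothesis z_tame : ctame q (rz z).
Hypothesis z_neq : forall m, toC (x m) - z != 0.

(** The polynomials of the second kind, in terms of the functions of the second
    kind and of the Stieltjes transform. *)
Lemma second_kindE n : ceval (second_kind mu (p n)) z = Q z n - ceval (p n) z * W z.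
Proof.
pose pn := p n; rewrite -/pn.
transitivity (cwsum w (fun m => \sum_(j < size pn) z ^+ j *
    toC (quot_coef pn j).[x m])).
  rewrite (cwsum_sum q0 q1 w_rapid) => [|j]; last first.
    by apply: ctameM => //; [exact: ctame_cst|apply: ctame_real; exact: tame_horner].
  rewrite /ceval (@horner_coef_wide _ (size pn)); last first.
    by rewrite size_map_poly size_poly.
  apply: eq_bigr => j _; rewrite coef_map coef_poly ltn_ord mulrC.
  rewrite (cwsumZ q0 q1 w_rapid); last exact/ctame_real/tame_horner.
  rewrite cwsum_real; congr (_ * toC _).
  rewrite -mu_poly; congr (Rintegral _ _ _); apply/funext => y.
  by rewrite diff_quot_coef.
transitivity (cwsum w (fun m => rz z m * toC pn.[x m] - ceval pn z * rz z m)).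
  apply: cwsumE => m; transitivity (ceval ((pn - pn.[x m]%:P) %/ ('X - (x m)%:P)) z).
    rewrite /ceval (@horner_coef_wide _ (size pn)); last first.
      by rewrite size_map_poly size_diff_quot.
    by apply: eq_bigr => j _; rewrite coef_map diff_quot_coef mulrC.
  by rewrite ceval_diff_quot// mulrBl mulrC.
rewrite (cwsumB q0 q1 w_rapid).
- by rewrite (cwsumZ q0 q1 w_rapid).
- by apply: ctameM => //; exact/ctame_real/p_tame.
- by apply: ctameM => //; exact: ctame_cst.
Qed.

Let ja n := toC (jacobi_a w x p n).
Let jb n := toC (jacobi_b w x p n).

Let cevalM (s t : {poly R}) : ceval (s * t) z = ceval s z * ceval t z.
Proof. by rewrite /ceval rmorphM hornerM. Qed.
Let cevalD (s t : {poly R}) : ceval (s + t) z = ceval s z + ceval t z.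
Proof. by rewrite /ceval rmorphD hornerD. Qed.
Let cevalZ c (s : {poly R}) : ceval (c *: s) z = toC c * ceval s z.
Proof. by rewrite /ceval map_polyZ hornerZ. Qed.
Let cevalX : ceval ('X : {poly R}) z = z.
Proof. by rewrite /ceval map_polyX hornerX. Qed.

Lemma ceval_recurrence : recurrence ja jb z 0 (fun n => ceval (p n) z).
Proof.
split=> [|n].
  rewrite subr0 -{1}cevalX -cevalM (recurrence0 q0 q1 w_rapid x_tame p_size p_orth).
  by rewrite cevalD !cevalZ.
rewrite -{1}cevalX -cevalM (recurrenceS q0 q1 w_rapid x_tame p_size p_orth).
by rewrite !cevalD !cevalZ.
Qed.

Let Qsum (s : {poly R}) := cwsum w (fun m => rz z m * toC s.[x m]).

Let rzM_tame (s : {poly R}) : ctame q (fun m => rz z m * toC s.[x m]).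
Proof. by apply: ctameM => //; apply/ctame_real/tame_horner. Qed.

Let QsumD s t : Qsum (s + t) = Qsum s + Qsum t.
Proof.
rewrite /Qsum -(cwsumD q0 q1 w_rapid)//; apply: cwsumE => m.
by rewrite hornerD rmorphD mulrDr.
Qed.

Let QsumZ c s : Qsum (c *: s) = toC c * Qsum s.
Proof.
rewrite /Qsum -(cwsumZ q0 q1 w_rapid)//; apply: cwsumE => m.
by rewrite hornerZ rmorphM mulrCA.
Qed.

Let QsumX n : z * Qsum (p n) = Qsum ('X * p n) - (n == 0%N)%:R.
Proof.
have E : toC (wsum w (fun m => (p n).[x m])) = (n == 0%N)%:R.
  rewrite -(rmorph_nat toC) -(p_orth n 0); congr toC; apply: wsumE => m.
  by rewrite p0 hornerC mulr1.
rewrite -E -cwsum_real -(cwsumZ q0 q1 w_rapid)// -(cwsumB q0 q1 w_rapid)//; last first.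
  exact: ctame_real.
apply: cwsumE => m; rewrite hornerM hornerX /rz.
have -> : toC (x m * (p n).[x m]) = toC (x m) * toC (p n).[x m] by exact: rmorphM.
by move: (z_neq m); move: (toC (x m)) (toC (p n).[x m]) => X Y d0; field.
Qed.

Lemma second_recurrence : recurrence ja jb z 1 (Q z).
Proof.
split=> [|n].
  rewrite -[Q z 0]/(Qsum (p 0%N)) QsumX (recurrence0 q0 q1 w_rapid x_tame p_size p_orth).
  by rewrite QsumD (QsumZ _ (p 1%N)) (QsumZ _ (p 0%N)).
rewrite -[Q z n.+1]/(Qsum (p n.+1)) QsumX subr0.
rewrite (recurrenceS q0 q1 w_rapid x_tame p_size p_orth) !QsumD.
by rewrite (QsumZ _ (p n.+2)) (QsumZ _ (p n.+1)) (QsumZ _ (p n)).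
Qed.

End Point.

Variable z : R[i].
Hypotheses (zt : ctame q (rz z)) (z_neq : forall m, toC (x m) - z != 0).
Hypotheses (ot : ctame q (rz 0)) (o_neq : forall m, toC (x m) - 0 != 0).
Hypothesis z_im : complex.Im z != 0.
Hypotheses (pz_l2 : cl2 (fun n => ceval (p n) z)) (po_l2 : cl2 (fun n => ceval (p n) 0)).
Hypotheses (Qz_l2 : cl2 (Q z)) (Qo_l2 : cl2 (Q 0)).
Hypothesis z_strict : exists2 eta, 0 < eta & forall n,
  \sum_(j < n) sqn (Q z j) <= wsum w (fun m => sqn (rz z m)) - eta.
Hypothesis mu_stieltjes : stieltjes mu z = W z.

Let r y n := ceval (second_kind mu (p n)) y.
Let u := Q z.
Let o := Q 0.
Let pz n := ceval (p n) z.
Let po n := ceval (p n) 0.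
Let ub n := conjc (u n).

Let rE n : r z n = u n - pz n * W z. Proof. exact: second_kindE. Qed.
Let roE n : r 0 n = o n - po n * W 0. Proof. exact: second_kindE. Qed.

Let rz_l2 : cl2 (r z).
Proof.
have : cl2 (fun n => u n + (- W z) * pz n) by apply: cl2D => //; exact: cl2Z.
by congr cl2; apply/funext => n; rewrite rE mulrC mulrN -mulrN.
Qed.

Let ro_l2 : cl2 (r 0).
Proof.
have : cl2 (fun n => o n + (- W 0) * po n) by apply: cl2D => //; exact: cl2Z.
by congr cl2; apply/funext => n; rewrite roE mulrC mulrN -mulrN.
Qed.

Let nA := nevanlinnaA mu P z.
Let nB := nevanlinnaB mu P z.
Let nC := nevanlinnaC mu P z.
Let nD := nevanlinnaD mu P z.

(** The Stieltjes transform is the one of the constant parameter [t] when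
    [t alpha = beta], and of [t = oo] when [alpha = 0]. *)
Let alpha := nA + W z * nB.
Let beta := nC + W z * nD.

Let ja n := toC (jacobi_a w x p n).
Let jb n := toC (jacobi_b w x p n).

Let p00 : pz 0%N = 1 /\ po 0%N = 1.
Proof. by rewrite /pz /po p0 /ceval !map_polyC !hornerC. Qed.

Let Q00 y : Q y 0%N = W y.
Proof.
by rewrite /Q /second_fun /W; apply: cwsumE => m; rewrite p0 hornerC mulr1.
Qed.

Let u00 : u 0%N = W z. Proof. exact: Q00. Qed.
Let o00 : o 0%N = W 0. Proof. exact: Q00. Qed.

Let rec_u : recurrence ja jb z 1 u := second_recurrence zt z_neq.
Let rec_o : recurrence ja jb 0 1 o := second_recurrence ot o_neq.
Let rec_po : recurrence ja jb 0 0 po := ceval_recurrence 0.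

Let lim1 : ccvg (fun n => wronskian jb u po n) beta.
Proof.
have S1 : ccvg (fun n => 1 + z * (\sum_(j < n.+1) po j * r z j) +
    W z * (z * (\sum_(j < n.+1) po j * pz j))) beta.
  apply: ccvgD.
    apply: ccvgD; first exact: ccvg_cst.
    by apply: ccvgZ; apply: (@ccvg_shift _ (fun n => \sum_(j < n) po j * r z j)); exact: cseries_ccvg.
  apply: ccvgZ; apply: ccvgZ; apply: (@ccvg_shift _ (fun n => \sum_(j < n) po j * pz j)).
  exact: cseries_ccvg.
move: S1; congr (ccvg _ _); apply/funext => n.
have := green n rec_u rec_po; rewrite subr0 mul1r mul0r addr0 p00.2 => G.
have -> : wronskian jb u po n = z * (\sum_(j < n.+1) u j * po j) + 1 by rewrite G; ring.
have -> : \sum_(j < n.+1) u j * po j = \sum_(j < n.+1) po j * r z j +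
    W z * (\sum_(j < n.+1) po j * pz j).
  rewrite mulr_sumr -big_split /=; apply: eq_bigr => j _.
  by rewrite rE; ring.
by ring.
Qed.

Let lim2 : ccvg (fun n => wronskian jb u o n) (alpha + W 0 * beta).
Proof.
have S1 : ccvg (fun n => (z * (\sum_(j < n.+1) r 0 j * r z j) +
    W z * (-1 + z * (\sum_(j < n.+1) r 0 j * pz j))) +
    W 0 * ((1 + z * (\sum_(j < n.+1) po j * r z j)) +
    W z * (z * (\sum_(j < n.+1) po j * pz j)))) (alpha + W 0 * beta).
  have cv (v v' : nat -> R[i]) : cl2 v -> cl2 v' ->
      ccvg (fun n => \sum_(j < n.+1) v j * v' j) (cseries (fun n => v n * v' n)).
    by move=> l1 l2; apply: (@ccvg_shift _ (fun n => \sum_(j < n) v j * v' j)); exact: cseries_ccvg.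
  apply: ccvgD.
    apply: ccvgD; first by apply: ccvgZ; exact: cv.
    apply: ccvgZ; apply: ccvgD; first exact: ccvg_cst.
    by apply: ccvgZ; exact: cv.
  apply: ccvgZ; apply: ccvgD; last by apply: ccvgZ; apply: ccvgZ; exact: cv.
  by apply: ccvgD; [exact: ccvg_cst|apply: ccvgZ; exact: cv].
move: S1; congr (ccvg _ _); apply/funext => n.
have := green n rec_u rec_o; rewrite subr0 !mul1r u00 o00 => G.
have -> : wronskian jb u o n = z * (\sum_(j < n.+1) u j * o j) + W 0 - W z.
  by rewrite G; ring.
have -> : \sum_(j < n.+1) u j * o j = \sum_(j < n.+1) r 0 j * r z j +
    W z * (\sum_(j < n.+1) r 0 j * pz j) + W 0 * (\sum_(j < n.+1) po j * r z j) +
    W 0 * W z * (\sum_(j < n.+1) po j * pz j).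
  rewrite !mulr_sumr -!big_split /=; apply: eq_bigr => j _.
  by rewrite rE roE; ring.
by ring.
Qed.

Let toC_conj (y : R) : conjc (toC y) = toC y.
Proof. by rewrite /conjc /= oppr0. Qed.

Let cjM (c d : R[i]) : conjc (c * d) = conjc c * conjc d. Proof. exact: rmorphM. Qed.
Let cjD (c d : R[i]) : conjc (c + d) = conjc c + conjc d. Proof. exact: rmorphD. Qed.
Let cjB (c d : R[i]) : conjc (c - d) = conjc c - conjc d. Proof. exact: rmorphB. Qed.
Let jb_conj n : conjc (jb n) = jb n. Proof. exact: toC_conj. Qed.

Let po_conj n : conjc (po n) = po n.
Proof. by rewrite /po -[0]/(toC 0) ceval_toC toC_conj. Qed.

Let W0_conj : conjc (W 0) = W 0.
Proof.
have -> : W 0 = toC (wsum w (fun m => (x m)^-1)).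
  by rewrite -cwsum_real; apply: cwsumE => m; rewrite /rz subr0 fmorphV.
exact: toC_conj.
Qed.

Let o_conj n : conjc (o n) = o n.
Proof.
have -> : o n = toC (wsum w (fun m => (x m)^-1 * (p n).[x m])).
  rewrite -cwsum_real; apply: cwsumE => m; rewrite subr0.
  by rewrite (rmorphM toC) (fmorphV toC).
exact: toC_conj.
Qed.

Let wconj (v : nat -> R[i]) n : (forall n, conjc (v n) = v n) ->
  wronskian jb ub v n = conjc (wronskian jb u v n).
Proof.
by move=> vc; rewrite /wronskian /ub cjM cjB !cjM !vc jb_conj.
Qed.

(** The squared norm of the projection of [1 / (x - z)] on the closed span of
    the polynomials, in terms of the Nevanlinna functions. *)
Lemma projection_norm : (z - conjc z) *
    toC (limn (series (fun n => sqn (u n)))) + conjc (W z) - W z =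
  alpha * conjc beta - beta * conjc alpha.
Proof.
have rec_ub : recurrence ja jb (conjc z) 1 ub := recurrence_conj rec_u.
have c3 : ccvg (fun n => wronskian jb u ub n) ((z - conjc z) *
    toC (limn (series (fun n => sqn (u n)))) + conjc (W z) - W z).
  have cs : ccvg (fun n => \sum_(j < n.+1) u j * ub j)
      (toC (limn (series (fun n => sqn (u n))))).
    apply: (@ccvg_shift _ (fun n => \sum_(j < n) u j * ub j)).
    have E n : \sum_(j < n) u j * ub j = toC (series (fun n => sqn (u n)) n).
      rewrite /series /= big_mkord (rmorph_sum toC); apply: eq_bigr => j _.
      rewrite /ub /sqn; case: (u j) => c d; apply: complex_eq => /=; ring.
    rewrite (funext E); split; first exact: (cl2_cvg Qz_l2).
    exact: cvg_cst.
  have : ccvg (fun n => (z - conjc z) * (\sum_(j < n.+1) u j * ub j) + conjc (W z) - W z)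
     ((z - conjc z) * toC (limn (series (fun n => sqn (u n)))) + conjc (W z) - W z).
    apply: ccvgB; last exact: ccvg_cst.
    by apply: ccvgD; [exact: ccvgZ|exact: ccvg_cst].
  congr (ccvg _ _); apply/funext => n.
  have := green n rec_u rec_ub; rewrite !mul1r u00 (_ : ub 0%N = conjc (W z)); last by rewrite /ub u00.
  move=> ->.
  by ring.
have c1 := lim1; have c2 := lim2.
have c1' := ccvg_conj c1; have c2' := ccvg_conj c2.
have c4 n : wronskian jb o po n = 1.
  have := green n rec_o rec_po; rewrite subrr mul0r mul1r mul0r addr0 p00.2.
  by move/esym/eqP; rewrite subr_eq0 => /eqP.
have PL : ccvg (fun n => wronskian jb u ub n)
    ((alpha + W 0 * beta) * conjc beta - beta * conjc (alpha + W 0 * beta)).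
  have : ccvg (fun n => wronskian jb u o n * conjc (wronskian jb u po n) -
      wronskian jb u po n * conjc (wronskian jb u o n))
    ((alpha + W 0 * beta) * conjc beta - beta * conjc (alpha + W 0 * beta)).
    by apply: ccvgB; exact: ccvgM.
  congr (ccvg _ _); apply/funext => n.
  have := wronskian_plucker jb u ub o po n; rewrite c4 mulr1 => ->.
  by rewrite (wconj _ po_conj) (wconj _ o_conj).
rewrite (ccvg_unique c3 PL) cjD cjM W0_conj; ring.
Qed.

(** For a constant parameter the right-hand side of [projection_norm] vanishes,
    and [1 / (x - z)] would be as long as its projection. *)
Lemma not_extremal : ~ extremal mu P.
Proof.
move=> [t ht]; have := ht z z_im; rewrite mu_stieltjes => Wt.
have ImW : complex.Im (W z) = complex.Im z * wsum w (fun m => sqn (rz z m)).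
  have [t1 t2] := zt.
  rewrite /W /= -(wsumZ q0 q1 w_rapid); last first.
    by apply: tameD => //; apply: tame_exp.
  apply: wsumE => m; rewrite /rz; have := z_neq m; case: (z) => c d.
  rewrite eq_complex /= sub0r oppr_eq0 => cd.
  have n0 : (x m - c) ^+ 2 + d ^+ 2 != 0.
    by rewrite paddr_eq0 ?sqr_ge0// !expf_eq0.
  by rewrite /sqn /= !sub0r sqrrN; field; rewrite ?sqrrN.
have [eta eta0 Heta] := z_strict.
have Sgt : 0 < wsum w (fun m => sqn (rz z m)).
  by have := Heta 0%N; rewrite big_ord0 subr_ge0; exact: lt_le_trans.
have W0 : W z != 0.
  apply/eqP => W0; move: ImW; rewrite W0 /= => /esym/eqP.
  by rewrite mulf_eq0 (negPf z_im) gt_eqF.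
have cross : alpha * conjc beta - beta * conjc alpha = 0.
  case: t {ht} Wt => [s|] /=.
    rewrite -/nA -/nB -/nC -/nD => Wt.
    have [d0|d0] := eqVneq (nB * toC s - nD) 0.
      by move: W0; rewrite Wt d0 invr0 mulr0 eqxx.
    have bE : beta = toC s * alpha.
      have : W z * (nB * toC s - nD) = - (nA * toC s - nC) by rewrite Wt divfK.
      rewrite /alpha /beta => H.
      have -> : toC s * (nA + W z * nB) = toC s * nA + W z * (nB * toC s - nD) + W z * nD.
        by ring.
      by rewrite H; ring.
    by rewrite bE cjM toC_conj; ring.
  rewrite -/nA -/nB => Wt.
  have [d0|d0] := eqVneq nB 0.
    by move: W0; rewrite Wt d0 invr0 mulr0 eqxx.
  have -> : alpha = 0 by rewrite /alpha Wt; field.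
  by rewrite mul0r conjc0 mulr0 subrr.
have := projection_norm; rewrite cross; set E := limn _ => PN.
have EE : complex.Im z * E = complex.Im (W z).
  have := congr1 (@complex.Im R) PN; rewrite !cImD cImM.
  move: (z) (W z) => [c d] [e f] /=; lra.
have ES : E = wsum w (fun m => sqn (rz z m)).
  by apply: (mulfI z_im); rewrite EE ImW.
have : E <= wsum w (fun m => sqn (rz z m)) - eta.
  apply: limr_le; first exact: (cl2_cvg Qz_l2).
  by apply: nearW => n; rewrite /series /= big_mkord.
by rewrite ES lerBrDr gerDl leNgt eta0.
Qed.

End Nevanlinna.

(** * The orthogonality measures of the dual big q-Jacobi polynomials *)

(** Points [c + i d] with [c <= 0], to the left of a positive increasing sequence. *)
Section LeftPoint.
Context {R : realType} (q : R) (x : nat -> R).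
Hypotheses (x_gt0 : 0 < x 0%N) (x_lt : forall m n, (m < n)%N -> x m < x n).
Variables (c d : R).
Hypothesis c_le0 : c <= 0.
Local Notation toC := (real_complex R).
Let z : R[i] := Complex c d.

Let dist m := Normc.normc (toC (x m) - z).

Let x_le m n : (m <= n)%N -> x m <= x n.
Proof. by rewrite leq_eqVlt => /orP[/eqP ->//|/x_lt/ltW]. Qed.

Let xc_gt0 m : 0 < x m - c.
Proof. by have := x_le (leq0n m); have := x_gt0; have := c_le0; lra. Qed.

Let distE m : dist m = Num.sqrt ((x m - c) ^+ 2 + d ^+ 2).
Proof. by rewrite /dist /= sub0r sqrrN. Qed.

Let dist_gt0 m : 0 < dist m.
Proof. by rewrite distE sqrtr_gt0 ltr_pwDl ?exprn_gt0 ?sqr_ge0. Qed.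

Let dist_le m n : (m <= n)%N -> dist m <= dist n.
Proof.
move=> mn; rewrite !distE ler_wsqrtr// lerD2r ler_pXn2r ?nnegrE ?(ltW (xc_gt0 _))//.
by rewrite lerB// x_le.
Qed.

Let dist_lt : dist 0 < dist 1.
Proof.
rewrite !distE ltr_sqrt; last by rewrite ltr_pwDl ?exprn_gt0 ?sqr_ge0.
by rewrite ltrD2r ltr_pXn2r ?nnegrE ?(ltW (xc_gt0 _))// ltrD2r x_lt.
Qed.

Lemma left_neq m : toC (x m) - z != 0.
Proof.
by have := dist_gt0 m; apply: contraTneq => e; rewrite /dist e Normc.normc0 ltxx.
Qed.

Lemma left_tame : ctame q (fun m => (toC (x m) - z)^-1).
Proof.
have bd (f : R[i] -> R) : (forall u, `|f u| <= Normc.normc u) ->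
    tame q (fun m => f (toC (x m) - z)^-1).
  move=> fn; exists 0%N, (dist 0)^-1 => m; rewrite mul0n mulr1.
  apply: le_trans (fn _) _; rewrite Normc.normcV lef_pV2 ?posrE ?dist_gt0//.
  exact: dist_le.
split; apply: bd => u; first exact: ler_Re_normc.
by case: u => e f /=; rewrite -[X in X <= _]sqrtr_sqr ler_wsqrtr// lerDr sqr_ge0.
Qed.

Lemma left_far : exists theta, [/\ 0 <= theta, theta < 1 &
  forall m, Normc.normc ((toC (x 0%N) - z) / (toC (x m.+1) - z)) <= theta].
Proof.
exists (dist 0 / dist 1); split.
- by rewrite divr_ge0// ltW.
- by rewrite ltr_pdivrMr ?dist_gt0// mul1r.
- move=> m; rewrite Normc.normcM Normc.normcV ler_wpM2l ?(ltW (dist_gt0 0))//.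
  by rewrite lef_pV2 ?posrE ?dist_gt0// dist_le.
Qed.

End LeftPoint.

Section Discrete.
Context {R : realType} (q : R) (q0 : 0 < q) (q1 : q < 1).

Lemma discrete_poly (v y : nat -> R) mu (p : {poly R}) : (forall m, 0 <= v m) ->
  rapid q (fun m => v m * p.[y m]) -> discrete_like v y mu ->
  mu.-integrable setT (fun t : R => (p.[t])%:E) /\
  Rintegral mu setT (fun t : R => p.[t]) = ssum (fun m => v m * p.[y m]).
Proof.
move=> v0 rv muE.
have cv : cvgn (series (fun m => v m * `|p.[y m]|)).
  rewrite (_ : (fun m => _) = (fun m => `|v m * p.[y m]|)); last first.
    by apply/funext => m; rewrite normrM ger0_norm.
  exact: (rapid_normed_cvg q0 q1 rv).
split; first exact: (discrete_integrable v0 muE (measurable_horner p) cv).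
exact: (discrete_Rintegral v0 muE (measurable_horner p) cv).
Qed.

Lemma discrete_orthogonality (v y : nat -> R) mu (P : nat -> {poly R}) :
  (forall m, 0 <= v m) -> (forall p : {poly R}, rapid q (fun m => v m * p.[y m])) ->
  discrete_like v y mu ->
  (forall n k, n != k -> ssum (fun m => v m * (P n * P k).[y m]) = 0) ->
  (forall n, 0 < ssum (fun m => v m * (P n * P n).[y m])) ->
  orthogonality_measure P mu.
Proof.
move=> v0 rv muE Porth Ppos.
have int p := discrete_poly v0 (rv p) muE.
split; [|split].
- move=> k; have [+ _] := int 'X^k.
  by rewrite (_ : (fun t : R => _) = (fun t => (t ^+ k)%:E))//; apply/funext => t; rewrite hornerXn.
- move=> n k nk; have [_] := int (P n * P k); rewrite Porth// => <-.
  by congr (Rintegral _ _ _); apply/funext => t; rewrite hornerM.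
- move=> n; have [_ e] := int (P n * P n); have := Ppos n; rewrite -e.
  by congr (0 < Rintegral _ _ _); apply/funext => t; rewrite hornerM expr2.
Qed.

Lemma discrete_neq (v y v' y' : nat -> R) mu nu i : discrete_like v y mu ->
  discrete_like v' y' nu -> (forall m, 0 <= v' m) -> 0 < v' i ->
  (forall m, y m != y' i) ->
  exists2 A : set (measurableTypeR R), measurable A & mu A <> nu A.
Proof.
move=> muE nuE v0 vi yi; pose A : set (measurableTypeR R) := [set y' i].
have mA : measurable A by exact: measurable_set1.
exists A => //; rewrite (muE _ mA) (nuE _ mA).
rewrite eseries0 => [|m _ _]; last first.
  by rewrite diracE memNset ?mule0// => /eqP; apply/negP.
apply/eqP; rewrite lt_eqF//.
have ge0 m : (0 <= (v' m)%:E * \d_(y' m : measurableTypeR R) A)%E.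
  by rewrite mule_ge0// lee_fin.
apply: (@lt_le_trans _ _ (\sum_(0 <= m < i.+1) (v' m)%:E * \d_(y' m : measurableTypeR R) A)%E).
  rewrite big_nat_recr//=.
  apply: (@lt_le_trans _ _ ((v' i)%:E * \d_(y' i : measurableTypeR R) A)%E).
    by rewrite diracE mem_set// mule1 lte_fin.
  by apply: leeDr; apply: sume_ge0 => m _; exact: ge0.
by apply: nneseries_lim_ge => m _ _; exact: ge0.
Qed.

End Discrete.

Lemma measurable_resolvent_i (R : realType) :
  measurable_fun setT (fun t : R => complex.Re (real_complex R t - Complex 0 1)^-1) /\
  measurable_fun setT (fun t : R => complex.Im (real_complex R t - Complex 0 1)^-1).
Proof.
have t0 (t : R) : t ^+ 2 + 1 != 0 by rewrite gt_eqF// ltr_wpDl// sqr_ge0.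
have mV : measurable_fun setT (fun t : R => (t ^+ 2 + 1)^-1).
  apply: continuous_measurable_fun => t; apply: cvgV => //.
  rewrite (_ : (fun t : R => t ^+ 2 + 1) = horner ('X^2 + 1)); last first.
    by apply/funext => y; rewrite hornerD hornerXn hornerC.
  have -> : t ^+ 2 + 1 = ('X^2 + 1).[t] by rewrite hornerD hornerXn hornerC.
  exact: continuous_horner.
split.
  rewrite (_ : (fun t : R => _) = (fun t : R => t * (t ^+ 2 + 1)^-1)).
    exact: measurable_funM.
  apply/funext => t /=; rewrite subr0 sub0r sqrrN expr1n.
  by rewrite ?mulrN.
rewrite (_ : (fun t : R => _) = (fun t : R => (t ^+ 2 + 1)^-1))//.
by apply/funext => t /=; rewrite subr0 sub0r sqrrN expr1n; field.
Qed.

(** [w] and [x] are the normalized weights and the lattice. *)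
Section DualBigQJacobi.
Context {R : realType} (q a b c : R) (q0 : 0 < q) (q1 : q < 1).
Hypothesis H : params q a b c.

Let x := dual_lattice q a b.
Let M := mass q a b c.
Let w m := dbqJ_weight q a b c m / M.
Let h := annihilator q (a * b * q).
Let D := dbqJ q a b c.

Let M_gt0 : 0 < M. Proof. exact: mass_gt0. Qed.
Let w_gt0 m : 0 < w m. Proof. by rewrite divr_gt0 ?weight_gt0. Qed.
Let w_ge0 m : 0 <= w m. Proof. exact: ltW. Qed.
Let w_rapid : rapid q w.
Proof.
have := rapidZ M^-1 (weight_rapid q0 q1 H); congr rapid.
by apply/funext => m; rewrite mulrC.
Qed.
Let x_tame : tame q x. Proof. exact: lattice_tame. Qed.
Let wp_rapid (p : {poly R}) : rapid q (fun m => w m * p.[x m]).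
Proof. by apply: rapidMtame => //; exact: tame_horner. Qed.

Let wmomE (p : {poly R}) : ssum (fun m => w m * p.[x m]) = wmom q a b c p / M.
Proof.
rewrite mulrC -(ssumZ q0 q1); last exact: weightMpoly_rapid.
by apply: ssumE => m; rewrite mulrAC mulrC.
Qed.

Let w_mass : ssum w = 1.
Proof.
rewrite -[RHS](mulVf (lt0r_neq0 M_gt0)) -(ssumZ q0 q1); last exact: weight_rapid.
by apply: ssumE => m; rewrite mulrC.
Qed.

Let D_orth n k : ssum (fun m => w m * (D n * D k).[x m]) =
  dbqJ_norm q a b c n / M * (n == k)%:R.
Proof.
rewrite wmomE; case: (ltngtP n k) => nk.
- by rewrite mulrC [D n * _]mulrC wmom_dbqJ_lt ?size_dbqJ// !mulr0.
- by rewrite wmom_dbqJ_lt ?size_dbqJ// mul0r mulr0.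
- by rewrite -nk wmom_dbqJ_sq// mulr1.
Qed.

Let D_pos n : 0 < ssum (fun m => w m * (D n * D n).[x m]).
Proof. by rewrite D_orth eqxx mulr1 divr_gt0 ?dbqJ_norm_gt0. Qed.

Let D_orth0 n k : n != k -> ssum (fun m => w m * (D n * D k).[x m]) = 0.
Proof. by move=> nk; rewrite D_orth (negPf nk) mulr0. Qed.

Let h_poly (p : {poly R}) : ssum (fun m => h m * p.[x m]) = 0.
Proof. exact: annihilator_poly H. Qed.

Let hw_tame : tame q (fun m => h m / w m).
Proof.
have := tameZ q0 M (ann_quot_tame q0 q1 H); congr tame.
apply/funext => m; rewrite /h (annihilatorE q0 q1 m H) /w.
have := lt0r_neq0 (weight_gt0 q0 q1 m H); have := lt0r_neq0 M_gt0.
by move: (dbqJ_weight _ _ _ _ _) M => W N N0 W0; field; rewrite N0 W0.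
Qed.

Lemma dbqJ_measure_exists : exists mu : probability (measurableTypeR R) R,
  discrete_like w x mu.
Proof.
apply: discrete_probability => //; rewrite -w_mass; exact: (rapid_cvg_to q0 q1).
Qed.

Lemma dbqJ_measure_orthogonality mu : discrete_like w x mu ->
  orthogonality_measure D mu.
Proof. by move=> muE; exact: (discrete_orthogonality q0 q1 w_ge0 wp_rapid muE D_orth0 D_pos). Qed.

Lemma dbqJ_indeterminate : indeterminate D.
Proof.
have [mu muE] := dbqJ_measure_exists.
have [g g0 gap] := lattice_gap q0 q1 H.
have [v [y [v0 rv vE [i vi yi]]]] := second_solution q0 q1 w_gt0 w_rapid x_tame
  (fun m => annihilator_sign q0 q1 m H) hw_tame h_poly g0 gap (lattice_inv q0 q1 a b).
have v1 : series v @ \oo --> (1 : R).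
  have e : (fun m => v m * (1 : {poly R}).[y m]) = v.
    by apply/funext => m; rewrite hornerC mulr1.
  have <- : ssum v = 1.
    by rewrite -e vE -w_mass; apply: ssumE => m; rewrite hornerC mulr1.
  by apply: (rapid_cvg_to q0 q1); rewrite -e.
have [nu nuE] := discrete_probability y v0 v1.
exists mu, nu; split.
- exact: dbqJ_measure_orthogonality.
- apply: (discrete_orthogonality q0 q1 v0 rv nuE) => [n k nk|n]; rewrite vE.
  + exact: D_orth0.
  + exact: D_pos.
- exact: (discrete_neq muE nuE v0 vi yi).
Qed.

Lemma dbqJ_not_extremal mu : discrete_like w x mu -> ~ extremal mu D.
Proof.
move=> muE.
have mu_poly (s : {poly R}) : Rintegral mu setT (fun t : R => s.[t]) = wsum w (fun m => s.[x m]).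
  by have [_] := discrete_poly q0 q1 w_ge0 (wp_rapid s) muE.
pose nrm n := Rintegral mu setT (fun t : R => (D n).[t] ^+ 2).
have nrmE n : nrm n = wsum w (fun m => (D n * D n).[x m]).
  by rewrite -mu_poly; congr (Rintegral _ _ _); apply/funext => t; rewrite hornerM expr2.
have nrm_gt0 n : 0 < nrm n by rewrite nrmE D_pos.
pose p := orthonormalized mu D.
have pE n : p n = (Num.sqrt (nrm n))^-1 *: D n by [].
have s0 n : Num.sqrt (nrm n) != 0 by rewrite gt_eqF ?sqrtr_gt0.
have p_size n : size (p n) = n.+1 by rewrite pE size_scale ?invr_eq0// size_dbqJ.
have p_orth n k : wsum w (fun m => (p n).[x m] * (p k).[x m]) = (n == k)%:R.
  transitivity ((Num.sqrt (nrm n))^-1 * (Num.sqrt (nrm k))^-1 *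
      ssum (fun m => w m * (D n * D k).[x m])).
    rewrite -(ssumZ q0 q1)//; apply: ssumE => m.
    by rewrite !pE !hornerZ hornerM; ring.
  have [<-|nk] := eqVneq n k; last by rewrite D_orth0// mulr0.
  have -> : ssum (fun m => w m * (D n * D n).[x m]) = nrm n by rewrite nrmE.
  rewrite -invfM -expr2 sqr_sqrtr ?(ltW (nrm_gt0 n))// mulVf//.
  by rewrite gt_eqF.
have D0 : D 0%N = 1.
  rewrite /D /dbqJ big_ord1 big_ord0 !qpoch0 expr0 !mulr1 divr1; exact: scale1r.
have p0 : p 0%N = 1.
  have n1 : nrm 0%N = 1.
    rewrite nrmE D0 mulr1 -w_mass; apply: ssumE => m.
    by rewrite hornerC mulr1.
  by rewrite pE n1 sqrtr1 invr1 scale1r D0.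
have [g g0 gap] := lattice_gap q0 q1 H.
have x_lt m n : (m < n)%N -> x m < x n.
  by move=> mn; apply: lt_le_trans (gap_lt g0 gap mn); rewrite ltrDl.
have x0 : 0 < x 0%N by exact: lattice_gt0 H.
have h0 : h 0%N != 0.
  by have := annihilator_sign q0 q1 0 H; rewrite expr0 mul1r; exact: lt0r_neq0.
have l0 : (0 : R) <= 0 by [].
(* the Nevanlinna formula is contradicted at [z = i]; the point [0] enters its
   definition *)
have zt := left_tame q x0 x_lt 1 l0; have zn := left_neq x0 x_lt 1 l0.
have ot := left_tame q x0 x_lt 0 l0; have on := left_neq x0 x_lt 0 l0.
have [thz [thz0 thz1 zfar]] := left_far x0 x_lt 1 l0.
have [tho [tho0 tho1 ofar]] := left_far x0 x_lt 0 l0.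
have zim : complex.Im (Complex 0 1 : R[i]) != 0 by rewrite /= oner_neq0.
apply: (@not_extremal R q q0 q1 w x w_rapid x_tame mu D mu_poly p_size p_orth p0
  (Complex 0 1) zt zn ot on zim).
- exact: (ceval_l2 q0 q1 w_gt0 w_rapid x_tame zt zn thz0 thz1 zfar h0 hw_tame h_poly p_orth).
- exact: (ceval_l2 q0 q1 w_gt0 w_rapid x_tame ot on tho0 tho1 ofar h0 hw_tame h_poly p_orth).
- exact: (second_fun_l2 q0 q1 w_gt0 w_rapid x_tame zt p_orth).
- exact: (second_fun_l2 q0 q1 w_gt0 w_rapid x_tame ot p_orth).
- exact: (second_fun_strict q0 q1 w_gt0 w_rapid x_tame zt zn thz0 thz1 zfar h0 hw_tame h_poly p_orth).
- have [m1 m2] := measurable_resolvent_i R; have [t1 t2] := zt.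
  have abs (f : R -> R) : tame q (fun m => f (x m)) -> cvgn (series (fun m => w m * `|f (x m)|)).
    move=> tf; apply: (rapid_cvg q0 q1); apply: rapidMtame => //.
    by apply: (tame_le q0 _ tf) => m; rewrite normr_id.
  apply: complex_eq => /=.
  + exact: (discrete_Rintegral w_ge0 muE m1 (abs _ t1)).
  + exact: (discrete_Rintegral w_ge0 muE m2 (abs _ t2)).
Qed.

End DualBigQJacobi.

Theorem mainTheorem2 (R : realType) (q a b c : R)
    (hq0 : 0 < q) (hq1 : q < 1) (ha0 : 0 < a) (ha1 : a < q^-1)
    (hb0 : 0 < b) (hb1 : b < q^-1) (hc : c < 0) :
  (forall n n' : nat,
     series (fun m : nat => dbqJ_weight q a b c m *
               (dbqJ q a b c n).[dual_lattice q a b m] *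
               (dbqJ q a b c n').[dual_lattice q a b m]) @ \oo -->
     dbqJ_norm q a b c n * (n == n')%:R) /\
  indeterminate (dbqJ q a b c) /\
  exists mu : probability (measurableTypeR R) R,
    [/\ is_dbqJ_measure q a b c mu,
        orthogonality_measure (dbqJ q a b c) mu &
        ~ extremal mu (dbqJ q a b c)].
Proof.
have H : params q a b c.
  by split; rewrite // -ltr_pdivlMr// div1r.
split; first by move=> n n'; exact: (dbqJ_orthogonality hq0 hq1 H).
split; first exact: (dbqJ_indeterminate hq0 hq1 H).
have [mu muE] := dbqJ_measure_exists hq0 hq1 H.
exists mu; split; first exact: muE.
- exact: (dbqJ_measure_orthogonality hq0 hq1 H muE).
- exact: (dbqJ_not_extremal hq0 hq1 H muE).
Qed.
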